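(* Let $S$ be a set of $n$ points in the plane with pairwise distinct $x$-coordinates, given in a read-only array sorted in increasing order of $x$-coordinate. Then the edges of a triangulation of $S$ can be reported within each of the following resource bounds: (a) in $O(n^2)$ time using $O(1)$ variables; (b) in $O(n^2\log n/2^s)$ time using $O(s)$ variables, for any $s \in \Omega(\log\log n)\cap o(\log n)$; (c) in $O(n\log_p n)$ time using $O(p\log_p n)$ variables, for any $2\le p\le n$.
   Context: A triangulation of a finite planar point set $S$ is a maximal plane straight-line graph with vertex set $S$. Model of computation: the input is stored in a read-only array with random access to each point; it may not be changed or reordered. In addition, the algorithm may read and write a stated number of variables (words), each of $\Theta(\log n)$ bits. The usual word RAM operations are available (including the standard constant-time geometric primitives on a constant number of input points). The output is written to a write-only structure: the edges of the triangulation are reported one after another, in no particular order, and they need not be stored. *)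

(* Defs.v *)
(* Uses MathComp, with MathComp-Analysis for the reals and the Landau notations. *)
From HB Require Import structures.
From mathcomp Require Import all_boot all_order all_algebra.
From mathcomp Require Import all_classical all_reals all_analysis.

Set Implicit Arguments.
Unset Strict Implicit.
Unset Printing Implicit Defensive.

Import Order.TTheory GRing.Theory Num.Theory.
Import numFieldNormedType.Exports.

Local Open Scope classical_set_scope.
Local Open Scope ring_scope.

Section Geometry.
Variable R : realType.

Definition segment (a b : R * R) : set (R * R) :=
  [set x | exists t : R, 0 <= t <= 1 /\
     x = ((1 - t) * a.1 + t * b.1, (1 - t) * a.2 + t * b.2)].

(* Positive iff a, b, c make a left turn. *)
Definition cross (a b c : R * R) : R :=
  (b.1 - a.1) * (c.2 - a.2) - (b.2 - a.2) * (c.1 - a.1).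

(* The vertex i is drawn at the point pt i; an edge is an unordered pair of
   vertices, that is, a two-element set. *)
Variables (n : nat) (pt : 'I_n -> R * R).

Definition drawing (e : {set 'I_n}) : set (R * R) :=
  [set x | exists i j : 'I_n, e = [set i; j]%SET /\ segment (pt i) (pt j) x].

Definition plane_graph (E : {set {set 'I_n}}) : Prop :=
  [/\ forall e, e \in E -> #|e| = 2%N,
      forall e k, e \in E -> drawing e (pt k) -> k \in e
    & forall e f x, e \in E -> f \in E -> e != f ->
        drawing e x -> drawing f x ->
        exists k : 'I_n, [/\ k \in e, k \in f & x = pt k]].

Definition triangulation (E : {set {set 'I_n}}) : Prop :=
  plane_graph E /\
  forall E' : {set {set 'I_n}}, plane_graph E' -> E \subset E' -> E' = E.

Definition x_sorted : Prop :=
  forall i j : 'I_n, (i < j)%N -> (pt i).1 < (pt j).1.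

End Geometry.

Section WordRAM.

(* Operands are addresses of the read-write memory, except for the literal k of
   Const and the jump targets l.  Read (mem[d] := mem[mem[a]]) and Write
   (mem[mem[a]] := mem[b]) are the indirect accesses.  The input points can only be accessed through
   CmpX, CmpY and Orient, whose point arguments are given by cells that hold
   indices into the input array; Emit likewise reports an edge by indices. *)
Inductive binop := Oadd | Osub | Omul | Odiv | Omod | Oand | Oor | Oxor | Oshl | Oshr.

Inductive instr :=
| Const (d k : nat)
| Copy (d a : nat)
| Read (d a : nat)
| Write (a b : nat)
| Op (o : binop) (d a b : nat)
| Jump (l : nat)
| JumpEq (a b l : nat)
| JumpLt (a b l : nat)
| CmpX (d i j : nat)
| CmpY (d i j : nat)
| Orient (d i j k : nat)
| Emit (i j : nat)
| Halt.

Definition program := seq instr.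

(* Results are reduced modulo 2 ^ w when written; on words, 2 ^ w + a - b is not
   affected by the truncation of subtraction. *)
Definition eval_op (w : nat) (o : binop) (a b : nat) : nat :=
  match o with
  | Oadd => a + b
  | Osub => 2 ^ w + a - b
  | Omul => a * b
  | Odiv => a %/ b
  | Omod => a %% b
  | Oand => Nat.land a b
  | Oor => Nat.lor a b
  | Oxor => Nat.lxor a b
  | Oshl => a * 2 ^ b
  | Oshr => a %/ 2 ^ b
  end%N.

(* A sign as a word: 0 for zero, 1 for positive, 2 for negative. *)
Definition sign_word (R : realType) (x : R) : nat :=
  if x == 0 then 0%N else if 0 < x then 1%N else 2%N.

Record state (n : nat) := State {
  pc : nat;
  mem : seq nat;
  out : seq ('I_n * 'I_n)
}.

Variables (R : realType) (n : nat) (pt : 'I_n -> R * R).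
Variables (w : nat) (P : program).

Definition point_index (m : seq nat) (a : nat) : option 'I_n :=
  obind insub (onth m a).

Definition goto (l : nat) (s : state n) : option (state n) :=
  Some (State l (mem s) (out s)).

Definition advance (s : state n) : option (state n) := goto (pc s).+1 s.

(* Writing outside the memory is an error; the memory never grows. *)
Definition write (d v : nat) (s : state n) : option (state n) :=
  if (d < size (mem s))%N
  then advance (State (pc s) (set_nth 0%N (mem s) d (v %% 2 ^ w)%N) (out s))
  else None.

Local Notation "'let?' x := a 'in' b" := (obind (fun x => b) a)
  (at level 200, x name, a at level 100, b at level 200).

Definition fetch (s : state n) : instr := nth Halt P (pc s).

Definition halted (s : state n) : bool :=
  if fetch s is Halt then true else false.

(* None means that the machine has halted or that the instruction is erroneous
   (memory or input index out of range); halted tells them apart. *)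
Definition step (s : state n) : option (state n) :=
  let m := mem s in
  match fetch s with
  | Const d k => write d k s
  | Copy d a => let? x := onth m a in write d x s
  | Read d a => let? x := onth m a in let? y := onth m x in write d y s
  | Write a b => let? x := onth m a in let? y := onth m b in write x y s
  | Op o d a b =>
      let? x := onth m a in let? y := onth m b in write d (eval_op w o x y) s
  | Jump l => goto l s
  | JumpEq a b l =>
      let? x := onth m a in let? y := onth m b in
      if x == y then goto l s else advance s
  | JumpLt a b l =>
      let? x := onth m a in let? y := onth m b in
      if (x < y)%N then goto l s else advance s
  | CmpX d i j =>
      let? a := point_index m i in let? b := point_index m j in
      write d (sign_word ((pt a).1 - (pt b).1)) s
  | CmpY d i j =>
      let? a := point_index m i in let? b := point_index m j in
      write d (sign_word ((pt a).2 - (pt b).2)) s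
  | Orient d i j k =>
      let? a := point_index m i in let? b := point_index m j in
      let? c := point_index m k in
      write d (sign_word (cross (pt a) (pt b) (pt c))) s
  | Emit i j =>
      let? a := point_index m i in let? b := point_index m j in
      advance (State (pc s) m ((a, b) :: out s))
  | Halt => None
  end.

Definition run (t : nat) (s : state n) : option (state n) :=
  iter t (obind step) (Some s).

(* The arguments occupy the first cells of the memory, which has v cells in
   total when size args <= v. *)
Definition init (args : seq nat) (v : nat) : state n :=
  State 0 ([seq (a %% 2 ^ w)%N | a <- args] ++ nseq (v - size args) 0%N) [::].

Definition reported_edges (s : state n) : seq {set 'I_n} :=
  [seq [set ij.1; ij.2]%SET | ij <- out s].

(* Each edge is reported exactly once, in either orientation. *)
Definition reports_triangulation (args : seq nat) (t v : nat) : Prop :=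
  (size args <= v)%N /\
  exists s : state n,
    [/\ run t (init args v) = Some s,
        halted s,
        uniq (reported_edges s)
      & triangulation pt [set e in reported_edges s]%SET].

End WordRAM.

(* c * (floor (log_2 n) + 1) bits per word; n < 2 ^ word_size c n when c > 0. *)
Definition word_size (c n : nat) : nat := (c * (trunc_log 2 n).+1)%N.

Definition log_base (R : realType) (p n : nat) : R := ln n%:R / ln p%:R.

(* Main.v *)
(* All points are joined by the x-monotone path.  Call a < b visible from above
   if every point between them lies strictly below the segment ab; a maximal
   non-crossing family of such pairs triangulates the region above the path, and
   together with a maximal family for the region below (without the path edges,
   which would be reported twice) it is a triangulation of the point set.
   Everything about one side uses only the signotope axiom for the predicate
   that b is below ac.

   A family for the points i .. j is found by cutting the path into about q chunks of
   g = ceil((j - i) / q) edges.  In each chunk an edge (l, r), at first a path edge, is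
   widened to the nearest point, left or right, that sees it; the pocket it
   jumps over has fewer than g path edges and is handled recursively.  When an
   edge is stuck it is merged with the edge stored last, if they form an ear, or
   stored itself.  No visible pair passes over an endpoint of a stored edge, so
   at the end the gaps between the at most q stored edges are independent
   recursive calls.  Every level costs linear time and O(q) words, and there are
   log_q n levels.  When a prescribed depth D is reached, the pocket is handled
   instead in quadratic time and constant space: report the visible pairs that
   are not crossed by a visible pair starting further left.
   The bounds (a), (b), (c) are the cases (q, D) = (2, 0), (2, s), (p, n). *)
Require Import Defs.
From HB Require Import structures.
From mathcomp Require Import all_boot all_order all_algebra.
From mathcomp Require Import all_classical all_reals all_analysis.
From mathcomp Require Import zify ring lra.

Set Implicit Arguments.
Unset Strict Implicit.
Unset Printing Implicit Defensive.

(** * Pairs of points visible along the path, and triangulating them *)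

(** [B] is a strict predicate and the two sides use opposite signs, so a point on a segment is below
    it for neither sign: collinear triples are covered, and no visible pair passes through a third
    point. The union is maximal because a further edge would be visible from neither side, so the
    path has points strictly on both sides of it and one path edge crosses it. A level is linear
    because both directions are tested alternately at growing distance [d]: a hit costs [d] rounds
    and covers [d] fresh path edges, which pay for the search and for the recursive call on the
    pocket. A failed search costs at most [g] rounds, charged to the chunk or to the stored edge
    that disappears. For [q = 2] and [D = s] the pockets left to the quadratic procedure have fewer
    than [n / 2 ^ s] edges, which gives [n ^ 2 / 2 ^ s]; the [n log n] of the levels is absorbed
    since [2 ^ s <= n]. On the machine everything is one loop around a branching body, with an
    explicit stack and a mode register. The bounds count rounds of this loop, each of constant
    length. *)

Section Visibility.

(* The sequence abc, abd, acd, bcd changes its value at most once. *)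
Definition signotope4 (abc abd acd bcd : bool) : bool :=
  if abc == bcd then (abd == abc) && (acd == abc)
  else if abc then acd ==> abd else abd ==> acd.

Variable B : nat -> nat -> nat -> bool.
Hypothesis B4 : forall a b c d, a < b -> b < c -> c < d ->
  signotope4 (B a b c) (B a b d) (B a c d) (B b c d).

Definition vis (a b : nat) : Prop :=
  a < b /\ forall k, a < k -> k < b -> B a k b.

(** Interleaving of indices stands in for a proper intersection of segments; for two visible pairs
    of one side the notions agree. The relation is ordered by left ends. *)
Definition crossing (e f : nat * nat) : bool :=
  [&& e.1 < f.1, f.1 < e.2 & e.2 < f.2].

Definition maximal_plane (i j : nat) (F : seq (nat * nat)) : Prop :=
  [/\ uniq F,
      forall e : nat * nat, e \in F -> [/\ i <= e.1, e.2 <= j & vis e.1 e.2],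
      forall e f : nat * nat, e \in F -> f \in F -> ~~ crossing e f
    & forall a b, i <= a -> b <= j -> vis a b -> (a, b) \in F \/
        exists2 e : nat * nat, e \in F & crossing e (a, b) || crossing (a, b) e].

(** Instantiates the axiom at four increasing indices, substitutes the values known from the context
    and tries all values of the others. *)
Ltac sig4 a b c d :=
  let H := fresh in
  (have H : signotope4 (B a b c) (B a b d) (B a c d) (B b c d)
    by apply: B4; lia);
  move: H; rewrite /signotope4;
  repeat match goal with
  | H : is_true (B ?x ?y ?z) |- context [B ?x ?y ?z] => rewrite H
  | H : is_true (~~ B ?x ?y ?z) |- context [B ?x ?y ?z] => rewrite (negbTE H)
  end;
  repeat match goal with |- context [B ?x ?y ?z] => case: (B x y z) end;
  try done.

Lemma vis_adj a : vis a a.+1.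
Proof. by split=> // k; lia. Qed.

(** A point below [ab] or below [bc] is below [ac], because the apex [b] is. *)
Lemma vis_merge a b c : vis a b -> vis b c -> B a b c -> vis a c.
Proof.
move=> [ab vab] [bc vbc] abc; split=> [|k ak kc]; first lia.
case: (ltngtP k b) => [kb|bk|->//].
- by have akb := vab _ ak kb; sig4 a k b c.
- by have bkc := vbc _ bk kc; sig4 a b k c.
Qed.

(** Before [z] the path stays on or below the line [lr], and [z] is above it, so the pocket lies
    below the segment [rz]. *)
Lemma vis_pocket_r l r z : vis l r -> r < z -> B l r z ->
  (forall k, r < k -> k < z -> ~~ B l r k) -> vis r z.
Proof.
move=> [lr _] rz lrz H; split=> // k rk kz.
by have := H _ rk kz => nk; sig4 l r k z.
Qed.

Lemma vis_pocket_l l r z : vis l r -> z < l -> B z l r ->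
  (forall k, z < k -> k < l -> ~~ B k l r) -> vis z l.
Proof.
move=> [lr _] zl zlr H; split=> // k zk kl.
by have := H _ zk kl => nk; sig4 z k l r.
Qed.

Lemma maximal_plane_nil i : maximal_plane i i [::].
Proof.
split=> // a b ia bi [ab _]; lia.
Qed.

Lemma maximal_plane_adj i : maximal_plane i i.+1 [:: (i, i.+1)].
Proof.
split=> //.
- by move=> e; rewrite inE => /eqP -> /=; split=> //; apply: vis_adj.
- by move=> e f; rewrite !inE => /eqP -> /eqP ->; rewrite /crossing /=; lia.
- move=> a b ia bi [ab _]; left; rewrite inE xpair_eqE; lia.
Qed.

Lemma maximal_plane_mem l r F : maximal_plane l r F -> vis l r -> (l, r) \in F.
Proof.
move=> [_ F1 F2 F3] v; case: (F3 l r _ _ v) => // [[e eF]].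
by have [] := F1 _ eF; rewrite /crossing /=; lia.
Qed.

Lemma maximal_plane_cat_uniq i j k F G : maximal_plane i j F ->
  maximal_plane j k G -> uniq (F ++ G).
Proof.
move=> [F0 F1 _ _] [G0 G1 _ _]; rewrite cat_uniq F0 G0 andbT /=.
apply/hasPn => e eG; apply/negP => eF.
have [_ ? [? _]] := F1 _ eF; have [? _ _] := G1 _ eG; lia.
Qed.

(** A pair over the apex [j] other than [(i, k)] starts inside [(i, j)] or ends inside [(j, k)], and
    so interleaves with one of these two edges, which belong to the families. *)
Lemma maximal_plane_tri i j k F G : maximal_plane i j F ->
  maximal_plane j k G -> vis i j -> vis j k -> vis i k ->
  maximal_plane i k ((i, k) :: F ++ G).
Proof.
move=> mF mG vij vjk vik.
have iF := maximal_plane_mem mF vij; have iG := maximal_plane_mem mG vjk.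
have ij : i < j by case: vij.
have jk : j < k by case: vjk.
have uFG := maximal_plane_cat_uniq mF mG.
move: mF mG => [F0 F1 F2 F3] [G0 G1 G2 G3]; split.
- rewrite /= uFG andbT mem_cat; apply/negP => /orP[/F1|/G1] /= [] *; lia.
- move=> e; rewrite inE mem_cat => /or3P[/eqP ->|/F1|/G1]; first (by split);
  move=> [h1 h2 h3]; split=> //; lia.
- move=> e f; rewrite !inE !mem_cat => /or3P[/eqP ->|eF|eG] /or3P[/eqP ->|fF|fG];
  rewrite /crossing /=.
  + lia.
  + have [] := F1 _ fF; lia.
  + have [] := G1 _ fG; lia.
  + have [] := F1 _ eF; lia.
  + exact: F2.
  + have [] := F1 _ eF; have [] := G1 _ fG; lia.
  + have [] := G1 _ eG; lia.
  + have [] := G1 _ eG; have [] := F1 _ fF; lia.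
  + exact: G2.
- move=> a b ia bk vab.
  have ab : a < b by case: vab.
  have [bj|jb] := leqP b j.
    case: (F3 a b ia bj vab) => [h|[e eF he]]; [left|right; exists e => //];
    by rewrite inE mem_cat ?h ?eF orbT.
  have [ja|aj] := leqP j a.
    case: (G3 a b ja bk vab) => [h|[e eF he]]; [left|right; exists e => //];
    by rewrite inE mem_cat ?h ?eF !orbT.
  have [ai|nai] := eqVneq a i; last first.
    right; exists (i, j); first by rewrite inE mem_cat iF orbT.
    rewrite /crossing /=; lia.
  have [bk'|nbk] := eqVneq b k; first by left; rewrite ai bk' mem_head.
  right; exists (j, k); first by rewrite inE mem_cat iG !orbT.
  rewrite /crossing /=; lia.
Qed.

Definition no_over (i j v : nat) : Prop :=
  forall a b, i <= a -> a < v -> v < b -> b <= j -> ~~ B a v b.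

(** Gluing without a closing edge. It serves at the ends of stored edges, over which nothing visible
    passes. *)
Lemma maximal_plane_cat i j k F G : i <= j -> j <= k -> maximal_plane i j F ->
  maximal_plane j k G -> no_over i k j -> maximal_plane i k (F ++ G).
Proof.
move=> ij jk mF mG nov.
have uFG := maximal_plane_cat_uniq mF mG.
move: mF mG => [F0 F1 F2 F3] [G0 G1 G2 G3].
split=> //.
- move=> e; rewrite mem_cat => /orP[/F1|/G1] [? ? ?]; split=> //=; lia.
- move=> e f; rewrite !mem_cat => /orP[eF|eG] /orP[fF|fG].
  + exact: F2.
  + have [_ ? _] := F1 _ eF; have [? _ _] := G1 _ fG; rewrite /crossing; lia.
  + have [? _ [? _]] := G1 _ eG; have [_ ? [? _]] := F1 _ fF.
    rewrite /crossing; lia.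
  + exact: G2.
- move=> a b ia bk vab.
  have ab : a < b by case: vab.
  have [bj|jb] := leqP b j.
    case: (F3 a b ia bj vab) => [h|[e eF he]]; [left|right; exists e => //];
    by rewrite mem_cat ?h ?eF ?orbT.
  have [ja|aj] := leqP j a.
    case: (G3 a b ja bk vab) => [h|[e eF he]]; [left|right; exists e => //];
    by rewrite mem_cat ?h ?eF ?orbT.
  by have := nov a b ia aj jb bk; rewrite (proj2 vab _ aj jb).
Qed.

(** [B x l r] means that the edge could be extended to [x]; an edge with both properties is stuck
    within the range. *)
Definition left_ok (i l r : nat) : Prop := forall x, i <= x -> x < l -> ~~ B x l r.
Definition right_ok (j l r : nat) : Prop := forall x, r < x -> x <= j -> ~~ B l r x.

(** A pair over an end of the edge would give four indices at which two predicates agree while one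
    between them, in the order of the axiom, differs. *)
Lemma stuck_no_over i j l r : vis l r -> left_ok i l r -> right_ok j l r ->
  no_over i j l /\ no_over i j r.
Proof.
move=> [lr v] L R; split=> a b ia av vb bj; apply/negP => avb.
- have := L a ia av => nalr.
  case: (ltngtP b r) => [br|rb|br]; last by move: nalr; rewrite -br avb.
  + by have lbr := v _ vb br; sig4 a l b r.
  + by have := R b rb bj => nlrb; sig4 a l r b.
- have := R b vb bj => nlrb.
  case: (ltngtP a l) => [al|la|al]; last by move: nlrb; rewrite -al avb.
  + by have := L a ia al => nalr; sig4 a l r b.
  + by have lar := v _ la av; sig4 l a r b.
Qed.

(** This lets the leftward search stop at the right end of the last stored edge: a stuck edge that
    does not merge hides everything to its left. *)
Lemma left_ok_step i l r l' r' : vis l r -> vis l' r' -> left_ok i l r ->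
  r <= l' -> right_ok l' l r -> (r = l' -> ~~ B l r r') ->
  (forall x, r <= x -> x < l' -> ~~ B x l' r') -> left_ok i l' r'.
Proof.
move=> [lr v] [lr' v'] L rl' R nm S x ix xl'.
have [rx|xr] := leqP r x; first exact: S.
have nlr : ~~ B l l' r'.
  case: (ltngtP r l') => [h|h|h]; [|lia|by rewrite -h; apply: nm].
  by have := R l' h (leqnn _) => n1; have := S r (leqnn _) h => n2; sig4 l r l' r'.
have nrl : r < l' -> ~~ B l r l' /\ ~~ B r l' r'.
  by move=> h; split; [apply: R|apply: S].
case: (ltngtP x l) => [xl|lx|->//].
- have n1 := L x ix xl.
  case: (ltngtP r l') => [h|h|h]; [|lia|].
  + have [n2 n3] := nrl h.
    have n4 : ~~ B x r l' by sig4 x l r l'.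
    by sig4 x r l' r'.
  + by subst l'; sig4 x l r r'.
- have lxr := v _ lx xr.
  apply/negP => xlr.
  case: (ltngtP r l') => [h|h|h]; [|lia|].
  + have [n2 n3] := nrl h.
    have xrl : B x r l' by sig4 x r l' r'.
    by have/negP[] := n2; sig4 l x r l'.
  + subst l'; move: nlr; suff -> : B l r r' by [].
    by sig4 l x r r'.
Qed.

(** The new edge shields the older one from the right, so a stored edge needs no second look when
    the scanned range grows. *)
Lemma right_ok_step j l r l' r' : vis l r -> vis l' r' -> r <= l' ->
  right_ok l' l r -> (r = l' -> ~~ B l r r') ->
  (r < l' -> ~~ B r l' r') -> right_ok j l' r' -> right_ok j l r.
Proof.
move=> [lr v] [lr' v'] rl' R nm S R' x rx xj.
have [xl'|l'x] := leqP x l'; first exact: R.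
have nrl : r < l' -> ~~ B l r l' /\ ~~ B r l' r'.
  by move=> h; split; [apply: R|apply: S].
have nlr : ~~ B l r r'.
  case: (ltngtP r l') => [h|h|h]; [|lia|exact: nm].
  by have [n1 n2] := nrl h; sig4 l r l' r'.
case: (ltngtP x r') => [xr'|r'x|->//].
- have n2 := v' _ l'x xr'.
  case: (ltngtP r l') => [h|h|h]; [|lia|by subst l'; sig4 l r x r'].
  have [n3 n4] := nrl h.
  apply/negP => lrx.
  have rlx : B r l' x by sig4 l r l' x.
  by have/negP[] := n4; sig4 r l' x r'.
- have n1 := R' x r'x xj.
  case: (ltngtP r l') => [h|h|h]; [|lia|by subst l'; sig4 l r r' x].
  have [n3 n4] := nrl h.
  have n5 : ~~ B r l' x by sig4 r l' r' x.
  by sig4 l r l' x.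
Qed.

(** An edge of the upper hull of the points from [h] to [z] passes over [a]. It is found by moving
    an end of the pair to a point that blocks it, which keeps [a] below. *)
Lemma vis_over h a z : h < a -> a < z -> B h a z ->
  exists c d, [/\ h <= c, c < a, a < d, d <= z & vis c d].
Proof.
have [n le_n] := ubnP (z - h); elim: n => // n IH in h z le_n *.
move=> ha az haz.
have [/allP vhz|] := boolP (all (fun k => B h k z) (iota h.+1 (z - h.+1))).
  exists h, z; split=> //; split=> [|k hk kz]; first lia.
  by apply: vhz; rewrite mem_iota; lia.
case/allPn => k; rewrite mem_iota => hkz nk.
case: (ltngtP k a) => [ka|ak|ka]; last by move: nk; rewrite ka haz.
- have kaz : B k a z by (have hk : h < k by lia); sig4 h k a z.
  have [|||c [d [? ? ? ? ?]]] := IH k z _ _ _ kaz; try lia.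
  by exists c, d; split=> //; lia.
- have hak : B h a k by (have kz : k < z by lia); sig4 h a k z.
  have [|||c [d [? ? ? ? ?]]] := IH h k _ _ _ hak; try lia.
  by exists c, d; split=> //; lia.
Qed.

(** From [a] along [ac] to the crossing point and on along [bd] the slope increases, so the chord
    [ad] runs above this route and above all points below it. *)
Lemma vis_uncross a b c d : a < b -> b < c -> c < d -> vis a c -> vis b d ->
  vis a d.
Proof.
move=> ab bc cd [ac vac] [bd vbd].
have abc := vac _ ab bc; have bcd := vbd _ bc cd.
have acd : B a c d by sig4 a b c d.
have abd : B a b d by sig4 a b c d.
split=> [|k ak kd]; first lia.
case: (ltngtP k c) => [kc|ck|->//].
- by have akc := vac _ ak kc; sig4 a k c d.
- by have bkd := vbd k (ltn_trans bc ck) kd; sig4 a b k d.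
Qed.

(* Unshadowed visible pairs are those that no visible pair starting further left
   crosses. *)
Definition shadowed (i a b : nat) : bool :=
  has (fun h => has (fun z => B h a z) (iota a.+1 (b - a.+1))) (iota i (a - i)).

Lemma shadowedP i a b :
  reflect (exists h z, [/\ i <= h, h < a, a < z, z < b & B h a z])
          (shadowed i a b).
Proof.
apply: (iffP hasP) => [[h] | [h [z [? ? ? ? ?]]]].
  rewrite mem_iota => ih /hasP[z]; rewrite mem_iota => az haz.
  by exists h, z; split=> //; lia.
exists h; first by rewrite mem_iota; lia.
by apply/hasP; exists z => //; rewrite mem_iota; lia.
Qed.

(** Of two crossing pairs the left one shadows the right one, so unshadowed pairs are compatible. By
    [vis_over] the witnesses of a shadow can be taken visible. *)
Lemma unshadowed_maximal i j F : uniq F ->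
  (forall a b, (a, b) \in F <->
     [/\ i <= a, b <= j, vis a b & ~~ shadowed i a b]) ->
  maximal_plane i j F.
Proof.
move=> uF memF; split=> //.
- by move=> [a b] /memF[].
- move=> [a b] [c d] /memF[ia _ [_ vab] _] /memF[_ _ _ /shadowedP ncd].
  apply/negP => /and3P[/= ac cb bd]; apply: ncd.
  by exists a, b; split=> //; apply: vab.
- move=> a b ia bj vab.
  have [sab|nsab] := boolP (shadowed i a b); last by left; apply/memF.
  right.
  have {sab} [c [d [ic ca ad db vcd]]] :
    exists c d, [/\ i <= c, c < a, a < d, d < b & vis c d].
    have /shadowedP[h [z [ih ha az zb /(vis_over ha az)[c [d [hc ca ad dz v]]]]]]
      := sab.
    by exists c, d; split=> //; lia.
  (* If [(c, d)] is itself shadowed, uncrossing it with its shadower gives a visible pair from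
     further left to the same [d], which still crosses [(a, b)]. *)
  have [n le_n] := ubnP c; elim: n => // n IH in c d ic ca ad db vcd le_n *.
  have [|nscd] := boolP (shadowed i c d); last first.
    exists (c, d); first by apply/memF; split=> //; lia.
    by rewrite /crossing /= ca ad db.
  case/shadowedP => h [z [ih hc cz zd /(vis_over hc cz)[c' [d' [hc' c'c cd' d'z v]]]]].
  apply: (IH c' d) => //; try lia.
  by apply: (vis_uncross c'c cd' _ v vcd); lia.
Qed.

End Visibility.

(** * Two maximal families make a triangulation *)

Section PlaneGeometry.

Import Order.TTheory GRing.Theory Num.Theory.
Import numFieldNormedType.Exports.

Local Open Scope classical_set_scope.
Local Open Scope ring_scope.

(** * Orientations and lines over the reals *)

Section Lines.
Variable R : realType.
Implicit Types a b c d x : R * R.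

(** Three-term relations among the orientations of four points. For increasing abscissae all
    coefficients are positive, which turns them into sign rules. *)
Lemma cross4_bd a b c d :
  (c.1 - b.1) * cross a b d = (d.1 - b.1) * cross a b c + (b.1 - a.1) * cross b c d.
Proof. rewrite /cross; ring. Qed.

Lemma cross4_ac a b c d :
  (c.1 - b.1) * cross a c d = (c.1 - a.1) * cross b c d + (d.1 - c.1) * cross a b c.
Proof. rewrite /cross; ring. Qed.

Lemma cross4_a a b c d :
  (c.1 - a.1) * cross a b d = (b.1 - a.1) * cross a c d + (d.1 - a.1) * cross a b c.
Proof. rewrite /cross; ring. Qed.

Lemma cross4_d a b c d :
  (d.1 - b.1) * cross a c d = (d.1 - c.1) * cross a b d + (d.1 - a.1) * cross b c d.
Proof. rewrite /cross; ring. Qed.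

(** When the outer orientations [abc] and [bcd] have the same sign, both inner ones follow. When
    they differ, one of the other two relations carries positivity from one inner orientation to the
    other. Zero counts as non-positive for either sign of [s]. *)
Lemma signotope4_cross (s : R) a b c d : a.1 < b.1 -> b.1 < c.1 -> c.1 < d.1 ->
  signotope4 (0 < s * cross a b c) (0 < s * cross a b d)
             (0 < s * cross a c d) (0 < s * cross b c d).
Proof.
move=> ab bc cd.
have cb0 : 0 < c.1 - b.1 by lra.
have ca0 : 0 < c.1 - a.1 by lra.
have db0 : 0 < d.1 - b.1 by lra.
have dc0 : 0 < d.1 - c.1 by lra.
have ba0 : 0 < b.1 - a.1 by lra.
have da0 : 0 < d.1 - a.1 by lra.
have e1 : (c.1 - b.1) * (s * cross a b d) =
  (d.1 - b.1) * (s * cross a b c) + (b.1 - a.1) * (s * cross b c d).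
  by rewrite mulrCA cross4_bd; ring.
have e2 : (c.1 - b.1) * (s * cross a c d) =
  (c.1 - a.1) * (s * cross b c d) + (d.1 - c.1) * (s * cross a b c).
  by rewrite mulrCA cross4_ac; ring.
have e3 : (c.1 - a.1) * (s * cross a b d) =
  (b.1 - a.1) * (s * cross a c d) + (d.1 - a.1) * (s * cross a b c).
  by rewrite mulrCA cross4_a; ring.
have e4 : (d.1 - b.1) * (s * cross a c d) =
  (d.1 - c.1) * (s * cross a b d) + (d.1 - a.1) * (s * cross b c d).
  by rewrite mulrCA cross4_d; ring.
move: e1 e2 e3 e4.
move: (s * cross a b c) (s * cross a b d) (s * cross a c d) (s * cross b c d).
move=> p q r t e1 e2 e3 e4; rewrite /signotope4.
case: (ltP 0 p) => p0; case: (ltP 0 t) => t0 /=.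
- by apply/andP; split; apply/eqP/idP; [rewrite -(pmulr_rgt0 _ cb0) e1|
    rewrite -(pmulr_rgt0 _ cb0) e2]; rewrite addr_gt0 ?mulr_gt0.
- apply/implyP => r0; rewrite -(pmulr_rgt0 _ ca0) e3.
  by rewrite addr_gt0 ?mulr_gt0.
- apply/implyP => q0; rewrite -(pmulr_rgt0 _ db0) e4.
  by rewrite addr_gt0 ?mulr_gt0.
- apply/andP; split; apply/eqP/negbTE; rewrite -leNgt.
    by rewrite -(pmulr_rle0 _ cb0) e1 -oppr_ge0 opprD addr_ge0 // -mulrN
       mulr_ge0 // ?oppr_ge0 // ltW.
  by rewrite -(pmulr_rle0 _ cb0) e2 -oppr_ge0 opprD addr_ge0 // -mulrN
       mulr_ge0 // ?oppr_ge0 // ltW.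
Qed.

Definition line_at a b (t : R) : R :=
  a.2 + (b.2 - a.2) / (b.1 - a.1) * (t - a.1).

Lemma line_at_l a b : line_at a b a.1 = a.2.
Proof. by rewrite /line_at subrr mulr0 addr0. Qed.

Lemma line_at_r a b : a.1 < b.1 -> line_at a b b.1 = b.2.
Proof. by move=> ab; rewrite /line_at divfK ?subr_eq0 ?gt_eqF //; ring. Qed.

Lemma cross_line_at a k b : a.1 < b.1 ->
  cross a k b = (b.1 - a.1) * (line_at a b k.1 - k.2).
Proof.
move=> ab; rewrite /cross /line_at.
have ne : b.1 - a.1 != 0 by rewrite subr_eq0 gt_eqF.
by field.
Qed.

Lemma segmentE a b x : a.1 < b.1 ->
  segment a b x <-> [/\ a.1 <= x.1, x.1 <= b.1 & x.2 = line_at a b x.1].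
Proof.
move=> ab; have ne : b.1 - a.1 != 0 by rewrite subr_eq0 gt_eqF.
have ba0 : 0 < b.1 - a.1 by lra.
split.
  case=> t [/andP[t0 t1] ->] /=; split.
  - by have := mulr_ge0 t0 (ltW ba0); lra.
  - have t1' : 0 <= 1 - t by lra.
    by have := mulr_ge0 t1' (ltW ba0); lra.
  - by rewrite /line_at; field.
case: x => x y /= [ax xb ->]; exists ((x - a.1) / (b.1 - a.1)); split.
  by rewrite divr_ge0 ?ler_pdivrMr //=; lra.
by rewrite /line_at; congr pair; field.
Qed.

Lemma segmentC a b : segment a b = segment b a.
Proof.
apply/seteqP; split=> x [t [t01 ->]]; exists (1 - t); (split; first lra);
  by congr pair; ring.
Qed.

Lemma line_at_affine a b (lo hi t : R) :
  (hi - lo) * line_at a b t = (hi - t) * line_at a b lo + (t - lo) * line_at a b hi.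
Proof. by rewrite /line_at; ring. Qed.

Lemma lines_meet (s : R) a b c d (lo hi : R) : lo < hi ->
  s * line_at a b lo < s * line_at c d lo -> s * line_at c d hi < s * line_at a b hi ->
  exists t, [/\ lo < t, t < hi & line_at a b t = line_at c d t].
Proof.
move=> lohi h1 h2.
have s0 : s != 0 by apply/eqP => s0; move: h1; rewrite s0 !mul0r ltxx.
set p := s * line_at c d lo - s * line_at a b lo.
set q := s * line_at a b hi - s * line_at c d hi.
have p0 : 0 < p by rewrite /p; lra.
have q0 : 0 < q by rewrite /q; lra.
have pq : 0 < p + q by lra.
(* The zero of the affine difference divides the interval in the ratio of the gaps [p] at [lo] and
   [q] at [hi]. *)
exists ((lo * q + hi * p) / (p + q)); split.
- rewrite ltr_pdivlMr //; have : lo * p < hi * p by rewrite ltr_pM2r.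
  by lra.
- rewrite ltr_pdivrMr //; have : lo * q < hi * q by rewrite ltr_pM2r.
  by lra.
- set t := _ / _.
  have t1 : (hi - t) * (p + q) = (hi - lo) * q by rewrite /t; field; lra.
  have t2 : (t - lo) * (p + q) = (hi - lo) * p by rewrite /t; field; lra.
  have hl : (p + q) * s * (hi - lo) != 0.
    by rewrite !mulf_eq0 !negb_or s0 subr_eq0 (gt_eqF pq) (gt_eqF lohi).
  have key a' b' : (p + q) * s * (hi - lo) * line_at a' b' t =
      s * ((hi - lo) * q * line_at a' b' lo + (hi - lo) * p * line_at a' b' hi).
    have -> : (p + q) * s * (hi - lo) * line_at a' b' t =
      s * (p + q) * ((hi - lo) * line_at a' b' t) by ring.
    by rewrite (line_at_affine a' b' lo hi t) -t1 -t2; ring.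
  by apply: (mulfI hl); rewrite !key /p /q; ring.
Qed.

(** The difference of the lines is affine and nonnegative at both ends, so a zero at [t] annihilates
    both terms of the combination of its end values. *)
Lemma lines_touch (s : R) a b c d (lo hi t : R) : lo < hi -> lo <= t -> t <= hi ->
  s * line_at a b lo <= s * line_at c d lo ->
  s * line_at a b hi <= s * line_at c d hi ->
  line_at a b t = line_at c d t ->
  (s * line_at a b lo < s * line_at c d lo -> t = hi) /\
  (s * line_at a b hi < s * line_at c d hi -> t = lo).
Proof.
move=> lohi lot thi h1 h2 e.
have : (hi - t) * (s * line_at c d lo - s * line_at a b lo) +
       (t - lo) * (s * line_at c d hi - s * line_at a b hi) = 0.
  have -> : (hi - t) * (s * line_at c d lo - s * line_at a b lo) +
       (t - lo) * (s * line_at c d hi - s * line_at a b hi) =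
    s * ((hi - t) * line_at c d lo + (t - lo) * line_at c d hi) -
    s * ((hi - t) * line_at a b lo + (t - lo) * line_at a b hi) by ring.
  by rewrite -!line_at_affine e subrr.
set p := s * line_at c d lo - _; set q := s * line_at c d hi - _ => e0.
have p0 : 0 <= p by rewrite subr_ge0.
have q0 : 0 <= q by rewrite subr_ge0.
have hp : 0 <= (hi - t) * p by rewrite mulr_ge0 // subr_ge0.
have hq : 0 <= (t - lo) * q by rewrite mulr_ge0 // subr_ge0.
split=> h.
- have {}hp : (hi - t) * p = 0 by lra.
  move/eqP: hp; rewrite mulf_eq0 subr_eq0 => /orP[/eqP -> //|].
  by rewrite gt_eqF // subr_gt0.
- have {}hq : (t - lo) * q = 0 by lra.
  move/eqP: hq; rewrite mulf_eq0 subr_eq0 => /orP[/eqP -> //|].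
  by rewrite gt_eqF // subr_gt0.
Qed.

End Lines.

(** * From visible families to triangulations *)

Section Points.
Variables (R : realType) (n : nat) (pt : 'I_n -> R * R).
Hypothesis pt_sorted : x_sorted pt.

(* Junk points to the right of the input keep the abscissae increasing. *)
Definition xpt (k : nat) : R * R :=
  if insub k is Some i then pt i
  else ((\sum_(i < n) `|(pt i).1|) + k.+1%:R, 0).

Lemma xptE (i : 'I_n) : xpt i = pt i.
Proof. by rewrite /xpt valK. Qed.

Lemma xpt_mono i j : (i < j)%N -> (xpt i).1 < (xpt j).1.
Proof.
move=> ij; rewrite /xpt; case: insubP => [i' _ ei|]; case: insubP => [j' _ ej|] /=.
- by move: ij; rewrite -ei -ej; apply: pt_sorted.
- move=> _; rewrite (bigD1 i') //= -addrA; apply: (le_lt_trans (ler_norm _)).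
  by rewrite ltrDl ltr_wpDl ?sumr_ge0 // ltr0n.
- by move=> /negP[]; apply: (ltn_trans ij); rewrite -ej; apply: ltn_ord.
- by move=> _ _; rewrite ltrD2l ltr_nat.
Qed.

(* b is strictly below (s > 0) or above (s < 0) the segment from a to c. *)
Definition below (s : R) (a b c : nat) : bool :=
  0 < s * cross (xpt a) (xpt b) (xpt c).

Lemma below4 s a b c d : (a < b)%N -> (b < c)%N -> (c < d)%N ->
  signotope4 (below s a b c) (below s a b d) (below s a c d) (below s b c d).
Proof. by move=> ab bc cd; apply: signotope4_cross; apply: xpt_mono. Qed.

Notation ln a b := (line_at (xpt a) (xpt b)).
Notation px k := (xpt k).1.
Notation py k := (xpt k).2.

Lemma belowE s a k b : (a < b)%N -> below s a k b = (s * py k < s * ln a b (px k)).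
Proof.
move=> /xpt_mono ab; rewrite /below cross_line_at // mulrCA pmulr_rgt0 ?subr_gt0 //.
by rewrite mulrBr subr_gt0.
Qed.

Lemma drawingE (i j : 'I_n) x : (i < j)%N ->
  drawing pt [set i; j]%SET x <-> segment (xpt i) (xpt j) x.
Proof.
move=> ij; have nij : i != j by apply: contraTneq ij => ->; rewrite ltnn.
rewrite !xptE; split=> [[i' [j' [e sx]]]|sx]; last by exists i, j.
have : i \in [set i'; j']%SET by rewrite -e set21.
have : j \in [set i'; j']%SET by rewrite -e set22.
rewrite !inE => /orP[]/eqP ej /orP[]/eqP ei; move: nij sx; rewrite ei ej ?eqxx //.
by rewrite segmentC.
Qed.

Lemma vis_line_le s a b k : vis (below s) a b -> (a <= k)%N -> (k <= b)%N ->
  s * py k <= s * ln a b (px k).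
Proof.
move=> [ab v] ak kb.
have [->|nak] := eqVneq k a; first by rewrite line_at_l.
have [->|nkb] := eqVneq k b; first by rewrite line_at_r ?xpt_mono.
by apply: ltW; rewrite -belowE // v //; lia.
Qed.

(** Without interleaving, the index intervals are nested or share at most an end. If nested, the
    inner segment is weakly below the outer one, strictly at an end that is not shared, so they
    touch only at a shared end. *)
Lemma vis_meet_same s a b c d x : vis (below s) a b -> vis (below s) c d ->
  (a, b) != (c, d) -> ~~ crossing (a, b) (c, d) -> ~~ crossing (c, d) (a, b) ->
  segment (xpt a) (xpt b) x -> segment (xpt c) (xpt d) x ->
  exists k, [/\ k = a \/ k = b, k = c \/ k = d & x = xpt k].
Proof.
wlog lt_ac : a b c d / (c < a)%N || (c == a) && (b <= d)%N.
  move=> W v1 v2 ne n1 n2 s1 s2.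
  have [h|h] := boolP ((c < a)%N || (c == a) && (b <= d)%N); first exact: (W a b c d).
  have h' : (a < c)%N || (a == c) && (d <= b)%N by lia.
  have ne' : (c, d) != (a, b) by rewrite eq_sym.
  by have [k [? ? ?]] := W c d a b h' v2 v1 ne' n2 n1 s2 s1; exists k.
move=> vab vcd ne n1 n2.
have ab : (a < b)%N by case: vab.
have cd : (c < d)%N by case: vcd.
move=> /(segmentE _ (xpt_mono ab))[ax xb ex] /(segmentE _ (xpt_mono cd))[cx xd ex'].
have [da|ad] := leqP d a.
  have ed : d = a.
    apply/eqP; rewrite eqn_leq da leqNgt; apply/negP => /xpt_mono; lra.
  exists a; split; [by left|by right|].
  have e1 : x.1 = px a by subst d; lra.
  by rewrite (surjective_pairing x) (surjective_pairing (xpt a)) ex e1 line_at_l.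
have bd : (b <= d)%N.
  by move: n2 lt_ac; rewrite /crossing /=; lia.
have ca : (c <= a)%N by lia.
have vb : (b < d)%N -> below s c b d.
  by case: vcd => _ v lt_bd; apply: v; [apply: leq_ltn_trans ab|].
have va : (c < a)%N -> below s c a d.
  by case: vcd => _ v lt_ca; apply: v.
have tri : [\/ c = a /\ (b < d)%N, (c < a)%N /\ b = d | (c < a)%N /\ (b < d)%N].
  move: ca bd; rewrite [(c <= a)%N]leq_eqVlt [(b <= d)%N]leq_eqVlt.
  move=> /orP[/eqP eca|lca] /orP[/eqP ebd|lbd]; [|by apply: Or31|by apply: Or32|by apply: Or33].
  by move: ne; rewrite eca ebd eqxx.
have e : ln a b x.1 = ln c d x.1 by rewrite -ex -ex'.
have la : s * ln a b (px a) <= s * ln c d (px a).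
  by rewrite line_at_l; apply: vis_line_le => //; apply: ltnW.
have lb : s * ln a b (px b) <= s * ln c d (px b).
  rewrite line_at_r ?xpt_mono //; apply: vis_line_le => //.
  by apply: leq_trans ca (ltnW ab).
have [h1 h2] := lines_touch (xpt_mono ab) ax xb la lb e.
have at_a : x.1 = px a -> x = xpt a.
  move=> e1.
  by rewrite (surjective_pairing x) (surjective_pairing (xpt a)) ex e1 line_at_l.
have at_b : x.1 = px b -> x = xpt b.
  move=> e1; rewrite (surjective_pairing x) (surjective_pairing (xpt b)) ex e1.
  by rewrite line_at_r ?xpt_mono.
have hb : (c < a)%N -> x.1 = px b.
  by move=> lca; apply: h1; rewrite line_at_l -belowE //; apply: va.
have ha : (b < d)%N -> x.1 = px a.
  by move=> lbd; apply: h2; rewrite line_at_r ?xpt_mono // -belowE //; apply: vb.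
case: tri => [[eca lbd]|[lca ebd]|[lca lbd]].
- by exists a; split; [left|left|apply/at_a/ha].
- by exists b; split; [right|right|apply/at_b/hb].
- by have := xpt_mono ab; rewrite -ha // -hb // ltxx.
Qed.

(* An upper and a lower pair lie on opposite sides of the path through all points. *)
Lemma vis_meet_opp s a b c d x : vis (below s) a b -> vis (below (- s)) c d ->
  (a, b) != (c, d) ->
  segment (xpt a) (xpt b) x -> segment (xpt c) (xpt d) x ->
  exists k, [/\ k = a \/ k = b, k = c \/ k = d & x = xpt k].
Proof.
move=> vab vcd ne.
have ab : (a < b)%N by case: vab.
have cd : (c < d)%N by case: vcd.
move=> /(segmentE _ (xpt_mono ab))[ax xb ex] /(segmentE _ (xpt_mono cd))[cx xd ex'].
have atk k : (k = a \/ k = b) -> x.1 = px k -> x = xpt k.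
  move=> hk e1; rewrite (surjective_pairing x) (surjective_pairing (xpt k)) ex e1.
  by case: hk => ->; rewrite ?line_at_l ?line_at_r ?xpt_mono.
have e : ln c d x.1 = ln a b x.1 by rewrite -ex -ex'.
have [bc|cb] := leqP b c.
  have ebc : b = c.
    apply/eqP; rewrite eqn_leq bc leqNgt; apply/negP => /xpt_mono; lra.
  exists b; split; [by right|by left|]; apply: atk; [by right|].
  by subst c; lra.
have [da|ad] := leqP d a.
  have eda : d = a.
    apply/eqP; rewrite eqn_leq da leqNgt; apply/negP => /xpt_mono; lra.
  exists a; split; [by left|by right|]; apply: atk; [by left|].
  by subst d; lra.
have sep k : (maxn a c <= k)%N -> (k <= minn b d)%N ->
    s * ln c d (px k) <= s * ln a b (px k).
  move=> h1 h2; apply: (@le_trans _ _ (s * py k)).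
    by have := vis_line_le vcd (_ : c <= k)%N (_ : k <= d)%N; rewrite !mulNr lerN2; apply; lia.
  by apply: vis_line_le => //; lia.
have seps k : (maxn a c <= k)%N -> (k <= minn b d)%N ->
    ~~ (((k == a) || (k == b)) && ((k == c) || (k == d))) ->
    s * ln c d (px k) < s * ln a b (px k).
  move=> h1 h2; rewrite negb_and => /orP[]; rewrite negb_or => /andP[k1 k2].
    apply: (@le_lt_trans _ _ (s * py k)).
      by have := vis_line_le vcd (_ : c <= k)%N (_ : k <= d)%N; rewrite !mulNr lerN2; apply; lia.
    by rewrite -belowE //; apply: (proj2 vab); lia.
  apply: (@lt_le_trans _ _ (s * py k)).
    have : below (- s) c k d by apply: (proj2 vcd); lia.
    by rewrite belowE // !mulNr ltrN2.
  by apply: vis_line_le => //; lia.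
have lohi : (maxn a c < minn b d)%N by lia.
have slo : a != c -> s * ln c d (px (maxn a c)) < s * ln a b (px (maxn a c)).
  by move=> nac; apply: seps; [done|exact: ltnW|lia].
have shi : b != d -> s * ln c d (px (minn b d)) < s * ln a b (px (minn b d)).
  by move=> nbd; apply: seps; [exact: ltnW|done|lia].
have xlo : px (maxn a c) <= x.1 by case: (leqP a c).
have xhi : x.1 <= px (minn b d) by case: (leqP b d).
have [h1 h2] := lines_touch (xpt_mono lohi) xlo xhi
  (sep _ (leqnn _) (ltnW lohi)) (sep _ (ltnW lohi) (leqnn _)) e.
have [eac|nac] := eqVneq a c; last first.
  have xe := h1 (slo nac).
  have [ebd|nbd] := eqVneq b d.
    by exists b; split; [right|right|apply: atk; [right|rewrite xe -ebd minnn]].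
  have xe' := h2 (shi nbd).
  by have := xpt_mono lohi; rewrite -xe -xe' ltxx.
have nbd : b != d by apply: contra_neq ne => ->; rewrite eac.
exists a; split; [by left|by left|]; apply: atk; [by left|].
by rewrite (h2 (shi nbd)) eac maxnn.
Qed.

(** At [c] the second segment has its end below the first, at [b] the first has its end below the
    second: their vertical order changes in between. *)
Lemma vis_crossing_meet s a b c d : vis (below s) a b -> vis (below s) c d ->
  (a < c)%N -> (c < b)%N -> (b < d)%N ->
  exists2 x, segment (xpt a) (xpt b) x & segment (xpt c) (xpt d) x.
Proof.
move=> [ab vab] [cd vcd] ac cb bd.
have h1 : s * ln c d (px c) < s * ln a b (px c).
  by rewrite line_at_l -belowE //; apply: vab.
have h2 : s * ln a b (px b) < s * ln c d (px b).
  by rewrite line_at_r ?xpt_mono // -belowE //; apply: vcd.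
have [t [ct tb e]] := lines_meet (xpt_mono cb) h1 h2.
have := xpt_mono ac; have := xpt_mono bd => ? ?.
exists (t, ln a b t); apply/segmentE; rewrite ?xpt_mono //=; split=> //; lra.
Qed.

Lemma bool_switch (f : nat -> bool) k l : (k <= l)%N -> f k != f l ->
  exists m, [/\ (k <= m)%N, (m < l)%N & f m != f m.+1].
Proof.
elim: l => [|l IH] kl ne; first by move: ne; rewrite (_ : k = 0)%N ?eqxx //; lia.
have [h|h] := eqVneq (f l) (f l.+1).
  have kl' : (k <= l)%N.
    by rewrite -ltnS ltn_neqAle kl andbT; apply: contra_neq ne => ->.
  by rewrite -h in ne; have [m [? ? ?]] := IH kl' ne; exists m; split=> //; lia.
exists l; split=> //; rewrite -ltnS ltn_neqAle kl andbT.
by apply: contra_neq ne => ->.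
Qed.

Lemma plane_graph_disjoint (E : {set {set 'I_n}}) (i j k l : 'I_n) x :
  plane_graph pt E -> (i < j)%N -> (k < l)%N ->
  [set i; j]%SET \in E -> [set k; l]%SET \in E ->
  i != k -> i != l -> j != k -> j != l ->
  segment (xpt i) (xpt j) x -> ~ segment (xpt k) (xpt l) x.
Proof.
move=> [_ _ Epl] ij kl ijE klE ik il jk jl /drawingE-/(_ ij) xij /drawingE-/(_ kl) xkl.
have ne : [set i; j]%SET != [set k; l]%SET.
  by apply/eqP => /setP/(_ i); rewrite !inE eqxx (negbTE ik) (negbTE il).
have [m [mij mkl _]] := Epl _ _ x ijE klE ne xij xkl.
move: mij mkl; rewrite !inE => /orP[]/eqP ->.
  by rewrite (negbTE ik) (negbTE il).
by rewrite (negbTE jk) (negbTE jl).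
Qed.

Lemma belowN s a b c : s != 0 -> cross (xpt a) (xpt b) (xpt c) != 0 ->
  below (- s) a b c = ~~ below s a b c.
Proof.
move=> s0 c0; rewrite /below mulNr oppr_gt0 -leNgt le_eqVlt.
by rewrite mulf_eq0 (negbTE s0) (negbTE c0).
Qed.

(** An edge of [E'] that is visible from one side lies in that family or is crossed by a member of
    it. An edge blocked from both sides has consecutive points on opposite sides, and the path edge
    between them crosses it. *)
Lemma triangulation_of_maximal (F1 F2 : seq (nat * nat)) (E : {set {set 'I_n}}) :
  maximal_plane (below 1) 0 n.-1 F1 -> maximal_plane (below (- 1)) 0 n.-1 F2 ->
  (forall i j : 'I_n, (i < j)%N ->
    ([set i; j]%SET \in E) = ((val i, val j) \in F1 ++ F2)) ->
  (forall e, e \in E -> exists i j : 'I_n, (i < j)%N /\ e = [set i; j]%SET) ->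
  triangulation pt E.
Proof.
move=> mF1 mF2 memE pairE.
have [_ F11 F12 F13] := mF1; have [_ F21 F22 F23] := mF2.
have visE (i j : 'I_n) : (i < j)%N -> [set i; j]%SET \in E ->
    ((val i, val j) \in F1 /\ vis (below 1) i j) \/
    ((val i, val j) \in F2 /\ vis (below (- 1)) i j).
  move=> ij; rewrite memE // mem_cat => /orP[h|h]; [left|right]; split=> //.
    by have [] := F11 _ h.
  by have [] := F21 _ h.
have plE : plane_graph pt E.
  split.
  - move=> e /pairE[i [j [ij ->]]]; rewrite cards2.
    by case: eqVneq ij => // ->; rewrite ltnn.
  - move=> e k /[dup] eE /pairE[i [j [ij ee]]]; subst e.
    rewrite -xptE => /(drawingE _ ij)/(segmentE _ (xpt_mono ij))[ik kj ek].
    have lik : (i <= k)%N by rewrite leqNgt; apply/negP => /xpt_mono; lra.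
    have lkj : (k <= j)%N by rewrite leqNgt; apply/negP => /xpt_mono; lra.
    have [<-|nik] := eqVneq i k; first by rewrite set21.
    have [<-|nkj] := eqVneq k j; first by rewrite set22.
    have {}lik : (i < k)%N by rewrite ltn_neqAle lik andbT.
    have {}lkj : (k < j)%N by rewrite ltn_neqAle lkj andbT.
    by case: (visE i j ij eE) => [[_ [_ v]]|[_ [_ v]]]; have := v k lik lkj;
      rewrite belowE // ek ltxx.
  - move=> e f x /[dup] eE /pairE[i [j [ij ee]]] /[dup] fE /pairE[k [l [kl ef]]].
    subst e f => ne /(drawingE _ ij) xij /(drawingE _ kl) xkl.
    have ne' : (val i, val j) != (val k, val l).
      apply: contra_neq ne => -[/val_inj -> /val_inj ->] //.
    have [m [m1 m2 ex]] : exists m : nat, [/\ m = i \/ m = j :> nat,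
        m = k \/ m = l :> nat & x = xpt m].
      case: (visE i j ij eE) => -[ijF vij]; case: (visE k l kl fE) => -[klF vkl].
      + by apply: (vis_meet_same vij vkl ne') => //; apply: F12.
      + exact: (vis_meet_opp vij vkl ne').
      + by apply: (vis_meet_opp vij _ ne') => //; rewrite opprK.
      + by apply: (vis_meet_same vij vkl ne') => //; apply: F22.
    case: m1 m2 ex => -> [e|e] ->.
    + by exists i; rewrite (val_inj e) set21 set21 xptE.
    + by exists i; rewrite (val_inj e) set21 set22 -(val_inj e) xptE.
    + by exists j; rewrite (val_inj e) set22 set21 -(val_inj e) xptE.
    + by exists j; rewrite (val_inj e) set22 set22 -(val_inj e) xptE.
split=> // E' plE' /fintype.subsetP sEE'; apply/eqP; rewrite finset.eqEsubset.
apply/andP; split; last exact/fintype.subsetP.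
apply/fintype.subsetP => e eE'.
have [E'2 E'v E'x] := plE'.
have [i [j [ij ee]]] : exists i j : 'I_n, (i < j)%N /\ e = [set i; j]%SET.
  have /eqP/cards2P[i [j [nij ->]]] := E'2 _ eE'.
  case: (ltngtP i j) => [h|h|/val_inj h]; first by exists i, j.
  - by exists j, i; split=> //; rewrite finset.setUC.
  - by rewrite h eqxx in nij.
subst e.
have inE_ s F : maximal_plane (below s) 0 n.-1 F -> {subset F <= F1 ++ F2} ->
    vis (below s) i j -> [set i; j]%SET \in E.
  move=> mF sF vij; have [_ G1 _ G3] := mF.
  have jn : (j <= n.-1)%N by rewrite -ltnS; apply: leq_trans (ltn_ord j) (leqSpred n).
  rewrite memE //; case: (G3 i j isT jn vij) => [h|[[c d] cdF]]; first exact: sF.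
  have [_ dn vcd] := G1 _ cdF; have cd : (c < d)%N by case: vcd.
  have dn' : (d < n)%N by move: dn => /=; lia.
  have cn' : (c < n)%N by apply: ltn_trans cd dn'.
  pose c' := Ordinal cn'; pose d' := Ordinal dn'.
  have cdE : [set c'; d']%SET \in E' by apply: sEE'; rewrite memE //; apply: sF.
  rewrite /crossing /= => /orP[]/and3P[h1 h2 h3]; exfalso.
    have [x x1 x2] := vis_crossing_meet vcd vij h1 h2 h3.
    by apply: (@plane_graph_disjoint E' c' d' i j x plE' cd ij cdE eE' _ _ _ _ x1 x2);
      rewrite -val_eqE /=; lia.
  have [x x1 x2] := vis_crossing_meet vij vcd h1 h2 h3.
  by apply: (@plane_graph_disjoint E' i j c' d' x plE' ij cd eE' cdE _ _ _ _ x1 x2);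
    rewrite -val_eqE /=; lia.
pose blocked s := ~~ all (fun k => below s i k j) (iota i.+1 (j - i.+1)).
have unblocked s : ~~ blocked s -> vis (below s) i j.
  rewrite negbK => /allP h; split=> // k ik kj; apply: h.
  by rewrite mem_iota; lia.
have [b1|/unblocked] := boolP (blocked 1); last first.
  by apply: inE_ mF1 _ => x xF; rewrite mem_cat xF.
have [b2|/unblocked] := boolP (blocked (- 1)); last first.
  by apply: inE_ mF2 _ => x xF; rewrite mem_cat xF orbT.
exfalso.
(* Planarity of [E'] keeps input points off the edge, so not being below it means being strictly on
   the other side. *)
have nz m : (i < m)%N -> (m < j)%N -> cross (xpt i) (xpt m) (xpt j) != 0.
  move=> im mj; have mn := ltn_trans mj (ltn_ord j).
  apply/eqP => c0.
  have xm : drawing pt [set i; j]%SET (pt (Ordinal mn)).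
    rewrite -xptE /=; apply/(drawingE _ ij)/(segmentE _ (xpt_mono ij)).
    split; [by apply/ltW/xpt_mono|by apply/ltW/xpt_mono|].
    apply/eqP; rewrite eq_sym -subr_eq0; move/eqP: c0.
    rewrite cross_line_at ?xpt_mono // mulf_eq0 => /orP[|//].
    by move=> /eqP h; exfalso; have := xpt_mono ij; lra.
  have := E'v _ (Ordinal mn) eE' xm; rewrite !inE -!val_eqE /=; lia.
have [k [ik kj fk]] : exists k, [/\ (i < k)%N, (k < j)%N & below 1 i k j = false].
  case/allPn: b1 => k; rewrite mem_iota => h /negbTE nk.
  by exists k; split=> //; lia.
have [l [il lj fl]] : exists k, [/\ (i < k)%N, (k < j)%N & below 1 i k j].
  case/allPn: b2 => l; rewrite mem_iota => h nl.
  have [il lj] : (i < l)%N /\ (l < j)%N by lia.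
  by exists l; split=> //; move: nl; rewrite belowN ?oner_eq0 ?negbK ?nz.
have [m [im mj fm]] : exists m, [/\ (i < m)%N, (m.+1 < j)%N &
    below 1 i m j != below 1 i m.+1 j].
  pose f x := below 1 i x j.
  have [kl|lk] := leqP k l.
    have [|m [m1 m2 ?]] := @bool_switch f k l kl; first by rewrite /f fk fl.
    by exists m; split=> //; move: m1 m2 ik lj; clear; lia.
  have [|m [m1 m2 ?]] := @bool_switch f l k (ltnW lk); first by rewrite /f fk fl.
  by exists m; split=> //; move: m1 m2 il kj; clear; lia.
have m1n := ltn_trans mj (ltn_ord j); have mn := ltnW m1n.
have mF : (m, m.+1) \in F1.
  have hm : (m.+1 <= n.-1)%N by move: m1n; clear; lia.
  have [//|[[c d] cdF]] := F13 m m.+1 isT hm (vis_adj _ m).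
  by clear; rewrite /crossing /=; lia.
have mE : [set Ordinal mn; Ordinal m1n]%SET \in E'.
  by apply: sEE'; rewrite memE //= mem_cat mF.
have lem : ln m m.+1 (px m) = py m by rewrite line_at_l.
have lem1 : ln m m.+1 (px m.+1) = py m.+1 by rewrite line_at_r ?xpt_mono.
have im1 := ltnW im; have mj1 := ltnW mj.
have [s [s1 s2]] : exists s, s * ln m m.+1 (px m) < s * ln i j (px m) /\
    s * ln i j (px m.+1) < s * ln m m.+1 (px m.+1).
  have nz0 : (1 : R) != 0 by exact: oner_neq0.
  have nzm := nz m im mj1; have nzm1 := nz m.+1 (ltnW im) mj.
  have [hm|hm] := boolP (below 1 i m j).
    exists 1; rewrite lem lem1 -belowE // hm; split=> //.
    have : below (- 1) i m.+1 j by rewrite belowN //; move: fm; rewrite hm; case: below.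
    by rewrite belowE // !mulN1r ltrN2 !mul1r.
  exists (- 1); rewrite lem lem1 -belowE // belowN // hm; split=> //.
  have : below 1 i m.+1 j by move: fm; rewrite (negbTE hm); case: below.
  by rewrite belowE // !mulN1r ltrN2 !mul1r.
have [t [t1 t2 et]] := lines_meet (xpt_mono (ltnSn m)) s1 s2.
have xim := xpt_mono im; have xmj := xpt_mono mj.
have [n1 n2 n3 n4] : [/\ i != Ordinal mn, i != Ordinal m1n, j != Ordinal mn & j != Ordinal m1n].
  by rewrite -!val_eqE /=; move: im mj; clear; move=> *; split; lia.
apply: (@plane_graph_disjoint E' i j (Ordinal mn) (Ordinal m1n) (t, ln i j t) plE' ij
  (ltnSn m) eE' mE n1 n2 n3 n4).
- apply/(segmentE _ (xpt_mono ij)); split=> //=; first by move: xim t1; clear; lra.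
  by move: xmj t2; clear; lra.
- apply/(segmentE _ (xpt_mono (ltnSn m))); split=> //=; first by move: t1; clear; lra.
  by move: t2; clear; lra.
Qed.

End Points.

End PlaneGeometry.

(** * Decision trees on the word RAM *)

(** Loop-free branching code. The program runs one such tree over and over, [Ret] jumping back to
    its start; loops and calls live in registers and in an explicit stack. *)
Inductive cmd :=
| Ret
| Stop
| Seq (i : instr) (c : cmd)
| IfEq (a b : nat) (c1 c2 : cmd)
| IfLt (a b : nat) (c1 c2 : cmd).

Fixpoint cmd_size (c : cmd) : nat :=
  match c with
  | Ret | Stop => 1
  | Seq _ c => (cmd_size c).+1
  | IfEq _ _ c1 c2 | IfLt _ _ c1 c2 => (cmd_size c2 + cmd_size c1).+1
  end.

Section Compile.
Variable start : nat.

(** The second branch follows the conditional jump directly and the first comes behind it, at the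
    jump target. *)
Fixpoint compile (off : nat) (c : cmd) : seq instr :=
  match c with
  | Ret => [:: Jump start]
  | Stop => [:: Halt]
  | Seq i c => i :: compile off.+1 c
  | IfEq a b c1 c2 => JumpEq a b (off.+1 + cmd_size c2) ::
      compile off.+1 c2 ++ compile (off.+1 + cmd_size c2) c1
  | IfLt a b c1 c2 => JumpLt a b (off.+1 + cmd_size c2) ::
      compile off.+1 c2 ++ compile (off.+1 + cmd_size c2) c1
  end.

Lemma size_compile off c : size (compile off c) = cmd_size c.
Proof.
by elim: c off => //= [i c IH|a b c1 IH1 c2 IH2|a b c1 IH1 c2 IH2] off;
  rewrite ?size_cat ?IH ?IH1 ?IH2.
Qed.
End Compile.

Definition operands_ok (N : nat) (i : instr) : bool :=
  match i with
  | Const d _ => d < N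
  | Copy d a | Read d a | Write d a | Emit d a => (d < N) && (a < N)
  | Op _ d a b => [&& d < N, a < N & b < N]
  | Orient d a b c => [&& d < N, a < N, b < N & c < N]
  | _ => false
  end.

Fixpoint cmd_ok (N : nat) (c : cmd) : bool :=
  match c with
  | Ret | Stop => true
  | Seq i c => operands_ok N i && cmd_ok N c
  | IfEq a b c1 c2 | IfLt a b c1 c2 =>
      [&& a < N, b < N, cmd_ok N c1 & cmd_ok N c2]
  end.

(** Unlike [set_nth] this never lengthens the list, and it reduces on an explicit list of
    registers. *)
Fixpoint upd (d v : nat) (m : seq nat) : seq nat :=
  match m, d with
  | [::], _ => [::]
  | x :: m, 0 => v :: m
  | x :: m, d.+1 => x :: upd d v m
  end.

Lemma size_upd d v m : size (upd d v m) = size m.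
Proof. by elim: m d => [|x m IH] [|d] //=; rewrite IH. Qed.

Lemma upd_cat d v m m' : d < size m -> set_nth 0 (m ++ m') d v = upd d v m ++ m'.
Proof. by elim: m d => [|x m IH] [|d] //= h; rewrite IH. Qed.

Lemma upd_set_nth d v m : d < size m -> set_nth 0 m d v = upd d v m.
Proof. by move=> h; have := @upd_cat d v m [::] h; rewrite !cats0. Qed.

Lemma all_upd (p : pred nat) d v m : p v -> all p m -> all p (upd d v m).
Proof. by move=> pv; elim: m d => [|x m IH] [|d] //= /andP[px pm]; rewrite ?px ?pv ?IH. Qed.

Section Run.
Variables (R : realType) (n : nat) (pt : 'I_n -> (R * R)%type).
Variables (w : nat) (P : program) (N start : nat).
Let W := 2 ^ w.
Hypothesis W_gt2 : 2 < W.

Definition orientation (a b c : nat) : nat :=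
  sign_word (cross (xpt pt a) (xpt pt b) (xpt pt c)).

Notation outs := (seq (nat * nat)).
Notation reg m a := (nth 0 m a).

(* The first N cells are registers rs; the others, st, are accessed through
   addresses held in registers.  The boolean passed to Q tells Stop from Ret. *)
Fixpoint wp (c : cmd) (rs st : seq nat) (o : outs)
    (Q : bool -> seq nat -> seq nat -> outs -> Prop) : Prop :=
  match c with
  | Ret => Q false rs st o
  | Stop => Q true rs st o
  | IfEq a b c1 c2 =>
      if reg rs a == reg rs b then wp c1 rs st o Q else wp c2 rs st o Q
  | IfLt a b c1 c2 =>
      if reg rs a < reg rs b then wp c1 rs st o Q else wp c2 rs st o Q
  | Seq i c =>
    match i with
    | Const d k => k < W /\ wp c (upd d k rs) st o Q
    | Copy d a => wp c (upd d (reg rs a) rs) st o Q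
    | Read d a => (N <= reg rs a < N + size st) /\
        wp c (upd d (reg st (reg rs a - N)) rs) st o Q
    | Write a b => (N <= reg rs a < N + size st) /\
        wp c rs (upd (reg rs a - N) (reg rs b) st) o Q
    | Op Oadd d a b => reg rs a + reg rs b < W /\
        wp c (upd d (reg rs a + reg rs b) rs) st o Q
    | Op Osub d a b => reg rs b <= reg rs a /\
        wp c (upd d (reg rs a - reg rs b) rs) st o Q
    | Op Odiv d a b => wp c (upd d (reg rs a %/ reg rs b) rs) st o Q
    | Orient d i j k => [/\ reg rs i < n, reg rs j < n & reg rs k < n] /\
        wp c (upd d (orientation (reg rs i) (reg rs j) (reg rs k)) rs) st o Q
    | Emit i j => (reg rs i < n /\ reg rs j < n) /\
        wp c rs st ((reg rs i, reg rs j) :: o) Q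
    | _ => False
    end
  end.

Definition at_config (pc' : nat) (rs st : seq nat) (o : outs) (s : state n) : Prop :=
  [/\ Defs.pc s = pc', Defs.mem s = rs ++ st, size rs = N, all (fun x => x < W) (rs ++ st)
    & [seq (val e.1, val e.2) | e <- Defs.out s] = o].

Definition code_at (off : nat) (cs : seq instr) : Prop :=
  forall k, k < size cs -> nth Halt P (off + k) = nth Halt cs k.

Lemma code_at_cons off i cs : code_at off (i :: cs) ->
  nth Halt P off = i /\ code_at off.+1 cs.
Proof.
move=> h; split; first by rewrite -(addn0 off) h.
by move=> k hk; rewrite addSnnS h.
Qed.

Lemma code_at_cat off cs cs' : code_at off (cs ++ cs') ->
  code_at off cs /\ code_at (off + size cs) cs'.
Proof.
move=> h; split=> k hk; first by rewrite h ?nth_cat ?hk // size_cat ltn_addr.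
by rewrite -addnA h ?nth_cat ?size_cat ?ltn_add2l // ltnNge leq_addr /= addKn.
Qed.

Notation run := (run pt w P).
Notation step := (step pt w P).

Lemma run_addn t t' s s' : run t s = Some s' -> run (t + t') s = run t' s'.
Proof. by rewrite /Defs.run addnC iterD => ->. Qed.

Lemma run1 s : run 1 s = step s. Proof. by []. Qed.

Lemma nth_onth (m : seq nat) a : a < size m -> onth m a = Some (nth 0 m a).
Proof. by move=> h; rewrite onthE (nth_map 0). Qed.

Lemma point_indexE m a : a < size m -> nth 0 m a < n ->
  exists2 i : 'I_n, point_index n m a = Some i & val i = nth 0 m a.
Proof.
move=> am an; rewrite /point_index nth_onth //=.
by case: insubP => [i _ e|]; [exists i|rewrite an].
Qed.

Lemma sign_word_lt x : @sign_word R x < W.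
Proof. by rewrite /sign_word; case: ifP => _; [|case: ifP => _]; lia. Qed.

Lemma nth_all_lt m a : all (fun x => x < W) m -> nth 0 m a < W.
Proof.
move=> h; have [am|ma] := ltnP a (size m); first exact: (all_nthP 0 h).
by rewrite nth_default //; lia.
Qed.

Lemma writeE (s : state n) (rs st : seq nat) d v : Defs.mem s = rs ++ st ->
  d < size rs -> v < W ->
  Defs.write w d v s = Some (State (Defs.pc s).+1 (upd d v rs ++ st) (Defs.out s)).
Proof.
move=> ms dN vW.
by rewrite /Defs.write ms size_cat ltn_addr //= /advance /goto /= modn_small // upd_cat.
Qed.

Lemma writeE_st (s : state n) (rs st : seq nat) d v : Defs.mem s = rs ++ st ->
  size rs <= d < size rs + size st -> v < W ->
  Defs.write w d v s = Some (State (Defs.pc s).+1 (rs ++ upd (d - size rs) v st) (Defs.out s)).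
Proof.
move=> ms /andP[Nd dN] vW; rewrite /Defs.write ms size_cat dN /= /advance /goto /=.
rewrite modn_small // -{1}(subnKC Nd); congr (Some (State _ _ _)).
have {}dN : d - size rs < size st by lia.
elim: rs {ms Nd} (d - size rs) dN => [|x rs IH] k hk /=; first by rewrite upd_set_nth.
by rewrite IH.
Qed.

Lemma at_config_upd pc' rs st o s d v : at_config pc' rs st o s -> d < N -> v < W ->
  at_config pc'.+1 (upd d v rs) st o (State pc'.+1 (upd d v rs ++ st) (Defs.out s)).
Proof.
move=> [e1 e2 e3 e4 e5] dN vW; split=> //=; first by rewrite size_upd.
by move: e4; rewrite !all_cat => /andP[h ->]; rewrite all_upd.
Qed.

(** Every executed instruction moves to a proper subtree, so a round takes at most [cmd_size] steps.
    The precondition excludes overflow and underflow, so the truncated results are the exact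
    ones. *)
Lemma wp_sound (c : cmd) off rs st o s (Q : bool -> seq nat -> seq nat -> outs -> Prop) :
  code_at off (compile start off c) -> cmd_ok N c -> at_config off rs st o s ->
  wp c rs st o Q ->
  exists t b s' rs' st' out', [/\ t <= cmd_size c, run t s = Some s',
    Q b rs' st' out' & exists pc', at_config pc' rs' st' out' s' /\
      (if b then halted P s' : Prop else pc' = start)].
Proof.
have step_then s0 s1 c0 : step s0 = Some s1 ->
    (exists t b s' rs' st' out', [/\ t <= c0, run t s1 = Some s',
    Q b rs' st' out' & exists pc', at_config pc' rs' st' out' s' /\
      (if b then halted P s' : Prop else pc' = start)]) ->
    (exists t b s' rs' st' out', [/\ t <= c0.+1, run t s0 = Some s',
    Q b rs' st' out' & exists pc', at_config pc' rs' st' out' s' /\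
      (if b then halted P s' : Prop else pc' = start)]).
  move=> st01 [t [b [s' [rs' [st' [out' [ht hr hQ hc]]]]]]].
  exists t.+1, b, s', rs', st', out'; split=> //.
  by rewrite -add1n (run_addn _ (s' := s1)).
elim: c off rs st o s => [||i c IH|a b c1 IH1 c2 IH2|a b c1 IH1 c2 IH2] off rs st o s.
- move=> /code_at_cons[e _] _ [e1 e2 e3 e4 e5] h.
  exists 1, false, (State start (Defs.mem s) (Defs.out s)), rs, st, o; split=> //.
    by rewrite run1 /Defs.step /fetch e1 e.
  by exists start; split.
- move=> /code_at_cons[e _] _ hs h.
  exists 0, true, s, rs, st, o; split=> //; exists off; split=> //.
  by have [e1 _ _ _ _] := hs; rewrite /halted /fetch e1 e.
- move=> /= /code_at_cons[e hc] /andP[oki okc] hs h.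
  have [e1 e2 e3 e4 e5] := hs.
  have sN : N <= size (Defs.mem s) by rewrite e2 size_cat e3 leq_addr.
  have regE a : a < N -> onth (Defs.mem s) a = Some (nth 0 rs a).
    by move=> aN; rewrite nth_onth ?e2 ?nth_cat ?e3 ?aN // -e2; apply: leq_trans sN.
  have regW a : nth 0 rs a < W.
    by apply: nth_all_lt; move: e4; rewrite all_cat => /andP[].
  have stW a : nth 0 st a < W.
    by apply: nth_all_lt; move: e4; rewrite all_cat => /andP[].
  have idxE a : a < N -> nth 0 rs a < n ->
      exists2 i : 'I_n, point_index n (Defs.mem s) a = Some i & val i = nth 0 rs a.
    move=> aN an; have ea : nth 0 (Defs.mem s) a = nth 0 rs a by rewrite e2 nth_cat e3 aN.
    by have := @point_indexE (Defs.mem s) a (leq_trans aN sN); rewrite ea; apply.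
  have upd_case d v : d < N -> v < W -> step s = Defs.write w d v s ->
      wp c (upd d v rs) st o Q ->
      exists t b s' rs' st' out', [/\ t <= (cmd_size c).+1, run t s = Some s',
        Q b rs' st' out' & exists pc', at_config pc' rs' st' out' s' /\
        (if b then halted P s' : Prop else pc' = start)].
    move=> dN vW est hw; apply: step_then => //.
      by rewrite est (writeE e2) // e3.
    apply: (IH off.+1 _ _ _ _ hc okc _ hw).
    by rewrite e1; apply: at_config_upd.
  case: i oki h e => //.
  + move=> d k dN [kW h] e; apply: upd_case h => //.
    by rewrite /Defs.step /fetch e1 e.
  + move=> d a /andP[dN aN] h e; apply: upd_case h => //.
    by rewrite /Defs.step /fetch e1 e regE.
  + move=> d a /andP[dN aN] [/andP[h1 h2] h] e; apply: upd_case h => //.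
    rewrite /Defs.step /fetch e1 e regE //= nth_onth ?e2 ?size_cat ?e3 //=.
    by rewrite nth_cat e3 ltnNge h1.
  + move=> a b /andP[aN bN] [hab h] e; apply: step_then => //.
      by rewrite /Defs.step /fetch e1 e !regE //= (writeE_st e2) // e3.
    apply: (IH off.+1 _ _ _ _ hc okc _ h); split=> //=; rewrite ?e1 ?e3 //.
    by move: e4; rewrite !all_cat => /andP[->]; apply: all_upd.
  + case=> // d a b /and3P[dN aN bN] /=.
    * move=> [hW h] e; apply: upd_case h => //.
      by rewrite /Defs.step /fetch e1 e !regE.
    * move=> [hle h] e; apply: upd_case h => //.
        by apply: leq_ltn_trans (leq_subr _ _) (regW a).
      rewrite /Defs.step /fetch e1 e !regE //= /Defs.write /eval_op -addnBA //.
      by rewrite modnDl.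
    * move=> h e; apply: upd_case h => //.
        by apply: leq_ltn_trans (leq_div _ _) (regW a).
      by rewrite /Defs.step /fetch e1 e !regE.
  + move=> d i j k /and4P[dN iN jN kN] [[hi hj hk] h] e.
    have [i' ei vi] := idxE i iN hi.
    have [j' ej vj] := idxE j jN hj.
    have [k' ek vk] := idxE k kN hk.
    apply: upd_case h => //; first exact: sign_word_lt.
    rewrite /Defs.step /fetch e1 e ei ej ek /= /orientation -vi -vj -vk.
    by rewrite !xptE.
  + move=> i j /andP[iN jN] [[hi hj] h] e.
    have [i' ei vi] := idxE i iN hi.
    have [j' ej vj] := idxE j jN hj.
    apply: step_then => //.
      by rewrite /Defs.step /fetch e1 e ei ej.
    apply: (IH off.+1 _ _ _ _ hc okc _ h); split=> //=.
    by rewrite e5 vi vj.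
- move=> /= /code_at_cons[e /code_at_cat[hc2 hc1]] /and4P[aN bN ok1 ok2] hs.
  rewrite size_compile in hc1.
  have [e1 e2 e3 e4 e5] := hs.
  have sN : N <= size (Defs.mem s) by rewrite e2 size_cat e3 leq_addr.
  have regE x : x < N -> onth (Defs.mem s) x = Some (nth 0 rs x).
    by move=> xN; rewrite nth_onth ?e2 ?nth_cat ?e3 ?xN // -e2; apply: leq_trans sN.
  case: ifP => hab h.
    have hs' : at_config (off.+1 + cmd_size c2) rs st o
      (State (off.+1 + cmd_size c2) (Defs.mem s) (Defs.out s)) by split.
    have [t [b' [s' [rs' [st' [out' [ht hr hQ hcf]]]]]]] := IH1 _ _ _ _ _ hc1 ok1 hs' h.
    exists t.+1, b', s', rs', st', out'; split=> //; first by rewrite ltnS (leq_trans ht) ?leq_addl.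
    rewrite -add1n (run_addn _ (s' := State (off.+1 + cmd_size c2) (Defs.mem s) (Defs.out s))) //.
    by rewrite run1 /Defs.step /fetch e1 e !regE //= hab.
  have hs' : at_config off.+1 rs st o
    (State off.+1 (Defs.mem s) (Defs.out s)) by split.
  have [t [b' [s' [rs' [st' [out' [ht hr hQ hcf]]]]]]] := IH2 _ _ _ _ _ hc2 ok2 hs' h.
  exists t.+1, b', s', rs', st', out'; split=> //; first by rewrite ltnS (leq_trans ht) ?leq_addr.
  rewrite -add1n (run_addn _ (s' := State off.+1 (Defs.mem s) (Defs.out s))) //.
  by rewrite run1 /Defs.step /fetch e1 e !regE //= hab /advance /goto e1.
- move=> /= /code_at_cons[e /code_at_cat[hc2 hc1]] /and4P[aN bN ok1 ok2] hs.
  rewrite size_compile in hc1.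
  have [e1 e2 e3 e4 e5] := hs.
  have sN : N <= size (Defs.mem s) by rewrite e2 size_cat e3 leq_addr.
  have regE x : x < N -> onth (Defs.mem s) x = Some (nth 0 rs x).
    by move=> xN; rewrite nth_onth ?e2 ?nth_cat ?e3 ?xN // -e2; apply: leq_trans sN.
  case: ifP => hab h.
    have hs' : at_config (off.+1 + cmd_size c2) rs st o
      (State (off.+1 + cmd_size c2) (Defs.mem s) (Defs.out s)) by split.
    have [t [b' [s' [rs' [st' [out' [ht hr hQ hcf]]]]]]] := IH1 _ _ _ _ _ hc1 ok1 hs' h.
    exists t.+1, b', s', rs', st', out'; split=> //; first by rewrite ltnS (leq_trans ht) ?leq_addl.
    rewrite -add1n (run_addn _ (s' := State (off.+1 + cmd_size c2) (Defs.mem s) (Defs.out s))) //.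
    by rewrite run1 /Defs.step /fetch e1 e !regE //= hab.
  have hs' : at_config off.+1 rs st o
    (State off.+1 (Defs.mem s) (Defs.out s)) by split.
  have [t [b' [s' [rs' [st' [out' [ht hr hQ hcf]]]]]]] := IH2 _ _ _ _ _ hc2 ok2 hs' h.
  exists t.+1, b', s', rs', st', out'; split=> //; first by rewrite ltnS (leq_trans ht) ?leq_addr.
  rewrite -add1n (run_addn _ (s' := State off.+1 (Defs.mem s) (Defs.out s))) //.
  by rewrite run1 /Defs.step /fetch e1 e !regE //= hab /advance /goto e1.
Qed.

End Run.

(** * The program *)

Definition nreg := 26.

Definition seqs (l : seq instr) (c : cmd) : cmd := foldr Seq c l.
Definition push (x : nat) (c : cmd) := Seq (Write 7 x) (Seq (Op Oadd 7 7 4) c).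
Definition pop (x : nat) (c : cmd) := Seq (Op Osub 7 7 4) (Seq (Read x 7) c).

(* Registers: 0 n, 1 q, 2 depth limit, 3 sign, 4-6 the constants 1, 2, 0,
   7 stack pointer, 8 depth, 9 mode (0 inside a call, 1 and 2 in the quadratic
   procedure, 3 after a call has returned), 10 j, 11 g, 12 s, 13 l, 14 r, 15 d,
   16 b, 17 e, 18 x, 19 p, 20 h, 21 r', 22-25 temporaries. *)

Definition emit_path : cmd := IfEq 3 4 (Seq (Emit 13 14) Ret) Ret.

(** The pair of equal indices pushed here is a degenerate edge that marks the bottom of the stored
    edges of this call. *)
Definition enter_cmd : cmd :=
  seqs [:: Copy 10 23; Op Osub 11 23 22; Op Oadd 11 11 1; Op Osub 11 11 4; Op Odiv 11 11 1]
  (push 22 (push 22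
  (seqs [:: Copy 12 22; Copy 13 22; Op Oadd 14 22 4; Copy 15 4] emit_path))).

(** Registers 22 and 23 hold the ends of the pocket. Five registers are saved; [d] is not among them
    since it restarts at 1 after every call. *)
Definition subcall_cmd : cmd :=
  IfEq 8 2
    (seqs [:: Copy 9 4; Copy 16 22; Copy 17 23; Copy 18 22; Copy 19 22; Op Oadd 20 22 4] Ret)
    (push 10 (push 11 (push 12 (push 13 (push 14 (Seq (Op Oadd 8 8 4) enter_cmd)))))).

Definition extend_left : cmd :=
  seqs [:: Copy 22 24; Copy 23 13; Copy 13 24; Emit 13 14; Copy 15 4] subcall_cmd.
Definition extend_right : cmd :=
  seqs [:: Copy 22 14; Copy 23 25; Copy 14 25; Emit 13 14; Copy 15 4] subcall_cmd.
Definition widen : cmd := Seq (Op Oadd 15 15 4) Ret.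
Definition store_edge : cmd :=
  push 13 (push 14 (seqs [:: Op Oadd 12 12 11; Copy 15 4]
  (IfLt 12 10 (seqs [:: Copy 13 12; Op Oadd 14 12 4] emit_path)
              (Seq (Copy 14 10) Ret)))).
Definition merge_edge : cmd :=
  seqs [:: Copy 13 23; Op Osub 7 7 5; Emit 13 14; Copy 15 4] Ret.
Definition stuck : cmd :=
  IfEq 22 13
    (seqs [:: Op Osub 23 7 5; Read 23 23; Orient 24 23 13 14]
      (IfEq 24 3 merge_edge store_edge))
    store_edge.
Definition look_right (fail : cmd) : cmd :=
  seqs [:: Op Oadd 24 12 11; Op Oadd 25 14 15]
  (IfLt 24 25 fail (IfLt 10 25 fail
    (Seq (Orient 24 13 14 25) (IfEq 24 3 extend_right widen)))).
(** Both directions are tried at distance [d] before [d] grows, so a hit is nearest on its side and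
    has cost about [d] rounds. The search ends at the last stored edge on the left and at the end of
    the chunk on the right. *)
Definition grow : cmd :=
  seqs [:: Op Osub 22 7 4; Read 22 22; Op Oadd 23 22 15]
  (IfLt 13 23 (look_right stuck)
    (seqs [:: Op Osub 24 13 15; Orient 25 24 13 14]
      (IfEq 25 3 extend_left (look_right widen)))).
(** Gaps are treated from right to left, register 14 holding the current right end. The leftmost gap
    is a tail call at the same depth, which saves no frame. *)
Definition finish : cmd :=
  pop 22 (pop 23
  (IfEq 22 23
    (IfLt 22 14 (Seq (Copy 23 14) enter_cmd) (seqs [:: Op Oadd 9 4 5] Ret))
    (seqs [:: Copy 24 14; Copy 14 23]
      (IfLt 22 24 (Seq (Copy 23 24) subcall_cmd) Ret)))).

(** The scan to the left of [x] selects one point [p] whose shadow contains all the others; the scan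
    to the right tests against [p] alone. *)
Definition tangent_step : cmd :=
  IfLt 20 18
    (Seq (Orient 22 19 20 18)
      (IfEq 22 3 (Seq (Op Oadd 20 20 4) Ret)
                 (seqs [:: Copy 19 20; Op Oadd 20 20 4] Ret)))
    (seqs [:: Op Oadd 21 18 4; Copy 20 21; Copy 9 5]
      (IfEq 3 4 (Seq (Emit 18 21) Ret) Ret)).

Definition next_point : cmd :=
  Seq (Op Oadd 18 18 4)
  (IfEq 18 17 (Seq (Copy 9 6) Ret)
              (seqs [:: Copy 19 16; Op Oadd 20 16 4; Copy 9 4] Ret)).
(** [r'] is the last point seen from [x], and it alone decides whether the next point is seen. Once
    [p] casts its shadow, everything further right is shadowed too. *)
Definition record_step : cmd :=
  IfEq 20 17 next_point
  (Seq (Orient 22 19 18 20)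
  (IfEq 22 3 next_point
    (seqs [:: Op Oadd 20 20 4; Orient 22 18 21 20]
    (IfEq 22 3 (seqs [:: Copy 21 20; Emit 18 20] Ret) Ret)))).

(** A pass starts in the guise of a finishing call: an empty range, the bottom mark [(0, 0)] and the
    right end [n - 1] make [finish] enter the whole path, or return at once for a single point. *)
Definition start_pass : cmd :=
  push 6 (push 6
  (seqs [:: Copy 10 6; Copy 12 4; Op Osub 14 0 4; Copy 15 4; Copy 9 6] Ret)).
Definition return_step : cmd :=
  IfEq 8 6 (IfEq 3 4 (Seq (Copy 3 5) start_pass) Stop)
  (Seq (Op Osub 8 8 4)
    (pop 14 (pop 13 (pop 12 (pop 11 (pop 10 (seqs [:: Copy 15 4; Copy 9 6] Ret))))))).

Definition body : cmd :=
  IfEq 9 6 (IfLt 12 10 grow finish)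
  (IfEq 9 4 tangent_step (IfEq 9 5 record_step return_step)).

Lemma body_ok : cmd_ok nreg body. Proof. by []. Qed.

Arguments nreg : simpl never.

(** * The effect of one round of the loop *)

Section Steps.
Variables (R : realType) (n : nat) (pt : 'I_n -> (R * R)%type).
Variables (w q D H : nat).
Let W := 2 ^ w.
Hypothesis W_bound : 4 * n + q + H + 100 < W.
Hypothesis q_gt0 : 0 < q.
Hypothesis D_lt : D < W.

Notation sgn := (orientation pt).
Notation outs := (seq (nat * nat)).
Notation cfg := (seq nat -> seq nat -> outs -> Prop).
Notation wp := (wp pt w nreg).

(** Temporaries and cells above the stack are existential, since pops and comparisons leave values
    behind. *)
Definition full_state (u dep mode : nat) (stk : seq nat) (j g s l r d b e x p h r' : nat)
    (o : outs) : cfg := fun rs st o1 =>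
  [/\ o1 = o, size st = H & exists junk t1 t2 t3 t4,
    rs = [:: n; q; D; u; 1; 2; 0; nreg + size stk; dep; mode; j; g; s; l; r; d;
            b; e; x; p; h; r'; t1; t2; t3; t4] /\ st = stk ++ junk].

Definition main_state u dep stk j g s l r d o : cfg := fun rs st o1 =>
  exists b e x p h r', full_state u dep 0 stk j g s l r d b e x p h r' o rs st o1.

Definition return_state u dep stk o : cfg := fun rs st o1 =>
  exists j g s l r d b e x p h r', full_state u dep 3 stk j g s l r d b e x p h r' o rs st o1.

Definition path_edge (u x : nat) (o : outs) : outs :=
  if u == 1 then (x, x.+1) :: o else o.

Definition chunk (x y : nat) := (y - x + q - 1) %/ q.

Definition entered u dep stk x y o : cfg :=
  main_state u dep (stk ++ [:: x; x]) y (chunk x y) x x x.+1 1 (path_edge u x o).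

Definition subcalled u dep stk j g s l r x y o : cfg := fun rs st o1 =>
  if dep == D then
    exists r', full_state u dep 1 stk j g s l r 1 x y x x x.+1 r' o rs st o1
  else entered u dep.+1 (stk ++ [:: j; g; s; l; r]) x y o rs st o1.

Definition leads (X Y : cfg) : Prop := forall rs st o, X rs st o ->
  wp body rs st o (fun b rs' st' o' => b = false /\ Y rs' st' o').

Lemma size_junk (stk junk : seq nat) : size (stk ++ junk) = H -> size stk < H ->
  0 < size junk.
Proof. rewrite size_cat; lia. Qed.

Lemma upd_push v (stk junk : seq nat) : 0 < size junk ->
  upd (size stk) v (stk ++ junk) = (stk ++ [:: v]) ++ behead junk.
Proof. by case: junk => // y junk _; elim: stk => //= a stk ->. Qed.

Lemma wp_push x c rs stk junk o Q : nth 0 rs 7 = nreg + size stk ->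
  nth 0 rs 4 = 1 -> size rs = nreg -> size (stk ++ junk) = H -> size stk < H ->
  (forall junk', size ((stk ++ [:: nth 0 rs x]) ++ junk') = H ->
   wp c (upd 7 (nreg + size (stk ++ [:: nth 0 rs x])) rs)
     ((stk ++ [:: nth 0 rs x]) ++ junk') o Q) ->
  wp (push x c) rs (stk ++ junk) o Q.
Proof.
move=> e7 e4 szr szH sH h /=; rewrite e7 e4; split.
  by rewrite leq_addr ltn_add2l szH.
split; first by rewrite /nreg -/W; lia.
rewrite addKn upd_push ?(size_junk szH) //.
rewrite -addnA (_ : size stk + 1 = size (stk ++ [:: nth 0 rs x])) ?size_cat //.
rewrite -size_cat; apply: h; move: szH (size_junk szH sH); rewrite !size_cat size_behead /=.
by case: junk => //= y jk; lia.
Qed.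

Lemma nth_top v (stk junk : seq nat) : nth 0 ((stk ++ [:: v]) ++ junk) (size stk) = v.
Proof. by rewrite -catA nth_cat ltnn subnn. Qed.

Lemma wp_pop x c rs stk v junk o Q : nth 0 rs 7 = nreg + size (stk ++ [:: v]) ->
  nth 0 rs 4 = 1 -> 7 < size rs -> 
  wp c (upd x v (upd 7 (nreg + size stk) rs)) (stk ++ (v :: junk)) o Q ->
  wp (pop x c) rs ((stk ++ [:: v]) ++ junk) o Q.
Proof.
move=> e7 e4 szr h /=; rewrite e7 e4; split; first by rewrite size_cat /=; lia.
have e : nreg + size (stk ++ [:: v]) - 1 = nreg + size stk by rewrite size_cat /=; lia.
have -> : nth 0 (upd 7 (nreg + size (stk ++ [:: v]) - 1) rs) 7 = nreg + size stk.
  by rewrite e -upd_set_nth // nth_set_nth.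
split; first by rewrite !size_cat /=; lia.
by rewrite e addKn nth_top -catA.
Qed.

Opaque push pop.

Lemma wp_emit_path u dep mode stk j g s l r d b e x p h r' t1 t2 t3 t4 junk o Q :
  l < n -> r < n ->
  let rs := [:: n; q; D; u; 1; 2; 0; nreg + size stk; dep; mode; j; g; s; l; r; d;
            b; e; x; p; h; r'; t1; t2; t3; t4] in
  Q false rs (stk ++ junk) (if u == 1 then (l, r) :: o else o) ->
  wp emit_path rs (stk ++ junk) o Q.
Proof. by move=> ln rn /=; rewrite /emit_path /=; case: ifP. Qed.

Opaque emit_path.

Lemma wp_enter u dep stk j g s l r d b e xx p h r' x y t3 t4 junk o :
  size (stk ++ junk) = H -> size stk + 2 <= H -> x < y -> y < n ->
  wp enter_cmd [:: n; q; D; u; 1; 2; 0; nreg + size stk; dep; 0; j; g; s; l; r; d;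
            b; e; xx; p; h; r'; x; y; t3; t4] (stk ++ junk) o
    (fun b rs' st' o' => b = false /\ entered u dep stk x y o rs' st' o').
Proof.
move=> szH sH xy yn; rewrite /enter_cmd /=.
split; first (try split; lia).
split; first by rewrite -/W; lia.
split; first (try split; lia).
apply: wp_push; [by []|by []|by []|by []|lia|].
move=> jk1 sz1 /=.
apply: wp_push; [by []|by []|by []|by []|rewrite size_cat /=; lia|].
move=> jk2 sz2 /=; split; first by rewrite -/W; lia.
apply: wp_emit_path; [lia|lia|].
split=> //; exists b, e, xx, p, h, r'; split=> //.
  by rewrite /path_edge addn1.
exists jk2, x, y, t3, t4; split; last by rewrite -!catA.
by rewrite /chunk addn1 -catA.
Qed.

Opaque enter_cmd.

Lemma wp_subcall u dep stk j g s l r b e xx p h r' x y t3 t4 junk o :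
  size (stk ++ junk) = H -> (dep != D -> size stk + 7 <= H) -> dep <= D -> x < y -> y < n ->
  wp subcall_cmd [:: n; q; D; u; 1; 2; 0; nreg + size stk; dep; 0; j; g; s; l; r; 1;
            b; e; xx; p; h; r'; x; y; t3; t4] (stk ++ junk) o
    (fun b rs' st' o' => b = false /\ subcalled u dep stk j g s l r x y o rs' st' o').
Proof.
move=> szH sH depD xy yn; rewrite /subcall_cmd /= /subcalled.
case: eqP => [eD|/eqP nD].
  split; first by rewrite -/W; lia.
  split=> //; exists r'; split=> //.
  by exists junk, x, y, t3, t4; rewrite addn1.
have {}sH := sH nD.
apply: wp_push; [by []|by []|by []|by []|lia|].
move=> jk1 sz1 /=; apply: wp_push; [by []|by []|by []|by []|rewrite !size_cat /=; lia|].
move=> jk2 sz2 /=; apply: wp_push; [by []|by []|by []|by []|rewrite !size_cat /=; lia|].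
move=> jk3 sz3 /=; apply: wp_push; [by []|by []|by []|by []|rewrite !size_cat /=; lia|].
move=> jk4 sz4 /=; apply: wp_push; [by []|by []|by []|by []|rewrite !size_cat /=; lia|].
move=> jk5 sz5 /=; split; first by rewrite -/W; lia.
rewrite addn1.
have -> : (((((stk ++ [:: j]) ++ [:: g]) ++ [:: s]) ++ [:: l]) ++ [:: r]) =
  stk ++ [:: j; g; s; l; r] by rewrite -!catA.
apply: wp_enter => //; last by rewrite !size_cat /=; lia.
by rewrite -sz5 -!catA.
Qed.

Opaque subcall_cmd.

Lemma nth_top1 a b (stk junk : seq nat) :
  nth 0 ((stk ++ [:: a; b]) ++ junk) (nreg + size (stk ++ [:: a; b]) - 1 - nreg) = b.
Proof.
have -> : nreg + size (stk ++ [:: a; b]) - 1 - nreg = (size stk).+1.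
  by rewrite size_cat /=; lia.
by rewrite -catA nth_cat ltnNge leqnSn /= subSnn.
Qed.

Lemma nth_top2 a b (stk junk : seq nat) :
  nth 0 ((stk ++ [:: a; b]) ++ junk) (nreg + size (stk ++ [:: a; b]) - 2 - nreg) = a.
Proof.
have -> : nreg + size (stk ++ [:: a; b]) - 2 - nreg = size stk.
  by rewrite size_cat /=; lia.
by rewrite -catA nth_cat ltnn subnn.
Qed.

(** The round as a function of the abstract state, so that later arguments do not look at the
    code. *)
Definition after_grow u dep stk0 lt lim j g s l r d o : cfg :=
  let stk := stk0 ++ [:: lt; lim] in
  if (lim + d <= l) && (sgn (l - d) l r == u) then
    subcalled u dep stk j g s (l - d) r (l - d) l ((l - d, r) :: o)
  else if [&& r + d <= s + g, r + d <= j & sgn l r (r + d) == u] then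
    subcalled u dep stk j g s l (r + d) r (r + d) ((l, r + d) :: o)
  else if (lim + d <= l) || (r + d <= s + g) && (r + d <= j) then
    main_state u dep stk j g s l r d.+1 o
  else if (lim == l) && (sgn lt l r == u) then
    main_state u dep stk0 j g s lt r 1 ((lt, r) :: o)
  else if s + g < j then
    main_state u dep (stk ++ [:: l; r]) j g (s + g) (s + g) (s + g).+1 1 (path_edge u (s + g) o)
  else main_state u dep (stk ++ [:: l; r]) j g (s + g) l j 1 o.

Section GrowCase.
Variables (u dep : nat) (stk0 : seq nat) (lt lim j g s l r d b e x p h r' : nat).
Variables (o : outs) (junk : seq nat).
Let stk := stk0 ++ [:: lt; lim].
Hypotheses (szH : size (stk ++ junk) = H) (sH : size stk0 + 9 <= H).
Hypotheses (depD : dep <= D) (sj : s < j) (jn : j < n) (lr : l < r) (rj : r <= j).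
Hypotheses (gn : g <= n) (d_gt0 : 0 < d) (dn : d <= n).

Let Q (X : cfg) b' rs' st' o' := b' = false /\ X rs' st' o'.
Let rs t1 t2 t3 t4 := [:: n; q; D; u; 1; 2; 0; nreg + size stk; dep; 0; j; g; s; l; r; d;
            b; e; x; p; h; r'; t1; t2; t3; t4].

Lemma size_stk : size stk = size stk0 + 2. Proof. by rewrite size_cat. Qed.

Lemma wp_store_edge t1 t2 t3 t4 :
  wp store_edge (rs t1 t2 t3 t4) (stk ++ junk) o (Q (
    if s + g < j then
      main_state u dep (stk ++ [:: l; r]) j g (s + g) (s + g) (s + g).+1 1 (path_edge u (s + g) o)
    else main_state u dep (stk ++ [:: l; r]) j g (s + g) l j 1 o)).
Proof.
have szs := size_stk.
rewrite /store_edge /rs; apply: wp_push; [by []|by []|by []|by []|lia|].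
move=> jk1 sz1 /=; apply: wp_push; [by []|by []|by []|by []|rewrite size_cat szs /=; lia|].
move=> jk2 sz2 /=; split; first by rewrite -/W; lia.
case sgj: (s + g < j).
  split; first by rewrite -/W; lia.
  apply: wp_emit_path; [lia|lia|].
  split=> //; exists b, e, x, p, h, r'; split=> //; first by rewrite /path_edge addn1.
  by exists jk2, t1, t2, t3, t4; rewrite addn1 -!catA; split=> //; rewrite -catA.
split=> //; exists b, e, x, p, h, r'; split=> //.
by exists jk2, t1, t2, t3, t4; rewrite -!catA; split=> //; rewrite -catA.
Qed.

Lemma wp_stuck t2 t3 t4 : lim <= l -> lt <= l ->
  wp stuck (rs lim t2 t3 t4) (stk ++ junk) o (Q (
    if (lim == l) && (sgn lt l r == u) then main_state u dep stk0 j g s lt r 1 ((lt, r) :: o)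
    else if s + g < j then
      main_state u dep (stk ++ [:: l; r]) j g (s + g) (s + g) (s + g).+1 1 (path_edge u (s + g) o)
    else main_state u dep (stk ++ [:: l; r]) j g (s + g) l j 1 o)).
Proof.
move=> liml ltl; have szs := size_stk.
rewrite /stuck; rewrite [wp _ _ _ _ _]/=.
case: eqP => [liml'|_]; last exact: wp_store_edge.
split; first (try split; lia).
split; first by rewrite size_cat; lia.
rewrite nth_top2; split; first (try split; lia).
case mg: (sgn lt l r == u) => /=; last exact: wp_store_edge.
split; first by lia.
split; first (try split; lia).
split=> //; exists b, e, x, p, h, r'; split=> //.
exists (lt :: lim :: junk), lim, lt, (sgn lt l r), t4; split; last by rewrite /stk -catA.
by do 7! congr cons; congr cons; lia.
Qed.

Opaque stuck.

Lemma wp_extend_right t1 t2 t3 : r + d <= j ->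
  wp extend_right (rs t1 t2 t3 (r + d)) (stk ++ junk) o (Q (
    subcalled u dep stk j g s l (r + d) r (r + d) ((l, r + d) :: o))).
Proof.
move=> rdj; have szs := size_stk.
rewrite /extend_right; rewrite [wp _ _ _ _ _]/=.
split; first (try split; lia).
by apply: wp_subcall => //; lia.
Qed.

Lemma wp_extend_left t1 t2 t4 : d <= l ->
  wp extend_left (rs t1 t2 (l - d) t4) (stk ++ junk) o (Q (
    subcalled u dep stk j g s (l - d) r (l - d) l ((l - d, r) :: o))).
Proof.
move=> dl; have szs := size_stk.
rewrite /extend_left; rewrite [wp _ _ _ _ _]/=.
split; first (try split; lia).
by apply: wp_subcall => //; lia.
Qed.

Opaque extend_left extend_right.

Lemma wp_widen t1 t2 t3 t4 :
  wp widen (rs t1 t2 t3 t4) (stk ++ junk) o (Q (main_state u dep stk j g s l r d.+1 o)).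
Proof.
rewrite /widen /=; split; first by rewrite -/W; lia.
split=> //; exists b, e, x, p, h, r'; split=> //.
by exists junk, t1, t2, t3, t4; rewrite addn1.
Qed.

Lemma wp_look_right fail X t1 t2 t3 t4 :
  (forall t3 t4, ~~ ((r + d <= s + g) && (r + d <= j)) ->
    wp fail (rs t1 t2 t3 t4) (stk ++ junk) o (Q X)) ->
  wp (look_right fail) (rs t1 t2 t3 t4) (stk ++ junk) o (Q (
    if [&& r + d <= s + g, r + d <= j & sgn l r (r + d) == u] then
      subcalled u dep stk j g s l (r + d) r (r + d) ((l, r + d) :: o)
    else if (r + d <= s + g) && (r + d <= j) then main_state u dep stk j g s l r d.+1 o
    else X)).
Proof.
move=> hfail; rewrite /look_right; rewrite [wp _ _ _ _ _]/=.
split; first by rewrite -/W; lia.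
split; first by rewrite -/W; lia.
rewrite ltnNge; case: (leqP (r + d) (s + g)) => h1 /=; last first.
  by apply: hfail; lia.
rewrite ltnNge; case: (leqP (r + d) j) => h2 /=; last first.
  by apply: hfail; lia.
split; first (try split; lia).
case: (sgn l r (r + d) == u) => /=; first exact: wp_extend_right.
exact: wp_widen.
Qed.

Opaque look_right widen.

Lemma wp_grow t1 t2 t3 t4 : lim <= l -> lt <= l ->
  wp grow (rs t1 t2 t3 t4) (stk ++ junk) o
    (Q (after_grow u dep stk0 lt lim j g s l r d o)).
Proof.
move=> liml ltl; have szs := size_stk.
rewrite /grow; rewrite [wp _ _ _ _ _]/=.
split; first (try split; lia).
split; first by rewrite size_cat; lia.
rewrite nth_top1; split; first by rewrite -/W; lia.
rewrite /after_grow -/stk ltnNge; case: (leqP (lim + d) l) => h1 /=.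
  split; first (try split; lia).
  split; first (try split; lia).
  case: (sgn (l - d) l r == u) => /=; first by apply: wp_extend_left; lia.
  have := @wp_look_right widen (main_state u dep stk j g s l r d.+1 o) lim (lim + d) (l - d)
    (sgn (l - d) l r) (fun t3 t4 _ => wp_widen _ _ _ _).
  by case: ifP => // _; rewrite if_same.
exact: wp_look_right (fun t3 t4 _ => wp_stuck _ _ _ liml ltl).
Qed.

End GrowCase.

Opaque grow.

Lemma leads_grow u dep stk0 lt lim j g s l r d o :
  size stk0 + 9 <= H -> dep <= D -> s < j -> j < n -> l < r -> r <= j ->
  lim <= l -> lt <= l -> g <= n -> 0 < d -> d <= n ->
  leads (main_state u dep (stk0 ++ [:: lt; lim]) j g s l r d o)
        (after_grow u dep stk0 lt lim j g s l r d o).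
Proof.
move=> sH depD sj jn lr rj liml ltl gn d0 dn rs st o1.
move=> [b [e [x [p [h [r' [-> szH [junk [t1 [t2 [t3 [t4 [-> est]]]]]]]]]]]]].
subst st; rewrite [wp _ _ _ _ _]/= sj.
exact: wp_grow.
Qed.

Definition after_finish u dep stk0 lt lim j g s l r o : cfg :=
  if lim == lt then
    if lim < r then entered u dep stk0 lim r o else return_state u dep stk0 o
  else if lim < r then subcalled u dep stk0 j g s l lt lim r o
  else main_state u dep stk0 j g s l lt 1 o.

Lemma leads_finish u dep stk0 lt lim j g s l r o :
  size stk0 + 7 <= H -> dep <= D -> j <= s -> r < n ->
  leads (main_state u dep (stk0 ++ [:: lt; lim]) j g s l r 1 o)
        (after_finish u dep stk0 lt lim j g s l r o).
Proof.
move=> sH depD js rn rs st o1.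
move=> [b [e [x [p [h [r' [-> szH [junk [t1 [t2 [t3 [t4 [-> est]]]]]]]]]]]]].
subst st; rewrite [wp _ _ _ _ _]/= ltnNge js /=.
have -> : stk0 ++ [:: lt; lim] = (stk0 ++ [:: lt]) ++ [:: lim] by rewrite -catA.
have szH' : size (stk0 ++ [:: lt, lim & junk]) = H by rewrite -szH -catA.
rewrite /finish; apply: wp_pop; [by []|by []|by []|rewrite [upd _ _ _]/=].
apply: wp_pop; [by []|by []|by []|rewrite [wp _ _ _ _ _]/= /after_finish].
case: (lim == lt) => /=.
  case limr: (lim < r); first by apply: wp_enter => //; lia.
  split; first by rewrite -/W; lia.
  split=> //; exists j, g, s, l, r, 1, b, e, x, p, h, r'; split=> //.
  by exists (lt :: lim :: junk), lim, lt, t3, t4.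
case limr: (lim < r); first by apply: wp_subcall => //; lia.
split=> //; exists b, e, x, p, h, r'; split=> //.
by exists (lt :: lim :: junk), lim, lt, r, t4.
Qed.

Definition after_tangent u dep stk j g s l r b e x p h r' o : cfg :=
  if h < x then
    full_state u dep 1 stk j g s l r 1 b e x (if sgn p h x == u then p else h) h.+1 r' o
  else full_state u dep 2 stk j g s l r 1 b e x p x.+1 x.+1 (path_edge u x o).

Lemma leads_tangent u dep stk j g s l r b e x p h r' o :
  h <= n -> x.+1 < n -> p < n ->
  leads (full_state u dep 1 stk j g s l r 1 b e x p h r' o)
        (after_tangent u dep stk j g s l r b e x p h r' o).
Proof.
move=> hn xn pn rs st o1 [-> szH [junk [t1 [t2 [t3 [t4 [-> est]]]]]]].
subst st; rewrite [wp _ _ _ _ _]/= /after_tangent.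
case hx: (h < x).
  split; first (try split; lia).
  case: (sgn p h x == u); (split; first by rewrite -/W; lia); split=> //; split=> //;
    by exists junk, (sgn p h x), t2, t3, t4; rewrite addn1.
split; first by rewrite -/W; lia.
rewrite /path_edge addn1.
by case: (u == 1); first (split; first lia);
  split=> //; split=> //; exists junk, t1, t2, t3, t4.
Qed.

Definition after_record u dep stk j g s l r b e x p h r' o : cfg :=
  if (h == e) || (sgn p x h == u) then
    if x.+1 == e then full_state u dep 0 stk j g s l r 1 b e x.+1 p h r' o
    else full_state u dep 1 stk j g s l r 1 b e x.+1 b b.+1 r' o
  else if sgn x r' h.+1 == u then
    full_state u dep 2 stk j g s l r 1 b e x p h.+1 h.+1 ((x, h.+1) :: o)
  else full_state u dep 2 stk j g s l r 1 b e x p h.+1 r' o.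

Lemma leads_record u dep stk j g s l r b e x p h r' o :
  h <= e -> e < n -> x < n -> p < n -> b <= n -> r' < n ->
  leads (full_state u dep 2 stk j g s l r 1 b e x p h r' o)
        (after_record u dep stk j g s l r b e x p h r' o).
Proof.
move=> he en xn pn bn r'n rs st o1 [-> szH [junk [t1 [t2 [t3 [t4 [-> est]]]]]]].
subst st; rewrite [wp _ _ _ _ _]/= /after_record.
have next t1' : wp next_point [:: n; q; D; u; 1; 2; 0; nreg + size stk; dep; 2; j; g; s; l;
    r; 1; b; e; x; p; h; r'; t1'; t2; t3; t4] (stk ++ junk) o
   (fun b0 rs' st' o' => b0 = false /\ (if x.+1 == e then
    full_state u dep 0 stk j g s l r 1 b e x.+1 p h r' o
    else full_state u dep 1 stk j g s l r 1 b e x.+1 b b.+1 r' o) rs' st' o').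
  rewrite [wp _ _ _ _ _]/=; split; first by rewrite -/W; lia.
  rewrite addn1; case: (x.+1 == e).
    by split=> //; split=> //; exists junk, t1', t2, t3, t4.
  split; first by rewrite -/W; lia.
  by split=> //; split=> //; exists junk, t1', t2, t3, t4; rewrite addn1.
case: eqP => [_|/eqP ne]; first exact: next.
split; first (try split; lia).
case: (sgn p x h == u) => /=; first exact: next.
split; first by rewrite -/W; lia.
rewrite addn1; split; first (try split; lia).
case: (sgn x r' h.+1 == u); first (split; first lia);
  by split=> //; split=> //; exists junk, (sgn x r' h.+1), t2, t3, t4.
Qed.

Lemma leads_return u dep stk j g s l r o : dep < W ->
  leads (return_state u dep.+1 (stk ++ [:: j; g; s; l; r]) o) (main_state u dep stk j g s l r 1 o).
Proof.
move=> dW rs st o1 [j1 [g1 [s1 [l1 [r1 [d1 [b [e [x [p [h [r' [-> szH]]]]]]]]]]]]].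
move=> [junk [t1 [t2 [t3 [t4 [-> est]]]]]].
subst st; rewrite [wp _ _ _ _ _]/=; split; first (try split; lia).
have -> : stk ++ [:: j; g; s; l; r] =
  ((((stk ++ [:: j]) ++ [:: g]) ++ [:: s]) ++ [:: l]) ++ [:: r] by rewrite -!catA.
do 5 (apply: wp_pop; [by []|by []|by []|rewrite [upd _ _ _]/=]).
rewrite [wp _ _ _ _ _]/=; split=> //; exists b, e, x, p, h, r'; split=> //.
  by rewrite -szH !size_cat /=; lia.
by exists [:: j, g, s, l, r & junk], t1, t2, t3, t4; rewrite subn1.
Qed.

Lemma leads_next_pass dep stk o : dep = 0 -> stk = [::] -> 2 <= H -> 0 < n ->
  leads (return_state 1 dep stk o)
    (fun rs st o1 => exists g l, main_state 2 0 [:: 0; 0] 0 g 1 l n.-1 1 o rs st o1).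
Proof.
move=> -> -> H2 n0 rs st o1 [j1 [g1 [s1 [l1 [r1 [d1 [b [e [x [p [h [r' [-> szH]]]]]]]]]]]]].
move=> [junk [t1 [t2 [t3 [t4 [-> est]]]]]].
subst st; rewrite [wp _ _ _ _ _]/= /start_pass.
apply: (@wp_push _ _ _ [::]); [by []|by []|by []|by []|rewrite /=; lia|].
move=> jk1 sz1; rewrite [upd _ _ _]/=; apply: wp_push; [by []|by []|by []|by []|rewrite /=; lia|].
move=> jk2 sz2; rewrite [wp _ _ _ _ _]/=; split=> //.
split=> //; exists g1, l1, b, e, x, p, h, r'; split=> //.
by exists jk2, t1, t2, t3, t4; rewrite subn1.
Qed.

Lemma wp_stop u dep stk o rs st o1 : u != 1 -> dep = 0 -> return_state u dep stk o rs st o1 ->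
  wp body rs st o1 (fun b rs' st' o' => b = true /\ o' = o).
Proof.
move=> /negbTE u1 -> [j1 [g1 [s1 [l1 [r1 [d1 [b [e [x [p [h [r' [-> szH]]]]]]]]]]]]].
move=> [junk [t1 [t2 [t3 [t4 [-> est]]]]]].
by subst st; rewrite [wp _ _ _ _ _]/= u1.
Qed.

End Steps.

(** * Iterating the program, and the bottom of the recursion *)

Lemma wp_mono (R : realType) n (pt : 'I_n -> (R * R)%type) w N c rs st o
    (Q Q' : bool -> seq nat -> seq nat -> seq (nat * nat) -> Prop) :
  (forall b rs st o, Q b rs st o -> Q' b rs st o) ->
  wp pt w N c rs st o Q -> wp pt w N c rs st o Q'.
Proof.
move=> QQ'; elim: c rs st o => [||i c IH|a b c1 IH1 c2 IH2|a b c1 IH1 c2 IH2] rs st o /=.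
- exact: QQ'.
- exact: QQ'.
- case: i => //.
  + by move=> d k [h1 h2]; split=> //; apply: IH.
  + by move=> d a; apply: IH.
  + by move=> d a [h1 h2]; split=> //; apply: IH.
  + by move=> d a [h1 h2]; split=> //; apply: IH.
  + case=> // d a b; [|by case=> h1 h2; split=> //; apply: IH|exact: IH].
    by case=> h1 h2; split=> //; apply: IH.
  + by move=> d a b k [h1 h2]; split=> //; apply: IH.
  + by move=> a b [h1 h2]; split=> //; apply: IH.
- by case: ifP => _; [apply: IH1|apply: IH2].
- by case: ifP => _; [apply: IH1|apply: IH2].
Qed.

Opaque body.

Section Goes.
Variables (R : realType) (n : nat) (pt : 'I_n -> (R * R)%type) (w : nat).
Notation outs := (seq (nat * nat)).
Notation cfg := (seq nat -> seq nat -> outs -> Prop).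

(** [Y] may hold early, so that bounds on the number of rounds are monotone and add up. *)
Fixpoint reaches (k : nat) (Y : cfg) rs st o : Prop :=
  Y rs st o \/ (if k is k'.+1 then
    wp pt w nreg body rs st o (fun b rs' st' o' => b = false /\ reaches k' Y rs' st' o')
  else False).

Definition goes (k : nat) (X Y : cfg) : Prop :=
  forall rs st o, X rs st o -> reaches k Y rs st o.

Lemma reaches_le k k' Y rs st o : k <= k' -> reaches k Y rs st o -> reaches k' Y rs st o.
Proof.
elim: k k' rs st o => [|k IH] [|k'] rs st o //= kk'; first by case; left.
case; [by left|right]; apply: wp_mono b => b rs' st' o' [-> h]; split=> //.
exact: IH h.
Qed.

Lemma reaches_trans k k' Y Z rs st o : goes k' Y Z -> reaches k Y rs st o ->
  reaches (k + k') Z rs st o.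
Proof.
move=> YZ; elim: k rs st o => [|k IH] rs st o /=.
  by case=> // /YZ.
case=> [/YZ|h]; first by apply: (@reaches_le k' (k.+1 + k')); apply: leq_addl.
right; apply: wp_mono h => b rs' st' o' [-> h]; split=> //; exact: IH.
Qed.

Lemma goes_trans k k' m X Y Z : goes k X Y -> goes k' Y Z -> k + k' <= m -> goes m X Z.
Proof. by move=> XY YZ km rs st o /XY/(reaches_trans YZ); apply: reaches_le. Qed.

Lemma leads_goes X Y : leads pt w X Y -> goes 1 X Y.
Proof.
move=> XY rs st o /XY h /=; right; apply: wp_mono h => b rs' st' o' [-> h].
by split=> //; left.
Qed.

Lemma goes_refl k (X Y : cfg) : (forall rs st o, X rs st o -> Y rs st o) -> goes k X Y.
Proof. by move=> XY rs st o /XY; case: k; left. Qed.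

Lemma goes_step k m X Y Z : leads pt w X Y -> goes k Y Z -> k < m -> goes m X Z.
Proof. by move=> /leads_goes XY YZ km; apply: (goes_trans XY YZ). Qed.

End Goes.

(** * The quadratic procedure in constant space *)

Section Bottom.
Variables (R : realType) (n : nat) (pt : 'I_n -> (R * R)%type).
Hypothesis pt_sorted : x_sorted pt.
Variables (w q D H : nat).
Let W := 2 ^ w.
Hypothesis W_bound : 4 * n + q + H + 100 < W.
Hypothesis q_gt0 : 0 < q.
Hypothesis D_lt : D < W.
Variables (u : nat).
Hypothesis u12 : (u == 1) || (u == 2).

Notation outs := (seq (nat * nat)).
Notation cfg := (seq nat -> seq nat -> outs -> Prop).
Notation sgn := (orientation pt).
Notation goes := (goes pt w).
Notation St := (full_state n q D H u).
Notation SS := (main_state n q D H u).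
Notation SR := (return_state n q D H u).

(** The sign register holds one of the words that [Orient] returns, so both passes share the
    code. *)
Definition onside (a b c : nat) : bool := sgn a b c == u.
Notation B := onside.

Lemma onside_below : exists s : R, forall a b c, B a b c = below pt s a b c.
Proof.
case/orP: u12 => /eqP eu; [exists 1%R|exists (- 1)%R] => a b c;
  rewrite /onside /orientation /sign_word /below eu; move: (cross _ _ _) => x.
  by rewrite GRing.mul1r; case: (Order.TotalTheory.ltgtP 0%R x).
by rewrite GRing.mulN1r Num.Theory.oppr_gt0; case: (Order.TotalTheory.ltgtP 0%R x).
Qed.

Lemma onside4 a b c d : a < b -> b < c -> c < d ->
  signotope4 (B a b c) (B a b d) (B a c d) (B b c d).
Proof. by have [s e] := onside_below; rewrite !e; apply: below4. Qed.

Lemma onside_aac a c : B a a c = false.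
Proof.
rewrite /onside /orientation /sign_word /cross !GRing.subrr !GRing.mul0r GRing.subrr eqxx.
by case/orP: u12 => /eqP ->.
Qed.

Definition emitted (e : nat * nat) : bool := (u == 1) || (e.2 != e.1.+1).

(** [F] is the family in the mathematical sense, [G] what was reported for it: possibly in another
    order and, in the second pass, without path edges. [K] is the continuation at the enlarged
    output. *)
Definition Post (x y : nat) (K : outs -> cfg) (o : outs) : cfg := fun rs st o1 =>
  exists F G, [/\ maximal_plane B x y F, perm_eq G [seq e <- F | emitted e]
    & K (G ++ o) rs st o1].

Lemma path_edgeE x o : path_edge u x o = [seq e <- [:: (x, x.+1)] | emitted e] ++ o.
Proof. by rewrite /path_edge /emitted /= eqxx orbF; case: ifP. Qed.

Variables (dep : nat) (stk : seq nat) (j g s l r b e : nat).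
Hypotheses (be : b < e) (en : e < n).
Notation S1 x p h r' := (St dep 1 stk j g s l r 1 b e x p h r').
Notation S2 x p h r' := (St dep 2 stk j g s l r 1 b e x p h r').

(* After scanning the points left of h, p carries the steepest shadow over x. *)
Definition shadow_inv (x p h : nat) : Prop :=
  [/\ b <= p, p <= x, p < h & forall k z, b <= k -> k < h -> k < x -> x < z ->
    B k x z -> B p x z].

(** If [h] is below [px], every shadow of [h] over [x] is also one of [p]; otherwise every shadow of
    [p] is also one of [h]. *)
Lemma shadow_step x p h : shadow_inv x p h -> h < x -> p < x ->
  shadow_inv x (if B p h x then p else h) h.+1.
Proof.
move=> [bp px ph inv] hx px'; case: ifP => phx; split=> //; try lia.
- move=> k z bk; rewrite ltnS leq_eqVlt => /orP[/eqP ->|kh] kx xz; last exact: inv.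
  move=> hxz; have := @onside4 p h x z ph hx xz.
  by rewrite /signotope4 phx hxz; case: (B p h z); case: (B p x z).
- move=> k z bk; rewrite ltnS leq_eqVlt => /orP[/eqP ->|kh] kx xz // kxz.
  have pxz := inv k z bk kh kx xz kxz.
  by have := @onside4 p h x z ph hx xz; rewrite /signotope4 phx pxz;
    case: (B h x z); case: (B p h z).
Qed.

Lemma tangent_run x p h r' o : b <= x -> x < e -> shadow_inv x p h -> h <= x.+1 ->
  (p = x -> x < h) ->
  goes (x.+1 - h).+1 (S1 x p h r' o) (fun rs st o1 => exists2 p',
    shadow_inv x p' x.+1 & S2 x p' x.+1 x.+1 (path_edge u x o) rs st o1).
Proof.
move=> bx xe.
have [k le_k] := ubnP (x.+1 - h); elim: k => // k IH in p h le_k *.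
move=> inv hx px; have [bp px1 ph inv'] := inv.
have ld : leads pt w (S1 x p h r' o) (after_tangent pt q D H u dep stk j g s l r b e x p h r' o).
  by apply: (leads_tangent pt W_bound q_gt0 D_lt); lia.
have [hx'|xh] := ltnP h x.
  apply: (goes_step (k := (x.+1 - h.+1).+1) ld); last lia.
  rewrite /after_tangent hx'.
  apply: (IH (if B p h x then p else h) h.+1); try lia.
    by apply: shadow_step => //; lia.
  by rewrite /B; case: ifP; lia.
apply: (goes_step (k := 0) ld) => //; apply: goes_refl => rs st o1.
rewrite /after_tangent ltnNge xh /= => h2; exists p => //; split=> //; try lia.
move=> m z bm mx mx' xz; apply: inv' => //; lia.
Qed.

Definition listed (x h : nat) (F : outs) : Prop := uniq F /\ forall a c, (a, c) \in F <->
  [/\ b <= a, vis B a c, ~~ shadowed B b a c & a < x /\ c <= e \/ a = x /\ c <= h].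

Lemma shadowed_le x c c' : c <= c' -> shadowed B b x c -> shadowed B b x c'.
Proof.
by move=> cc' /shadowedP[k [z [? ? ? ? ?]]]; apply/shadowedP; exists k, z; split=> //; lia.
Qed.

Lemma shadowed_adj x : ~~ shadowed B b x x.+1.
Proof. by apply/shadowedP => -[k [z [? ? ? ? ?]]]; lia. Qed.

Lemma shadowedS x p h : shadow_inv x p x.+1 -> x < h ->
  shadowed B b x h.+1 = shadowed B b x h || B p x h.
Proof.
move=> [bp px _ inv] xh; apply/(@shadowedP B b x h.+1)/orP.
  move=> [k [z [bk kx xz zh kxz]]].
  have [zh'|zh'] := ltnP z h; first by left; apply/shadowedP; exists k, z.
  have -> : h = z by lia.
  by right; apply: (inv k) => //; lia.
case=> [/shadowedP[k [z [? ? ? ? ?]]]|pxh]; first by exists k, z; split=> //; lia.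
(* [p = x] occurs when no point lies to the left; the test is then degenerate and fails. *)
exists p, h; split=> //; rewrite ltn_neqAle px andbT; apply/eqP => epx.
by move: pxh; rewrite epx onside_aac.
Qed.

(** A shadow over [(x, h + 1)] covers all longer pairs from [x], so stopping early loses nothing. *)
Lemma listed_next x h F : listed x h F -> h = e \/ shadowed B b x h.+1 ->
  x < h -> h <= e -> listed x.+1 x.+1 F.
Proof.
move=> [uF memF] he xh h_le; split=> // a c; split.
  move=> /memF[ba vac nac alt]; split=> //; left; split; lia.
move=> [ba vac nac alt]; apply/memF; split=> //.
have ac : a < c by case: vac.
have [ax|ax] : a < x \/ a = x by lia.
  by left; lia.
right; split=> //; case: he => [->|sh]; first by lia.
rewrite leqNgt; apply/negP => hc; move/negP: nac; apply; subst a.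
exact: shadowed_le sh.
Qed.

Lemma listed_start x F : b <= x -> x < e -> listed x x F -> listed x x.+1 ((x, x.+1) :: F).
Proof.
move=> bx xe [uF memF]; split.
  rewrite /= uF andbT; apply/negP => /memF[_ _ _]; lia.
move=> a c; rewrite inE xpair_eqE; split.
  case/orP=> [/andP[/eqP -> /eqP ->]|/memF[ba vac nac alt]].
    by split=> //; [exact: vis_adj|exact: shadowed_adj|right].
  by split=> //; lia.
move=> [ba vac nac alt]; have ac : a < c by case: vac.
case ax: (a == x); last first.
  by rewrite andFb orFb; apply/memF; split=> //; lia.
by apply/orP; left; lia.
Qed.

(** No point after [r'] was seen, so a hit at [h + 1] closes a pocket from [r'], whose edge merges
    with [(x, r')]. *)
Lemma vis_next x r' h : vis B x r' -> r' <= h ->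
  (forall k, r' < k -> k <= h -> ~~ B x r' k) -> vis B x h.+1 <-> B x r' h.+1.
Proof.
move=> v rh nB; split=> [[_ vh]|xrh]; first by apply: vh; [case: v|lia].
apply: (vis_merge onside4 v) => //; apply: (vis_pocket_r onside4 v) => //.
Qed.

Lemma listed_more x p h r' F : b <= x -> shadow_inv x p x.+1 -> h < e ->
  vis B x r' -> r' <= h -> (forall k, r' < k -> k <= h -> ~~ B x r' k) ->
  ~~ shadowed B b x h -> ~~ B p x h -> listed x h F ->
  listed x h.+1 (if B x r' h.+1 then (x, h.+1) :: F else F).
Proof.
move=> bx inv he v rh nB nsh npxh [uF memF].
have xr : x < r' by case: v.
have xh : x < h by lia.
have vn := vis_next v rh nB.
have nsh' : ~~ shadowed B b x h.+1 by rewrite (shadowedS inv) // negb_or nsh.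
case bn: (B x r' h.+1); split.
- rewrite /= uF andbT; apply/negP => /memF[_ _ _]; lia.
- move=> a c; rewrite inE xpair_eqE; split.
    case/orP=> [/andP[/eqP -> /eqP ->]|/memF[ba vac nac alt]].
      by split=> //; [apply/vn|right].
    by split=> //; lia.
  move=> [ba vac nac alt].
  case ac: ((a == x) && (c == h.+1)) => //=.
  by apply/memF; split=> //; lia.
- by [].
- move=> a c; split=> [/memF[ba vac nac alt]|[ba vac nac alt]].
    by split=> //; lia.
  apply/memF; split=> //.
  have nc : ~ (a = x /\ c = h.+1).
    by move=> [ea ec]; subst a c; move/vn: vac; rewrite bn.
  lia.
Qed.

Lemma listed_head x h F : x.+1 < h -> 
  [seq f <- (x, h) :: F | emitted f] = (x, h) :: [seq f <- F | emitted f].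
Proof. by move=> xh; rewrite /= /emitted (_ : (x, h).2 != (x, h).1.+1) ?orbT //=; lia. Qed.

Lemma record_run x p h r' F G o : b <= x -> x < e -> shadow_inv x p x.+1 ->
  vis B x r' -> r' <= h -> h <= e -> (forall k, r' < k -> k <= h -> ~~ B x r' k) ->
  ~~ shadowed B b x h -> listed x h F -> perm_eq G [seq f <- F | emitted f] ->
  goes (e - h).+1 (S2 x p h r' (G ++ o)) (fun rs st o1 => exists F' G',
    [/\ listed x.+1 x.+1 F', perm_eq G' [seq f <- F' | emitted f] &
    exists p' h' r'', if x.+1 == e then 
      St dep 0 stk j g s l r 1 b e x.+1 p' h' r'' (G' ++ o) rs st o1
      else S1 x.+1 b b.+1 r'' (G' ++ o) rs st o1]).
Proof.
move=> bx xe inv.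
have [k le_k] := ubnP (e - h); elim: k => // k IH in h r' F G le_k *.
move=> v rh he nB nsh lF pG; have [bp px _ _] := inv.
have xr : x < r' by case: v.
have ld : leads pt w (S2 x p h r' (G ++ o))
    (after_record pt q D H u dep stk j g s l r b e x p h r' (G ++ o)).
  by apply: (leads_record pt W_bound q_gt0 D_lt); lia.
case fin: ((h == e) || B p x h).
  apply: (goes_step (k := 0) ld) => //; apply: goes_refl => rs st o1.
  rewrite /after_record -/(B p x h) fin => h2; exists F, G; split=> //.
    apply: (listed_next lF); [|lia|by []].
    case/orP: fin => [/eqP|pxh]; [by left|right].
    by rewrite (shadowedS inv) ?pxh ?orbT //; lia.
  by exists p, h, r'; case: ifP h2.
move/negbT: fin; rewrite negb_or => /andP[ne npxh].
have he' : h < e by lia.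
have lF' := listed_more bx inv he' v rh nB nsh npxh lF.
have nsh' : ~~ shadowed B b x h.+1 by rewrite (shadowedS inv) ?negb_or ?nsh //; lia.
case bn: (B x r' h.+1) lF' => lF'.
  apply: (goes_step (k := (e - h.+1).+1) ld); last lia.
  rewrite /after_record -/(B p x h) (negbTE ne) (negbTE npxh) /= -/(B x r' h.+1) bn.
  rewrite -cat_cons; apply: (IH h.+1 h.+1 ((x, h.+1) :: F)) => //; try lia.
    by apply/(vis_next v rh nB).
  rewrite listed_head ?perm_cons //; lia.
apply: (goes_step (k := (e - h.+1).+1) ld); last lia.
rewrite /after_record -/(B p x h) (negbTE ne) (negbTE npxh) /= -/(B x r' h.+1) bn.
apply: (IH h.+1 r' F) => //; try lia.
move=> m rm; rewrite leq_eqVlt => /orP[/eqP ->|]; first by rewrite bn.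
exact: nB.
Qed.

(** For one [x] the scans to the left and to the right together touch each point about once, hence
    the linear factor. *)
Lemma bottom_run x F G o r' : b <= x -> x < e -> listed x x F ->
  perm_eq G [seq f <- F | emitted f] ->
  goes ((e - x) * (e - b + 3)) (S1 x b (if x == b then x.+1 else b.+1) r' (G ++ o))
    (Post b e (SS dep stk j g s l r 1) o).
Proof.
have [k le_k] := ubnP (e - x); elim: k => // k IH in x r' F G le_k *.
move=> bx xe lF pG.
have -> : (if x == b then x.+1 else b.+1) = b.+1 by case: eqP => // ->.
have run1 := @tangent_run x b b.+1 r' (G ++ o) bx xe.
apply: (goes_trans (k := (x.+1 - b.+1).+1)
  (k' := (e - x.+1).+1 + (e - x.+1) * (e - b + 3)) (run1 _ _ _)); try lia.
- split; [lia|lia|lia|move=> m z bm mb _ _]; by (have -> : m = b by lia).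
- move=> rs st o1 [p inv]; rewrite path_edgeE /= => h1.
  have run2 := @record_run x p x.+1 x.+1 ((x, x.+1) :: F)
    ((if emitted (x, x.+1) then [:: (x, x.+1)] else [::]) ++ G) o bx xe inv (vis_adj _ _)
    (leqnn _) xe.
  apply: (goes_trans (k' := (e - x.+1) * (e - b + 3)) (run2 _ _ _ _) _ (leqnn _)).
  + by move=> m ? ?; lia.
  + exact: shadowed_adj.
  + exact: listed_start.
  + by rewrite /=; case: ifP; rewrite /= ?perm_cons.
  + move=> {h1}rs {}st {}o1 [F' [G' [lF' pG' [p' [h' [r'' h2]]]]]].
    have [ex|nex] := eqVneq x.+1 e.
      apply: reaches_le (leq0n _) _; left; exists F', G'.
      move: h2; rewrite ex eqxx => h2; split=> //; last by exists b, e, e, p', h', r''.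
      case: lF' => uF' memF'; apply: (unshadowed_maximal onside4) => // a c; split.
        by move=> /memF'[? ? ? ?]; split=> //; lia.
      by move=> [? ? vac ?]; apply/memF'; split=> //; case: vac; lia.
    move: h2; rewrite (negbTE nex) => h2.
    have bx' : (x.+1 == b) = false by lia.
    apply: (IH x.+1 r'' F' G'); [lia|lia|lia|by []|by []|by rewrite bx'].
  + by rewrite -catA; move: h1; case: ifP.
- rewrite -subSn // subSS; nia.
Qed.

Lemma bottom_goes o r' :
  goes (4 * (e - b) ^ 2) (S1 b b b.+1 r' o) (Post b e (SS dep stk j g s l r 1) o).
Proof.
have := @bottom_run b [::] [::] o r' (leqnn b) be.
rewrite eqxx => run rs st o1 h1; apply: reaches_le (run _ _ _ _ _ h1) => //; first nia.
split=> // a c; split=> // -[ba [ac _] _]; lia.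
Qed.

End Bottom.

(** * Calls *)

Section Chain.
Variable B : nat -> nat -> nat -> bool.
Hypothesis B4 : forall a b c d, a < b -> b < c -> c < d ->
  signotope4 (B a b c) (B a b d) (B a c d) (B b c d).
Variables i g : nat.
Notation outs := (seq (nat * nat)).
Notation item := (nat * nat * outs)%type.

Definition top (Es : seq item) : nat * nat := if Es is e :: _ then e.1 else (i, i).

(* The stored edges, top of the stack first, each with the triangulation below it. *)
Fixpoint chain (s : nat) (Es : seq item) (c : nat) : Prop :=
  (top Es).2 <= c < (top Es).2 + g /\
  if Es is e :: Es' then
    [/\ vis B e.1.1 e.1.2, maximal_plane B e.1.1 e.1.2 e.2, left_ok B i e.1.1 e.1.2,
      right_ok B s e.1.1 e.1.2 & chain s Es' e.1.1]
  else True.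

Definition span (Es : seq item) : nat := sumn [seq e.1.2 - e.1.1 | e <- Es].
Definition families (Es : seq item) : outs := flatten [seq e.2 | e <- Es].

Lemma chain_top s Es c : chain s Es c ->
  [/\ (top Es).1 <= (top Es).2, (top Es).2 <= c & c < (top Es).2 + g].
Proof. by case: Es => [|e Es] [/andP[h1 h2] //] => -[[? _] _ _ _ _]; split=> //=; lia. Qed.

Lemma chain_span s Es c : chain s Es c -> i + span Es <= c.
Proof.
elim: Es c => [|e Es IH] c [/andP[h1 h2]] /=; first by move=> _; rewrite /span /= addn0.
case=> [[el _] _ _ _ /IH h]; rewrite /span /= -/(span Es); simpl in h1.
lia.
Qed.

Lemma chain_le s Es c : chain s Es c -> i <= c.
Proof. by move=> /chain_span; lia. Qed.

Lemma chain_move s Es c c' : chain s Es c -> (top Es).2 <= c' -> c' <= c -> chain s Es c'.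
Proof.
by case: Es => [|e Es] [/andP[h1 h2] h3] h4 h5; split=> //; rewrite h4 /=; apply: leq_ltn_trans h2.
Qed.

(** Only the top edge is consulted: being stuck itself, it hides everything to its left. *)
Lemma chain_left_ok s Es l r : chain s Es l -> l <= s -> vis B l r ->
  (forall x, (top Es).2 <= x -> x < l -> ~~ B x l r) ->
  ((top Es).2 = l -> ~~ B (top Es).1 l r) -> left_ok B i l r.
Proof.
case: Es => [|e Es] [/andP[h1 h2] /= h3] ls v nB nm; first by move=> x; apply: nB.
case: h3 => ve _ L R _; apply: (left_ok_step B4 ve v L h1) => //.
- by move=> x rx xl; apply: R; lia.
- by move=> e2; rewrite e2; apply: nm.
Qed.

(** The new edge is stuck up to the new limit, and [right_ok_step] passes this down the stack edge
    by edge. *)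
Lemma chain_raise s s' Es l r : chain s Es l -> l <= s -> s <= s' -> vis B l r ->
  left_ok B i l r -> right_ok B s' l r -> chain s' Es l.
Proof.
elim: Es l r => [|e Es IH] l r [/andP[h1 h2] /= h3] ls ss' v L R.
  by split=> //; rewrite h1 h2.
case: h3 => ve me Le Re ch.
have el : e.1.1 < e.1.2 by case: ve.
have il := chain_le ch.
have Re' : right_ok B s' e.1.1 e.1.2.
  apply: (right_ok_step B4 ve v h1) R.
  - by move=> x rx xl; apply: Re; lia.
  - by move=> e2; rewrite e2; apply: L; lia.
  - by move=> e2; apply: L; lia.
split; first by rewrite h1 h2.
by split=> //; apply: (IH _ e.1.2) => //; simpl in h1; lia.
Qed.

Lemma pocket_left l r z F M : vis B l r -> maximal_plane B l r F -> z < l -> B z l r ->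
  (forall k, z < k -> k < l -> ~~ B k l r) -> maximal_plane B z l M ->
  vis B z r /\ maximal_plane B z r ((z, r) :: M ++ F).
Proof.
move=> v mF zl zlr nB mM; have vz := vis_pocket_l B4 v zl zlr nB.
have vzr := vis_merge B4 vz v zlr; split=> //; exact: (maximal_plane_tri mM mF vz v vzr).
Qed.

Lemma pocket_right l r z F M : vis B l r -> maximal_plane B l r F -> r < z -> B l r z ->
  (forall k, r < k -> k < z -> ~~ B l r k) -> maximal_plane B r z M ->
  vis B l z /\ maximal_plane B l z ((l, z) :: F ++ M).
Proof.
move=> v mF zl zlr nB mM; have vz := vis_pocket_r B4 v zl zlr nB.
have vzr := vis_merge B4 v vz zlr; split=> //; exact: (maximal_plane_tri mF mM v vz vzr).
Qed.

End Chain.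

(** * One call, given the cost [A] per path edge of its recursive calls *)

Section OneCall.
Variables (R : realType) (n : nat) (pt : 'I_n -> (R * R)%type).
Hypothesis pt_sorted : x_sorted pt.
Variables (w q D H : nat).
Let W := 2 ^ w.
Hypothesis W_bound : 4 * n + q + H + 100 < W.
Hypothesis q_gt0 : 0 < q.
Hypothesis D_lt : D < W.
Variables (u : nat).
Hypothesis u12 : (u == 1) || (u == 2).

Notation outs := (seq (nat * nat)).
Notation cfg := (seq nat -> seq nat -> outs -> Prop).
Notation item := (nat * nat * outs)%type.
Notation goes := (goes pt w).
Notation St := (full_state n q D H u).
Notation SS := (main_state n q D H u).
Notation SR := (return_state n q D H u).
Notation Sub := (subcalled n q D H u).
Notation Enter := (entered n q D H u).
Notation B := (onside pt u).
Notation Post := (Post pt u).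
Notation em := (emitted u).
Let BB4 := @onside4 R n pt pt_sorted u u12.

Lemma goes_le k k' (X Y : cfg) : k <= k' -> goes k X Y -> goes k' X Y.
Proof. by move=> kk' XY rs st o1 /XY; apply: reaches_le. Qed.

Lemma goes_sub k k' m X x y K o Z : goes k X (Post x y K o) ->
  (forall F G, maximal_plane B x y F -> perm_eq G [seq e <- F | em e] ->
    goes k' (K (G ++ o)) Z) -> k + k' <= m -> goes m X Z.
Proof.
move=> XP PZ; apply: goes_trans XP _ => rs st o1 [F [G [mF pG]]]; exact: PZ mF pG _ _ _.
Qed.

Lemma em_wide x y : x.+1 < y -> em (x, y).
Proof. by move=> xy; rewrite /emitted (_ : (x, y).2 != (x, y).1.+1) ?orbT //=; lia. Qed.

Lemma em_cons x y F : x.+1 < y ->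
  [seq f <- (x, y) :: F | em f] = (x, y) :: [seq f <- F | em f].
Proof. by move=> /em_wide h; rewrite /= h. Qed.

Variables (dep : nat) (stk : seq nat) (i j g A : nat).
Hypotheses (depD : dep <= D) (ij : i < j) (jn : j < n) (g_gt0 : 0 < g).
Hypotheses (g_le : g <= j - i) (gq : j - i <= g * q).
Hypothesis H_ge : size stk + (2 * q + 9) <= H.
Hypothesis sub_goes : forall stk' s l r x y o,
  size stk' <= size stk + 2 + 2 * q -> x < y -> y < n -> y - x < g ->
  goes (A * (y - x)) (Sub dep stk' j g s l r x y o) (Post x y (SS dep stk' j g s l r 1) o).
Hypothesis tail_goes : forall x y o, x < y -> y < n -> y - x < g ->
  goes (A * (y - x)) (Enter dep stk x y o) (Post x y (SR dep stk) o).

Fixpoint enc (Es : seq item) : seq nat :=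
  if Es is e :: Es' then enc Es' ++ [:: e.1.1; e.1.2] else stk ++ [:: i; i].

Lemma size_enc Es : size (enc Es) = size stk + 2 + 2 * size Es.
Proof. elim: Es => [|e Es IH] /=; rewrite size_cat ?IH /=; lia. Qed.

Notation chain := (chain B i g).
Notation top := (top i).

(** [A] is charged only to path edges in the gaps, those under stored edges being done. The families
    are glued at the ends of stored edges. *)
Lemma finish_run s l r Es M F G o : j <= s -> r <= j -> chain j Es r ->
  maximal_plane B r j F -> no_over B i j r -> size Es <= q ->
  perm_eq G [seq f <- F ++ families Es | em f] ->
  4 * g * size Es + 1 + A * (r - i - span Es) <= M ->
  goes M (SS dep (enc Es) j g s l r 1 (G ++ o)) (Post i j (SR dep stk) o).
Proof.
move=> js; elim: Es l r M F G => [|e Es IH] l r M F G rj ch mF nov szE pG hM.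
  have [_ /= ir rg] := chain_top ch.
  have ld : leads pt w (SS dep (stk ++ [:: i; i]) j g s l r 1 (G ++ o))
    (after_finish n q D H u dep stk i i j g s l r (G ++ o)).
    by apply: (leads_finish pt W_bound q_gt0 D_lt); lia.
  rewrite /after_finish eqxx in ld.
  rewrite /families /= cats0 in pG.
  have [ir'|ri] := ltnP i r; last first.
    have er : r = i by lia.
    rewrite (_ : (i < r) = false) in ld; last by lia.
    apply: (goes_step (k := 0) ld); last lia.
    by apply: goes_refl => rs st o1 h; exists F, G; rewrite -er.
  rewrite ir' /= in ld.
  apply: (goes_step (k := A * (r - i)) ld); last by rewrite /span /= in hM; lia.
  apply: (goes_sub (k' := 0) (tail_goes _ _ _)); [lia|lia|lia| |lia].
  move=> M' G' mM pG'; apply: goes_refl => rs st o1 h.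
  exists (M' ++ F), (G' ++ G); split; last by rewrite -catA.
    by apply: (maximal_plane_cat _ _ mM mF nov); lia.
  by rewrite filter_cat perm_cat.
have [/= h1 h2 h3] := chain_top ch.
have szs := size_enc Es; rewrite /= in szE.
have sp := chain_span ch; rewrite /span /= -/(span Es) in sp hM.
case: ch => _ /= [ve me Le Re ch'].
have el : e.1.1 < e.1.2 by case: ve.
have sp' := chain_span ch'.
have [novl novr] := stuck_no_over BB4 ve Le Re.
have ie := chain_le ch'.
have ld : leads pt w (SS dep (enc Es ++ [:: e.1.1; e.1.2]) j g s l r 1 (G ++ o))
    (after_finish n q D H u dep (enc Es) e.1.1 e.1.2 j g s l r (G ++ o)).
  apply: (leads_finish pt W_bound q_gt0 D_lt); lia.
rewrite /after_finish (_ : (e.1.2 == e.1.1) = false) in ld; last by lia.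
have {}hM : 4 * g * size Es + 4 * g + 1 + (A * (r - e.1.2) + A * (e.1.1 - i - span Es)) <= M.
  apply: leq_trans hM; rewrite -mulnDr mulnS -(addnC (4 * g)) leq_add2l leq_mul2l.
  by apply/orP; right; lia.
move: hM; set X := A * (r - e.1.2); set Y := A * (e.1.1 - i - span Es).
set Z := 4 * g * size Es => hM.
have close F1 G1 M1 : maximal_plane B e.1.2 j F1 ->
    perm_eq G1 [seq f <- F1 ++ families (e :: Es) | em f] -> Z + 1 + Y <= M1 ->
    goes M1 (SS dep (enc Es) j g s l e.1.1 1 (G1 ++ o)) (Post i j (SR dep stk) o).
  move=> mF1 pG1 hM1; apply: (IH _ _ _ (e.2 ++ F1)) => //; try lia.
    apply: (maximal_plane_cat _ _ me mF1); [lia|lia|].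
    by move=> a b ea; apply: novr; lia.
  apply: perm_trans pG1 _; apply: perm_filter; rewrite /families /= catA perm_cat2r.
  by rewrite perm_catC.
have [er|re] := ltnP e.1.2 r; last first.
  rewrite (_ : (e.1.2 < r) = false) in ld; last by lia.
  have er : r = e.1.2 by lia.
  apply: (goes_step (k := M.-1) ld); last by lia.
  by apply: (close F) => //; [rewrite -er|lia].
rewrite er /= in ld.
apply: (goes_step (k := M.-1) ld); last by lia.
apply: (goes_sub (k' := M.-1 - X) (sub_goes _ _ _ _)); try lia.
move=> M' G' mM pG'; rewrite catA; apply: (close (M' ++ F)); last by lia.
- apply: (maximal_plane_cat _ _ mM mF); [lia|lia|].
  by move=> a b ea; apply: nov; lia.
- by rewrite -catA filter_cat perm_cat.
Qed.

Definition under (Es : seq item) : seq nat := if Es is _ :: Es' then enc Es' else stk.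

Lemma enc_top Es : enc Es = under Es ++ [:: (top Es).1; (top Es).2].
Proof. by case: Es. Qed.

(* The last factor counts the path edges not yet covered by a stored or current edge.
   Each one pays A for the recursive calls and 2 for the reset of d to 1 after an
   extension by d; the first two terms pay for new starts and for pops. *)
Definition potential s l r d (Es : seq item) : nat :=
  6 * (j + g - s) + 4 * g * size Es + (g - d) + 1 + (A + 2) * (j - i - span Es - (r - l)).

(** The reset raises [g - d] by [d - 1], while [d] newly covered path edges release [A + 2] each. *)
Lemma potential_extend s l r d l' r' Es : 0 < d -> d <= g -> r' - l' = r - l + d ->
  span Es + (r' - l') <= j - i ->
  A * d + potential s l' r' 1 Es < potential s l r d Es.
Proof.
rewrite /potential => d0 dg rl sp.
have -> : j - i - span Es - (r - l) = j - i - span Es - (r' - l') + d by lia.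
move: (j - i - span Es - (r' - l')) (4 * g * size Es) (6 * (j + g - s)) => V Z X.
by rewrite mulnDr (mulnDl A 2 d); move: (A * d) ((A + 2) * V) => *; lia.
Qed.

Lemma potential_widen s l r d Es : d < g -> potential s l r d.+1 Es < potential s l r d Es.
Proof. by rewrite /potential => dg; lia. Qed.

(** The removed edge gives back [4 * g], more than the reset of [d] costs; the number of covered
    path edges stays the same. *)
Lemma potential_merge s r d (e : item) Es : e.1.1 < e.1.2 -> e.1.2 < r -> 0 < d -> d <= g ->
  potential s e.1.1 r 1 Es < potential s e.1.2 r d (e :: Es).
Proof.
move=> ee er d0 dg; rewrite /potential /span /= -/(span Es).
have -> : j - i - (e.1.2 - e.1.1 + span Es) - (r - e.1.2) = j - i - span Es - (r - e.1.1) by lia.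
by rewrite mulnS; move: (4 * g * size Es) ((A + 2) * _) (6 * (j + g - s)) => *; lia.
Qed.

(** The finished chunk releases [6 * g]: [4 * g] for the stored edge, the rest for the reset of [d].
    The summand [g] in [j + g - s] keeps the subtraction exact when [s + g] exceeds [j]. *)
Lemma potential_push s l r d F Es : s < j -> 0 < d -> d <= g ->
  potential (s + g) (s + g) (s + g).+1 1 ((l, r, F) :: Es) < potential s l r d Es.
Proof.
move=> sj d0 dg; rewrite /potential /span /= -/(span Es).
have : (A + 2) * (j - i - (r - l + span Es) - ((s + g).+1 - (s + g))) <=
  (A + 2) * (j - i - span Es - (r - l)) by rewrite leq_mul2l; apply/orP; right; lia.
rewrite mulnS; move: (4 * g * size Es) ((A + 2) * _) ((A + 2) * _) => *; lia.
Qed.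

Lemma potential_last s l r d F Es : s < j ->
  4 * g * size ((l, r, F) :: Es) + 1 + A * (j - i - span ((l, r, F) :: Es)) <
  potential s l r d Es.
Proof.
move=> sj; rewrite /potential /span /= -/(span Es).
have : A * (j - i - (r - l + span Es)) <= (A + 2) * (j - i - span Es - (r - l)).
  by apply: leq_mul; lia.
rewrite mulnS; move: (4 * g * size Es) (A * _) ((A + 2) * _) => *; lia.
Qed.

Lemma no_over_end : no_over B i j j.
Proof. by move=> a b ? ? ? ?; lia. Qed.

(** The last two clauses record the failed tests at distances below [d]. One stored edge per
    finished chunk, expressed by [g * size Es <= s - i], keeps their number below [q]. *)
Definition grow_inv s l r d (Es : seq item) F G : Prop :=
  [/\ [/\ s < j, i <= s, l <= s, s < r & r <= s + g],
    [/\ r <= j, 0 < d, d <= g & g * size Es <= s - i],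
    [/\ chain s Es l, vis B l r, maximal_plane B l r F
      & perm_eq G [seq f <- F ++ families Es | em f]],
    forall x, (top Es).2 <= x -> x < l -> l - x < d -> ~~ B x l r
    & forall x, r < x -> x <= s + g -> x <= j -> x - r < d -> ~~ B l r x].

Definition grow_goal M s l r d Es F G o : Prop :=
  grow_inv s l r d Es F G -> potential s l r d Es <= M ->
  goes M (SS dep (enc Es) j g s l r d (G ++ o)) (Post i j (SR dep stk) o).

Section GrowStep.
Variables (M s l r d : nat) (Es : seq item) (F G o : outs).
Hypothesis IH : forall M' s l r d Es F G, M' < M -> grow_goal M' s l r d Es F G o.
Hypothesis inv : grow_inv s l r d Es F G.
Hypothesis hM : potential s l r d Es <= M.
Notation goal X := (goes M.-1 X (Post i j (SR dep stk) o)).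

Lemma grow_facts : [/\ [/\ s < j, i <= s, l <= s, s < r & r <= s + g],
    [/\ r <= j, 0 < d, d <= g & size Es < q],
    [/\ (top Es).1 <= (top Es).2, (top Es).2 <= l, l < (top Es).2 + g & i + span Es <= l],
    0 < M & size (enc Es) <= size stk + 2 + 2 * q].
Proof.
have [[h1 h2 h3 h4 h5] [h6 h7 h8 szE] [ch _ _ _] _ _] := inv.
have [tt1 tt2 tt3] := chain_top ch; have sp := chain_span ch.
have szq : size Es < q by rewrite -(ltn_pmul2l g_gt0); lia.
have szenc := size_enc Es.
have M0 : 0 < M by apply: leq_trans hM; rewrite /potential -addnA addn_gt0 orbT.
split; [by []|by []|by []|by []|rewrite szenc; lia].
Qed.

(** All nearer points failed, so [l - d] is the nearest on its side to see the edge, and the family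
    of the recursive call fills the pocket. *)
Lemma grow_left : (top Es).2 + d <= l -> B (l - d) l r ->
  goal (Sub dep (enc Es) j g s (l - d) r (l - d) l ((l - d, r) :: (G ++ o))).
Proof.
have [[h1 h2 h3 h4 h5] [h6 h7 h8 szE] [t1 t2 t3 sp] M0 szenc] := grow_facts.
have [_ [_ _ _ gE] [ch v mF pG] Dl Dr] := inv.
move=> e1; set z := l - d => e2; have zl : z < l by rewrite /z; lia.
have zd : l - z = d by rewrite /z; lia.
have lz : (top Es).2 <= z by rewrite /z; lia.
have ch' : chain s Es z by apply: (chain_move ch) (ltnW zl).
have sp' := chain_span ch'.
have pot : A * d + potential s z r 1 Es < potential s l r d Es.
  apply: potential_extend => //; lia.
clearbody z.
apply: (goes_sub (k' := potential s z r 1 Es) (sub_goes szenc zl _ _)); first lia; first lia.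
  move=> M' G' mM pG'.
  have [|vz mz] := pocket_left BB4 v mF zl e2 _ mM.
    by move=> k zk kl; apply: Dl; lia.
  rewrite -cat_cons catA; apply: (@IH _ s z r 1 Es ((z, r) :: M' ++ F)) => //.
    by move: pot hM; case: (M) => *; lia.
  split=> //; try by split=> //; lia.
  - split=> //.
    rewrite cat_cons em_cons; last by lia.
    apply: (@perm_trans _ ((z, r) :: G' ++ G)); first by rewrite -cat1s perm_catCA.
    by rewrite perm_cons -catA filter_cat perm_cat.
  - by move=> x; lia.
  - by move=> x; lia.
rewrite zd; lia.
Qed.

Lemma grow_right : r + d <= s + g -> r + d <= j -> B l r (r + d) ->
  goal (Sub dep (enc Es) j g s l (r + d) r (r + d) ((l, r + d) :: (G ++ o))).
Proof.
have [[h1 h2 h3 h4 h5] [h6 h7 h8 szE] [t1 t2 t3 sp] M0 szenc] := grow_facts.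
have [_ [_ _ _ gE] [ch v mF pG] Dl Dr] := inv.
set z := r + d => e1 e1' e2; have zl : r < z by rewrite /z; lia.
have zd : z - r = d by rewrite /z; lia.
have pot : A * d + potential s l z 1 Es < potential s l r d Es.
  apply: potential_extend => //; lia.
clearbody z.
apply: (goes_sub (k' := potential s l z 1 Es) (sub_goes szenc zl _ _)); first lia; first lia.
  move=> M' G' mM pG'.
  have [|vz mz] := pocket_right BB4 v mF zl e2 _ mM.
    by move=> k zk kl; apply: Dr; lia.
  rewrite -cat_cons catA; apply: (@IH _ s l z 1 Es ((l, z) :: F ++ M')) => //.
    by move: pot hM; case: (M) => *; lia.
  split=> //; try by split=> //; lia.
  - split=> //.
    rewrite cat_cons em_cons; last by lia.
    apply: (@perm_trans _ ((l, z) :: G' ++ G)); first by rewrite -cat1s perm_catCA.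
    rewrite perm_cons -catA filter_cat filter_cat perm_sym perm_catCA -filter_cat perm_sym.
    by rewrite perm_cat.
  - by move=> x; lia.
  - by move=> x; lia.
rewrite zd; lia.
Qed.

Lemma grow_widen : ((top Es).2 + d <= l) || (r + d <= s + g) && (r + d <= j) ->
  ((top Es).2 + d <= l -> ~~ B (l - d) l r) ->
  (r + d <= s + g -> r + d <= j -> ~~ B l r (r + d)) ->
  goal (SS dep (enc Es) j g s l r d.+1 (G ++ o)).
Proof.
have [[h1 h2 h3 h4 h5] [h6 h7 h8 szE] [t1 t2 t3 sp] M0 szenc] := grow_facts.
have [_ [_ _ _ gE] [ch v mF pG] Dl Dr] := inv.
move=> e1 e2 e3; have dg : d < g by lia.
have pot := potential_widen s l r Es dg.
apply: (IH (F := F)); [lia| |lia].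
split=> //.
- move=> x tx xl xd; have [xd'|xd'] := ltnP (l - x) d; first exact: Dl.
  have -> : x = l - d by lia.
  by apply: e2; lia.
- move=> x tx xl xj xd; have [xd'|xd'] := ltnP (x - r) d; first exact: Dr.
  have -> : x = r + d by lia.
  by apply: e3; lia.
Qed.

Lemma grow_merge : (top Es).2 = l -> B (top Es).1 l r ->
  goal (SS dep (under Es) j g s (top Es).1 r 1 ((((top Es).1, r) :: G) ++ o)).
Proof.
have [[h1 h2 h3 h4 h5] [h6 h7 h8 szE] [t1 t2 t3 sp] M0 szenc] := grow_facts.
have [_ [_ _ _ gE] [ch v mF pG] Dl Dr] := inv.
have hM' := hM.
case eE: Es => [|e Es'] /=; rewrite eE in ch gE pG hM' t1 t2 t3 sp.
  (* The bottom mark [(i, i)] never merges, the orientation with a repeated point being zero. *)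
  by move=> <-; rewrite onside_aac.
move: ch => [_ /= [ve me Le Re ch']] e2 e3.
have ee : e.1.1 < e.1.2 by case: ve.
have pot := potential_merge s Es' ee (leq_ltn_trans (eq_leq e2) (leq_ltn_trans h3 h4)) h7 h8.
rewrite e2 in pot ve me; have ver := vis_merge BB4 ve v e3.
rewrite -cat_cons; apply: (@IH _ _ _ _ _ Es' ((e.1.1, r) :: e.2 ++ F)); [lia| |lia].
split=> //; try by split=> //; lia.
- split=> //; first by rewrite /= mulnS in gE; lia.
- split=> //; first exact: (maximal_plane_tri me mF ve v ver).
  rewrite cat_cons em_cons; last by lia.
  by rewrite perm_cons; apply: perm_trans pG _; apply: perm_filter;
    rewrite /families /= -catA perm_catCA.
- by move=> x; lia.
- by move=> x; lia.
Qed.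

Hypothesis far_left : l < (top Es).2 + d.
Hypothesis far_right : ~~ ((r + d <= s + g) && (r + d <= j)).
Hypothesis no_merge : ~~ (((top Es).2 == l) && B (top Es).1 l r).

(** The failed tests reach the last stored edge on the left and the end of the range on the right,
    which is enough for stuckness; the edges below inherit the new limit. *)
Lemma stuck_chain s' c : s' <= s + g -> s' <= j -> s <= s' -> r <= c -> c < r + g ->
  chain s' ((l, r, F) :: Es) c.
Proof.
have [[h1 h2 h3 h4 h5] [h6 h7 h8 szE] [t1 t2 t3 sp] M0 szenc] := grow_facts.
have [_ [_ _ _ gE] [ch v mF pG] Dl Dr] := inv.
move=> sg sj ss rc cr.
have L : left_ok B i l r.
  apply: (chain_left_ok BB4 ch h3 v).
  - by move=> x tx xl; apply: Dl => //; lia.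
  - by move=> e2; move: no_merge; rewrite e2 eqxx.
have Rk : right_ok B s' l r by move=> x rx xs; apply: Dr => //; lia.
split; first by rewrite /= rc cr.
by split=> //; exact: (chain_raise BB4 ch h3 ss v L Rk).
Qed.

Lemma grow_push : s + g < j ->
  goal (SS dep (enc Es ++ [:: l; r]) j g (s + g) (s + g) (s + g).+1 1
    (path_edge u (s + g) (G ++ o))).
Proof.
have [[h1 h2 h3 h4 h5] [h6 h7 h8 szE] [t1 t2 t3 sp] M0 szenc] := grow_facts.
have [_ [_ _ _ gE] [ch v mF pG] Dl Dr] := inv.
move=> sgj; have ch2 : chain (s + g) ((l, r, F) :: Es) (s + g) by apply: stuck_chain; lia.
have pot := potential_push l r F Es h1 h7 h8.
rewrite path_edgeE catA.
apply: (@IH _ _ _ _ _ ((l, r, F) :: Es) [:: (s + g, (s + g).+1)]); [lia| |lia].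
split=> //; try by split=> //; lia.
- by split=> //; rewrite /= mulnS; lia.
- split=> //; [exact: vis_adj|exact: maximal_plane_adj|].
  by rewrite filter_cat perm_cat2l.
- by move=> x; lia.
- by move=> x; lia.
Qed.

Lemma grow_last : j <= s + g ->
  goal (SS dep (enc Es ++ [:: l; r]) j g (s + g) l j 1 (G ++ o)).
Proof.
have [[h1 h2 h3 h4 h5] [h6 h7 h8 szE] [t1 t2 t3 sp] M0 szenc] := grow_facts.
have [_ [_ _ _ gE] [ch v mF pG] Dl Dr] := inv.
move=> sgj; have ch2 : chain j ((l, r, F) :: Es) j by apply: stuck_chain; lia.
have pot := potential_last l r d F Es h1.
apply: (@finish_run _ _ _ ((l, r, F) :: Es) _ [::]) => //; try lia.
- exact: maximal_plane_nil.
- exact: no_over_end.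
Qed.

End GrowStep.

Lemma grow_run M s l r d Es F G o : grow_goal M s l r d Es F G o.
Proof.
elim/ltn_ind: M => M IH' in s l r d Es F G * => inv hM.
have IH M' s' l' r' d' Es' F' G' : M' < M -> grow_goal M' s' l' r' d' Es' F' G' o.
  by move=> h; apply: IH'.
have [[h1 h2 h3 h4 h5] [h6 h7 h8 szE] [t1 t2 t3 sp] M0 szenc] := grow_facts inv hM.
have ld : leads pt w (SS dep (under Es ++ [:: (top Es).1; (top Es).2]) j g s l r d (G ++ o))
    (after_grow pt q D H u dep (under Es) (top Es).1 (top Es).2 j g s l r d (G ++ o)).
  apply: (leads_grow pt W_bound q_gt0 D_lt); try lia.
  by move: szenc; rewrite size_enc; case: (Es) szE => [|e Es'] /= szE _; rewrite ?size_enc; lia.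
rewrite -enc_top in ld.
apply: (goes_step (k := M.-1) ld); last by lia.
rewrite /after_grow -enc_top -!/(B _ _ _).
case: ifP => [/andP[]|e1]; first exact: (grow_left IH inv hM).
have {}e1 : (top Es).2 + d <= l -> ~~ B (l - d) l r by move=> h; move: e1; rewrite h /= => ->.
case: ifP => [/and3P[]|e2]; first exact: (grow_right IH inv hM).
have {}e2 : r + d <= s + g -> r + d <= j -> ~~ B l r (r + d).
  by move=> h h'; move: e2; rewrite h h' /= => ->.
case: ifP => [e3|/norP[e3 e4]]; first exact: (grow_widen IH inv hM).
case: ifP => [/andP[/eqP]|/negbT e5]; first exact: (grow_merge IH inv hM).
rewrite -ltnNge in e3.
case: ltnP => sgj; first exact: (grow_push IH inv hM).
exact: (grow_last inv hM).
Qed.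

Lemma one_call o : g = chunk q i j ->
  goes ((A + 15) * (j - i)) (Enter dep stk i j o) (Post i j (SR dep stk) o).
Proof.
move=> eg; rewrite /entered -eg path_edgeE.
apply: (@grow_run _ _ _ _ _ [::] [:: (i, i.+1)]).
  split=> //; try by split=> //; lia.
  - by split=> //=; rewrite muln0.
  - by split; [split=> //=; lia|exact: vis_adj|exact: maximal_plane_adj|].
  - by move=> x /=; lia.
  - by move=> x /=; lia.
(* With [g <= j - i], the three parts of the potential are at most 12, 1 and [A + 2] per path edge;
   hence 15. *)
rewrite /potential /span /= muln0 addn0 subn0 subSnn.
have m0 : 0 < j - i by lia.
rewrite (_ : j + g - i = j - i + g); last by lia.
move: (j - i) g_le m0 => [|m] // gm _; rewrite subn1 /= mulnS !mulnDl; lia.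
Qed.

End OneCall.

(** * Induction over the levels of recursion *)

Section Recursion.
Variables (R : realType) (n : nat) (pt : 'I_n -> (R * R)%type).
Hypothesis pt_sorted : x_sorted pt.
Variables (w q D H : nat).
Let W := 2 ^ w.
Hypothesis W_bound : 4 * n + q + H + 100 < W.
Hypothesis q_gt0 : 0 < q.
Hypothesis D_lt : D < W.
Variables (u : nat).
Hypothesis u12 : (u == 1) || (u == 2).

Lemma chunk_bounds x y : x < y ->
  [/\ 0 < chunk q x y, chunk q x y <= y - x & y - x <= chunk q x y * q].
Proof.
rewrite /chunk => xy; set m := y - x; have m0 : 0 < m by rewrite /m; lia.
have em := divn_eq (m + q - 1) q; have lm := ltn_pmod (m + q - 1) q_gt0.
split; [by rewrite divn_gt0 //; lia| |lia].
rewrite -(leq_pmul2r q_gt0).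
have : m + q - 1 <= m * q; last by lia.
by case: (m) (q) m0 q_gt0 => [|a] [|b] // _ _; nia.
Qed.

Lemma chunk_le x y t : y - x <= t * q -> chunk q x y <= t.
Proof.
move=> h; rewrite /chunk -ltnS ltn_divLR // mulSn; lia.
Qed.

(* For at most q ^ k path edges with d levels of recursion left: the number of
   iterations per path edge, whose second term is the size of the pieces left to
   the quadratic procedure, and the stack space. *)
Definition cost k d := 16 * k.+1 + 4 * q ^ (k - 1 - d).
Definition stack_need k d := (2 * q + 9) + (2 * q + 7) * minn k d.

(** Chunks of [q ^ k.+1] path edges have at most [q ^ k], so subproblems fall under the induction
    hypothesis or, at the depth limit, cost at most [4 * q ^ k] rounds per path edge. *)
Lemma call_goes k dep stk x y o : x < y -> y < n -> y - x <= q ^ k -> dep <= D ->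
  size stk + stack_need k (D - dep) <= H ->
  goes pt w (cost k (D - dep) * (y - x)) (entered n q D H u dep stk x y o)
    (Post pt u x y (return_state n q D H u dep stk) o).
Proof.
elim: k => [|k IH] in dep stk x y o *; move=> xy yn yx depD szH;
  have [g0 g_le gq] := chunk_bounds xy.
  (* With chunks of one edge no subproblem exists, so the hypotheses on recursive calls hold
     vacuously. *)
  have g1 : chunk q x y <= 1 by apply: chunk_le; rewrite expn0 in yx; lia.
  have := @one_call R n pt pt_sorted w q D H W_bound q_gt0 D_lt u u12 dep stk x y
    (chunk q x y) 1 depD xy yn g0 g_le gq _ _ _ o erefl.
  move=> h; apply: (goes_le _ (h _ _ _)).
  - by rewrite leq_mul2r; apply/orP; right; rewrite /cost; lia.
  - by rewrite /stack_need in szH; lia.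
  - by move=> *; lia.
  - by move=> *; lia.
have gk : chunk q x y <= q ^ k by apply: chunk_le; rewrite -expnSr.
(* The final 1 pays for the round that returns from a call. *)
set A := 16 * k.+1 + 4 * q ^ (k - (D - dep)) + 1.
have hA : A + 15 <= cost k.+1 (D - dep).
  by rewrite /A /cost (_ : k.+1 - 1 - (D - dep) = k - (D - dep)) //; lia.
have := @one_call R n pt pt_sorted w q D H W_bound q_gt0 D_lt u u12 dep stk x y
    (chunk q x y) A depD xy yn g0 g_le gq _ _ _ o erefl.
move=> h; apply: (goes_le _ (h _ _ _)).
- by rewrite leq_mul2r hA orbT.
- by rewrite /stack_need in szH; lia.
- move=> {o h} stk' s l r x' y' o szs xy' yn' yx' rs st o1; rewrite /subcalled.
  case: eqP => [eD|/eqP nD].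
    case=> r' h; have := bottom_goes pt_sorted W_bound q_gt0 D_lt u12 xy' yn' h.
    apply: reaches_le; rewrite -mulnn mulnA leq_mul2r /A; apply/orP; right.
    rewrite eD subnn subn0; lia.
  move=> h.
  have dD : D - dep = (D - dep.+1).+1 by lia.
  have sub := @IH dep.+1 (stk' ++ [:: y; chunk q x y; s; l; r]) x' y' o xy' yn' _ _ _.
  apply: (goes_sub (k' := 1) (sub _ _ _) _ _ h).
  + by lia.
  + by lia.
  (* A level occupies two cells for the bottom mark, two for each of at most [q] edges and five for
     the saved registers. *)
  + rewrite size_cat /=; move: szH; rewrite /stack_need dD minnSS mulnS; lia.
  + move=> F G mF pG.
    have ld := @leads_return R n pt w q D H W_bound q_gt0 D_lt u dep stk' y (chunk q x y) s l r
      (G ++ o) (leq_ltn_trans depD D_lt).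
    by apply: (goes_step (k := 0) ld) => //; apply: goes_refl => ? ? ? ?; exists F, G.
  + have : cost k (D - dep.+1) < A.
      by rewrite /cost /A dD (_ : k - 1 - (D - dep.+1) = k - (D - dep.+1).+1); lia.
    by move=> cA; apply: leq_trans (_ : (cost k (D - dep.+1)).+1 * (y' - x') <= _);
      [rewrite mulSn; lia|rewrite leq_mul2r cA orbT].
- move=> {o h} x' y' o xy' yn' yx'.
  apply: (goes_le _ (@IH dep stk x' y' o xy' yn' _ depD _)).
  + rewrite leq_mul2r; apply/orP; right; rewrite /cost /A.
    have : q ^ (k - 1 - (D - dep)) <= q ^ (k - (D - dep)) by rewrite leq_pexp2l //; lia.
    by lia.
  + by lia.
  + apply: leq_trans szH; rewrite leq_add2l /stack_need leq_add2l leq_mul2l; apply/orP; right.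
    by lia.
Qed.

End Recursion.

(** * Both passes *)

Section Output.
Variables (R : realType) (n : nat) (pt : 'I_n -> (R * R)%type).
Notation outs := (seq (nat * nat)).
Notation B := (onside pt).

Lemma B1_below : B 1 = below pt 1%R.
Proof.
apply/funext => a; apply/funext => b; apply/funext => c.
rewrite /onside /orientation /sign_word /below GRing.mul1r; move: (cross _ _ _) => x.
by case: (Order.TotalTheory.ltgtP 0%R x).
Qed.

Lemma B2_below : B 2 = below pt (- 1)%R.
Proof.
apply/funext => a; apply/funext => b; apply/funext => c.
rewrite /onside /orientation /sign_word /below GRing.mulN1r Num.Theory.oppr_gt0.
by move: (cross _ _ _) => x; case: (Order.TotalTheory.ltgtP 0%R x).
Qed.

Lemma maximal_plane_adjacent u F a : maximal_plane (B u) 0 n.-1 F -> a.+1 < n ->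
  (a, a.+1) \in F.
Proof.
move=> [_ F11 _ F13] an; case: (F13 a a.+1); [lia|lia|exact: vis_adj|by []|].
by case=> e /F11[_ _ [h _]]; rewrite /crossing /=; lia.
Qed.

Variables (F1 F2 G1 G2 : outs).
Hypotheses (mF1 : maximal_plane (B 1) 0 n.-1 F1) (mF2 : maximal_plane (B 2) 0 n.-1 F2).
Hypotheses (pG1 : perm_eq G1 [seq e <- F1 | emitted 1 e])
  (pG2 : perm_eq G2 [seq e <- F2 | emitted 2 e]).

Lemma mem_G1 e : (e \in G1) = (e \in F1).
Proof. by rewrite (perm_mem pG1) mem_filter. Qed.

Lemma mem_G2 e : (e \in G2) = (e.2 != e.1.+1) && (e \in F2).
Proof. by rewrite (perm_mem pG2) mem_filter. Qed.

Lemma lt_output e : e \in G2 ++ G1 -> e.1 < e.2.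
Proof.
have [_ F11 _ _] := mF1; have [_ F21 _ _] := mF2.
by rewrite mem_cat mem_G1 mem_G2 => /orP[/andP[_ /F21[_ _ []]]|/F11[_ _ []]].
Qed.

(** A pair in both families with a point in between would have that point strictly on both sides, so
    only path edges are common, and the second pass drops them. *)
Lemma uniq_output : uniq (G2 ++ G1).
Proof.
have [u1 F11 _ _] := mF1; have [u2 F21 _ _] := mF2.
rewrite cat_uniq (perm_uniq pG1) (perm_uniq pG2) !filter_uniq //= andbT.
apply/hasPn => -[a b]; rewrite mem_G1 mem_G2 => /F11[_ _ [/= ab v1]].
apply/negP => /andP[/= nab /F21[_ _ [_ v2]]].
have := v1 a.+1; have := v2 a.+1; rewrite /onside => /= h2 h1.
by have := h1 _ _; have := h2 _ _; case: eqP => [->|_] //; lia.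
Qed.

End Output.

Section Report.
Variables (R : realType) (n : nat) (pt : 'I_n -> (R * R)%type).
Hypothesis pt_sorted : x_sorted pt.

Lemma set2_lt (i j k l : 'I_n) : i < j -> k < l ->
  [set i; j]%SET = [set k; l]%SET -> i = k /\ j = l.
Proof.
move=> ij kl e.
have : i \in [set k; l]%SET by rewrite -e finset.set21.
have : j \in [set k; l]%SET by rewrite -e finset.set22.
have : k \in [set i; j]%SET by rewrite e finset.set21.
have : l \in [set i; j]%SET by rewrite e finset.set22.
rewrite !finset.in_set2 => /orP[] /eqP h1 /orP[] /eqP h2 /orP[] /eqP h3 /orP[] /eqP h4;
  subst; split=> //; lia.
Qed.

Lemma report_of_output F1 F2 G1 G2 (s : state n) :
  maximal_plane (onside pt 1) 0 n.-1 F1 -> maximal_plane (onside pt 2) 0 n.-1 F2 ->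
  perm_eq G1 [seq e <- F1 | emitted 1 e] -> perm_eq G2 [seq e <- F2 | emitted 2 e] ->
  [seq (val e.1, val e.2) | e <- Defs.out s] = G2 ++ G1 ->
  uniq (reported_edges s) /\ triangulation pt [set e in reported_edges s]%SET.
Proof.
move=> mF1 mF2 pG1 pG2 es.
have lt_s e : e \in Defs.out s -> e.1 < e.2.
  move=> h; have : (val e.1, val e.2) \in G2 ++ G1 by rewrite -es map_f.
  exact: (lt_output mF1 mF2 pG1 pG2).
split.
  rewrite map_inj_in_uniq.
    by have := uniq_output mF1 mF2 pG1 pG2; rewrite -es => /map_uniq.
  move=> [i j] [k l] /lt_s /= ij /lt_s /= kl /(set2_lt ij kl)[-> ->] //.
have mF1' := mF1; have mF2' := mF2; rewrite B1_below in mF1'; rewrite B2_below in mF2'.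
apply: (triangulation_of_maximal pt_sorted mF1' mF2').
- move=> i j ij; rewrite finset.in_set; apply/mapP/idP => [[[k l] hkl /= e]|].
    have [e1 e2] := set2_lt ij (lt_s _ hkl) e.
    have : (val i, val j) \in G2 ++ G1 by rewrite -es; apply/mapP; exists (k, l); rewrite ?e1 ?e2.
    rewrite !mem_cat (mem_G1 pG1) (mem_G2 pG2) => /orP[/andP[_ ->]|->] //.
    by rewrite orbT.
  rewrite mem_cat => h; have : (val i, val j) \in G2 ++ G1.
    rewrite mem_cat (mem_G1 pG1) (mem_G2 pG2) /=; case/orP: h => [->|->].
      by rewrite orbT.
    (* A path edge of the second family was reported in the first pass. *)
    rewrite andbT; case: eqP => //= e; rewrite e.
    by apply: (maximal_plane_adjacent mF1); have := ltn_ord j; move: e => /= ->.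
  rewrite -es => /mapP[[k l] hkl [ek el]]; exists (k, l) => //=.
  by rewrite (val_inj ek) (val_inj el).
- move=> e; rewrite finset.in_set => /mapP[[k l] hkl ->] /=.
  by exists k, l; split=> //; apply: (lt_s _ hkl).
Qed.

End Report.

Definition prog (pre : seq instr) : program :=
  compile (size pre).+1 0 (seqs pre Ret) ++ compile (size pre).+1 (size pre).+1 body.

Lemma size_seqs pre : cmd_size (seqs pre Ret) = (size pre).+1.
Proof. by elim: pre => //= i pre ->. Qed.

(** * The complete run of the machine *)

Section Machine.
Variables (R : realType) (n : nat) (pt : 'I_n -> (R * R)%type).
Hypothesis pt_sorted : x_sorted pt.
Hypothesis n_gt0 : 0 < n.
Variables (w q D H k : nat).
Let W := 2 ^ w.
Hypothesis W_bound : 4 * n + q + H + 100 < W.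
Hypothesis q_gt0 : 0 < q.
Hypothesis D_lt : D < W.
Hypothesis n_le : n.-1 <= q ^ k.
Hypothesis H_ge : stack_need q k D <= H.
Notation outs := (seq (nat * nat)).
Notation goes := (goes pt w).
Notation Post := (Post pt).
Notation cfg := (seq nat -> seq nat -> outs -> Prop).

Definition pass_start (u : nat) (o : outs) : cfg := fun rs st o1 => exists g l,
  main_state n q D H u 0 [:: 0; 0] 0 g 1 l n.-1 1 o rs st o1.

Lemma pass_goes u o : (u == 1) || (u == 2) ->
  goes (cost q k D * n.-1 + 1) (pass_start u o) (Post u 0 n.-1 (return_state n q D H u 0 [::]) o).
Proof.
move=> u12 rs st o1 [g [l h]].
have H9 : 9 <= H by move: H_ge; rewrite /stack_need; lia.
have n1 : n.-1 < n by lia.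
have ld := @leads_finish R n pt w q D H W_bound q_gt0 D_lt u 0 [::] 0 0 0 g 1 l n.-1 o
  (leq_trans (isT : 7 <= 9) H9) isT isT n1.
rewrite /after_finish /= in ld.
have st1 : goes (cost q k D * n.-1) (if 0 < n.-1 then entered n q D H u 0 [::] 0 n.-1 o
    else return_state n q D H u 0 [::] o) (Post u 0 n.-1 (return_state n q D H u 0 [::]) o).
  case: ltnP => [n0|n0].
    have := @call_goes R n pt pt_sorted w q D H W_bound q_gt0 D_lt u u12 k 0 [::] 0 n.-1 o n0 n1.
    by rewrite !subn0; apply.
  apply: goes_refl => rs' st' o' h'; exists [::], [::]; split=> //.
  by rewrite (_ : n.-1 = 0); [exact: maximal_plane_nil|lia].
by apply: (goes_step ld st1 _ h); rewrite addn1.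
Qed.

Definition finished : cfg := fun rs st o1 => exists F1 F2 G1 G2,
  [/\ maximal_plane (onside pt 1) 0 n.-1 F1, maximal_plane (onside pt 2) 0 n.-1 F2,
    perm_eq G1 [seq e <- F1 | emitted 1 e], perm_eq G2 [seq e <- F2 | emitted 2 e]
  & return_state n q D H 2 0 [::] (G2 ++ G1) rs st o1].

Lemma two_passes : goes (2 * (cost q k D * n.-1) + 3) (pass_start 1 [::]) finished.
Proof.
have H2 : 2 <= H by move: H_ge; rewrite /stack_need; lia.
have run2 G1 : goes (cost q k D * n.-1 + 2) (return_state n q D H 1 0 [::] G1)
    (Post 2 0 n.-1 (return_state n q D H 2 0 [::]) G1).
  have ld := @leads_next_pass R n pt w q D H W_bound q_gt0 D_lt 0 [::] G1 erefl erefl H2 n_gt0.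
  by apply: (goes_step (k := cost q k D * n.-1 + 1) ld (@pass_goes 2 G1 isT)); lia.
apply: (goes_sub (k' := cost q k D * n.-1 + 2) (@pass_goes 1 [::] isT)); last by lia.
move=> F1 G1 mF1 pG1; rewrite cats0.
apply: (goes_sub (k' := 0) (run2 G1)); last by lia.
move=> F2 G2 mF2 pG2; apply: goes_refl => rs st o1 h.
by exists F1, F2, G1, G2.
Qed.

Variable pre : seq instr.
Notation P := (prog pre).
Notation start := (size pre).+1.
Notation at_config := (at_config w nreg).

Lemma W_gt2 : 2 < 2 ^ w. Proof. by rewrite -/W; lia. Qed.

Lemma code_body : code_at P start (compile start start body).
Proof.
move=> m hm; rewrite /prog nth_cat size_compile size_seqs ltnNge leq_addr /=.
by rewrite addKn.
Qed.

Lemma code_pre : code_at P 0 (compile start 0 (seqs pre Ret)).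
Proof. by move=> m hm; rewrite add0n /prog nth_cat hm. Qed.

Lemma reaches_run m Y rs st o (s : state n) : reaches pt w m Y rs st o ->
  at_config start rs st o s -> exists t s' rs' st' out',
  [/\ t <= m * cmd_size body, run pt w P t s = Some s', at_config start rs' st' out' s'
    & Y rs' st' out'].
Proof.
(* The size of the body is abstracted so that it is not evaluated. *)
have [c ec] : exists c, c = cmd_size body by exists (cmd_size body).
rewrite -ec; elim: m rs st o s => [|m IH] rs st o s; (case; [move=> h hs|]) => //;
  try by exists 0, s, rs, st, o; split.
move=> h hs.
have [t [b [s' [rs' [st' [out' [ht hr [eb hQ] [pc' [hc ep]]]]]]]]] :=
  wp_sound W_gt2 code_body body_ok hs h.
rewrite -ec in ht; rewrite eb in ep; subst pc'.
have [t2 [s2 [rs2 [st2 [out2 [ht2 hr2 hc2 hY]]]]]] := IH _ _ _ _ hQ hc.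
exists (t + t2), s2, rs2, st2, out2; split=> //; first by rewrite mulSn leq_add.
by rewrite (run_addn _ hr).
Qed.

Variable args : seq nat.
Hypothesis args_le : size args <= nreg.
Hypothesis pre_ok : cmd_ok nreg (seqs pre Ret).
Hypothesis pre_wp : wp pt w nreg (seqs pre Ret)
  ([seq a %% W | a <- args] ++ nseq (nreg - size args) 0) (nseq H 0) [::]
  (fun b rs st o => b = false /\ pass_start 1 [::] rs st o).

Theorem program_correct : exists2 t,
  t <= start + (2 * (cost q k D * n.-1) + 4) * cmd_size body &
  reports_triangulation pt w P args t (nreg + H).
Proof.
have hs : at_config 0 ([seq a %% W | a <- args] ++ nseq (nreg - size args) 0) (nseq H 0) [::]
    (init n w args (nreg + H)).
  split=> //=.
  - by rewrite -catA -nseqD addnBAC.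
  - by rewrite size_cat size_map size_nseq subnKC.
  - rewrite !all_cat all_map !all_nseq expn_gt0 /= !orbT !andbT.
    by apply/allP => a _ /=; rewrite ltn_mod expn_gt0.
have [t1 [b [s1 [rs1 [st1 [out1 [ht1 hr1 [eb h1] [pc' [hc1 ec]]]]]]]]] :=
  wp_sound W_gt2 code_pre pre_ok hs pre_wp.
rewrite eb in ec; subst pc'.
have [t2 [s2 [rs2 [st2 [out2 [ht2 hr2 hc2 [F1 [F2 [G1 [G2 [mF1 mF2 pG1 pG2 h2]]]]]]]]]]] :=
  reaches_run (two_passes h1) hc1.
have eo2 : out2 = G2 ++ G1 by case: h2 => ? [? [? [? [? [? [? [? [? [? [? [? []]]]]]]]]]]].
have hw := @wp_stop R n pt w q D H 2 0 [::] (G2 ++ G1) rs2 st2 out2 isT erefl h2.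
have [t3 [b3 [s3 [rs3 [st3 [out3 [ht3 hr3 [eb3 eo3] [pc3 [hc3 hh]]]]]]]]] :=
  wp_sound W_gt2 code_body body_ok hc2 hw.
rewrite eb3 in hh.
exists (t1 + (t2 + t3)).
  rewrite -size_seqs; apply: leq_add => //; apply: leq_trans (leq_add ht2 ht3) _.
  by rewrite (addnS _ 3) mulSn addnC.
split; first by rewrite (leq_trans args_le) ?leq_addr.
have [ur tr] : uniq (reported_edges s3) /\
    triangulation pt [set e in reported_edges s3]%SET.
  apply: (report_of_output pt_sorted mF1 mF2 pG1 pG2).
  by case: hc3 => _ _ _ _ ->; rewrite eo3.
by exists s3; split=> //; rewrite (run_addn _ hr1) (run_addn _ hr2).
Qed.

End Machine.

(** * Resource bounds *)

(** Memory starts as zeros, so the bottom mark [(0, 0)] is already in place and only the stack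
    pointer moves past it. *)
Definition setup : seq instr :=
  [:: Const 3 1; Const 4 1; Const 5 2; Const 7 (nreg + 2); Const 12 1; Op Osub 14 0 4;
      Const 15 1].

Lemma wp_setup (R : realType) n (pt : 'I_n -> (R * R)%type) w q D H : 0 < n -> 2 <= H ->
  100 < 2 ^ w ->
  wp pt w nreg (seqs setup Ret) [:: n, q, D & nseq 23 0] (nseq H 0) [::]
    (fun b rs st o => b = false /\ pass_start n q D H 1 [::] rs st o).
Proof.
move=> n0 H2 W100; rewrite /setup /nreg /=; do 5 (split; first by lia).
split=> //; split; first by lia.
split=> //; exists 0, 0, 0, 0, 0, 0, 0, 0; split=> //; first exact: size_nseq.
exists (nseq (H - 2) 0), 0, 0, 0, 0; rewrite subn1; split=> //.
by case: H H2 => [|[|H]] // _; rewrite subn2.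
Qed.

(** Words must hold every stack address, and the stack is estimated crudely by a quadratic bound in
    [n]; the factor 8 leaves room for it and its constants. *)
Lemma word_bound n : let M := 2 ^ (trunc_log 2 n).+1 in
  [/\ n < M, 2 <= M & 64 * M ^ 2 <= 2 ^ word_size 8 n].
Proof.
move=> M; have h1 : n < M by apply: trunc_log_ltn.
have h2 : 2 <= M by rewrite -{1}(expn1 2) leq_exp2l.
split=> //; rewrite /word_size (mulnC 8) expnM -/M; move: (M) h2 => m h2.
have -> : m ^ 8 = m ^ 6 * m ^ 2 by rewrite -expnD.
by rewrite leq_mul2r -[64]/(2 ^ 6) leq_exp2r // h2 orbT.
Qed.

(** The second argument arrives in the register of [q]: [setup_b] moves it to the depth limit and
    puts 2 in its place, [setup_c] keeps it and takes [n] as the limit. *)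
Definition setup_a : seq instr := Const 1 2 :: setup.
Definition setup_b : seq instr := Copy 2 1 :: Const 1 2 :: setup.
Definition setup_c : seq instr := Copy 2 0 :: setup.

Section Runs.
Variables (R : realType) (n : nat) (pt : 'I_n -> (R * R)%type).
Hypothesis n_gt0 : 0 < n.
Hypothesis pt_sorted : x_sorted pt.
Let L := (trunc_log 2 n).+1.
Let w := word_size 8 n.

Lemma n_le_expL : n.-1 <= 2 ^ L.
Proof. have [h _ _] := word_bound n; rewrite /L; lia. Qed.

Lemma word_gt m : m <= 2 * n ^ 2 + 20 * n + 120 -> m < 2 ^ w.
Proof.
have [h1 h2 h3] := word_bound n; move=> hm; apply: leq_trans h3; rewrite -/L.
have : n.+1 ^ 2 <= (2 ^ L) ^ 2 by rewrite leq_exp2r.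
by rewrite -!mulnn; nia.
Qed.

Lemma run_a : exists2 t, t <= (size setup_a).+1 + (2 * (cost 2 L 0 * n.-1) + 4) * cmd_size body &
  reports_triangulation pt w (prog setup_a) [:: n] t (nreg + 13).
Proof.
have nW : n < 2 ^ w by apply: word_gt; nia.
apply: (@program_correct R n pt pt_sorted n_gt0 w 2 0 13 L) => //.
- by apply: word_gt; nia.
- by apply: leq_ltn_trans nW.
- exact: n_le_expL.
- rewrite (_ : _ ++ _ = [:: n & nseq 25 0]); last by rewrite /= modn_small.
  split; first by apply: word_gt; lia.
  by apply: (@wp_setup R n pt w 2 0 13) => //; apply: word_gt; lia.
Qed.

Lemma exp_logL : 2 ^ (L - 1) <= n.
Proof. by rewrite /L subn1; apply: trunc_logP. Qed.

Lemma L_le : L <= n.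
Proof.
have := exp_logL; have : L - 1 < 2 ^ (L - 1) by apply: ltn_expl.
by rewrite /L; lia.
Qed.

Lemma bound_a a c t : t <= a + (2 * (cost 2 L 0 * n.-1) + 4) * c ->
  t <= (a + 76 * c) * n ^ 2.
Proof.
have := exp_logL; have := L_le; rewrite /cost subn0 => hL hE ht.
apply: leq_trans ht _; rewrite (mulnDl a); apply: leq_add.
  by rewrite leq_pmulr ?expn_gt0 ?n_gt0.
apply: (@leq_trans (76 * n ^ 2 * c)); last by rewrite -mulnA (mulnC _ c) mulnA.
rewrite leq_mul2r; apply/orP; right.
apply: (@leq_trans (2 * ((16 * n.+1 + 4 * n) * n.-1) + 4)).
  by rewrite leq_add2r leq_mul2l leq_mul2r; apply/orP; right; apply/orP; right; lia.
by case: (n) n_gt0 => // m _; rewrite -mulnn /=; nia.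
Qed.

(** Correctness is claimed for every [s], also one that does not fit in a word; the truncated value
    is then the depth limit. *)
Lemma run_b s : exists2 t,
  t <= (size setup_b).+1 + (2 * (cost 2 L (s %% 2 ^ w) * n.-1) + 4) * cmd_size body &
  reports_triangulation pt w (prog setup_b) [:: n; s] t (nreg + stack_need 2 L (s %% 2 ^ w)).
Proof.
have nW : n < 2 ^ w by apply: word_gt; nia.
have hL := L_le.
have W_gt0 : 0 < 2 ^ w by rewrite expn_gt0.
apply: (@program_correct R n pt pt_sorted n_gt0 w 2 (s %% 2 ^ w) _ L) => //.
- by apply: word_gt; rewrite /stack_need; have := geq_minl L (s %% 2 ^ w); nia.
- by rewrite ltn_mod.
- exact: n_le_expL.
- rewrite (_ : _ ++ _ = [:: n, s %% 2 ^ w & nseq 24 0]); last by rewrite /= modn_small.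
  split; first by apply: word_gt; lia.
  by apply: (@wp_setup R n pt w 2 (s %% 2 ^ w)) => //; apply: word_gt; lia.
Qed.

Lemma run_c p : 2 <= p -> p <= n -> exists2 t,
  t <= (size setup_c).+1 + (2 * (cost p (up_log p n) n * n.-1) + 4) * cmd_size body &
  reports_triangulation pt w (prog setup_c) [:: n; p] t (nreg + stack_need p (up_log p n) n).
Proof.
move=> p2 pn; have nW : n < 2 ^ w by apply: word_gt; nia.
have pW : p < 2 ^ w by apply: leq_ltn_trans pn nW.
have hk := up_logP n p2.
apply: (@program_correct R n pt pt_sorted n_gt0 w p n _ (up_log p n)) => //.
- apply: word_gt; rewrite /stack_need; have := geq_minr (up_log p n) n.
  by move: (minn _ _) => m mn; nia.
- by lia.
- by lia.
- rewrite (_ : _ ++ _ = [:: n, p & nseq 24 0]); last by rewrite /= !modn_small.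
  by apply: (@wp_setup R n pt w p n) => //; [rewrite /stack_need; lia|apply: word_gt; lia].
Qed.

Lemma bound_c a c p k t : 1 <= k -> k <= n ->
  t <= a + (2 * (cost p k n * n.-1) + 4) * c ->
  t <= (a + 76 * c) * (n * k).
Proof.
(* Since [k <= n], the exponent truncates to zero and the quadratic share per path edge is
   constant. *)
move=> k0 kn; rewrite /cost (_ : k - 1 - n = 0); last by lia.
move=> ht; apply: leq_trans ht _; rewrite (mulnDl a); apply: leq_add.
  by rewrite leq_pmulr // muln_gt0 n_gt0.
apply: (@leq_trans (76 * (n * k) * c)); last by rewrite -mulnA (mulnC _ c) mulnA.
rewrite leq_mul2r; apply/orP; right.
by case: (n) (k) n_gt0 k0 => // m [|j] // _ _; rewrite expn0 /=; nia.
Qed.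

Lemma memory_c p k : 2 <= p -> 1 <= k -> nreg + stack_need p k n <= 26 * (p * k).
Proof.
move=> p2 k0; rewrite /stack_need /nreg; have := geq_minl k n; move: (minn _ _) => m mk.
have : (2 * p + 7) * m <= (2 * p + 7) * k by rewrite leq_mul2l mk orbT.
by move=> h; nia.
Qed.

(** The quadratic share shrinks by the factor [2 ^ s]; the share of the levels, logarithmic per path
    edge, is absorbed because [2 ^ s <= n]. *)
Lemma bound_b a c s t : s < L ->
  t <= a + (2 * (cost 2 L s * n.-1) + 4) * c ->
  t * 2 ^ s <= (a + 44 * c) * (n ^ 2 * L.+1).
Proof.
move=> sL ht; apply: leq_trans (leq_mul ht (leqnn _)) _.
have es : 2 ^ (L - 1 - s) * 2 ^ s <= n by rewrite -expnD subnK; [exact: exp_logL|lia].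
have s_le : 2 ^ s <= n.
  by apply: leq_trans exp_logL; rewrite leq_exp2l //; lia.
have hX : (2 * (cost 2 L s * n.-1) + 4) * 2 ^ s <= 44 * (n ^ 2 * L.+1).
  rewrite /cost; move: (2 ^ (L - 1 - s)) (2 ^ s) es s_le => x y xy yn.
  case: (n) n_gt0 xy yn => // m _ xy yn; rewrite -mulnn /=.
  have : L.+1 * (m * y) <= L.+1 * (m * m.+1) by rewrite leq_mul2l leq_mul2l yn !orbT.
  have : m * (x * y) <= m * m.+1 by rewrite leq_mul2l xy orbT.
  by nia.
have hy : 2 ^ s <= n ^ 2 * L.+1 by rewrite -mulnn; nia.
move: (2 * _ + 4) (2 ^ s) (n ^ 2 * L.+1) hX hy => X y Z hX hy.
rewrite (mulnDl a (X * c) y) (mulnDl a (44 * c) Z); apply: leq_add.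
  by rewrite leq_mul2l hy orbT.
by rewrite (mulnAC X) (mulnAC 44) leq_mul2r hX orbT.
Qed.

End Runs.

(** * Logarithms and the growth conditions on [s] *)

Section Logarithms.
Variable R : realType.
Import Order.TTheory GRing.Theory Num.Theory numFieldNormedType.Exports.
Local Open Scope classical_set_scope.
Local Open Scope ring_scope.

Lemma ln_natX (p k : nat) : (0 < p)%N -> ln ((p ^ k)%N%:R : R) = k%:R * ln p%:R.
Proof. by move=> p0; rewrite natrX lnXn ?ltr0n // mulr_natl. Qed.

Lemma le_ln_nat (a b : nat) : (0 < a)%N -> (a <= b)%N -> ln (a%:R : R) <= ln b%:R.
Proof.
move=> a0 ab; rewrite ler_ln ?ler_nat // posrE ltr0n //; exact: leq_trans ab.
Qed.

Lemma lt_ln_nat (a b : nat) : (0 < a)%N -> (a < b)%N -> ln (a%:R : R) < ln b%:R.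
Proof.
move=> a0 ab; rewrite ltr_ln ?ltr_nat // posrE ltr0n //; exact: ltn_trans ab.
Qed.

Lemma ln2_gt0 : 0 < ln (2%:R : R).
Proof. by rewrite ln_gt0 // ltr1n. Qed.

Lemma trunc_log_le (n : nat) : (0 < n)%N -> (trunc_log 2 n)%:R * ln 2%:R <= ln (n%:R : R).
Proof. by move=> n0; rewrite -ln_natX // le_ln_nat ?expn_gt0 // trunc_logP. Qed.

Lemma trunc_log_gt (n : nat) : (0 < n)%N -> ln (n%:R : R) < (trunc_log 2 n).+1%:R * ln 2%:R.
Proof. by move=> n0; rewrite -ln_natX // lt_ln_nat // trunc_log_ltn. Qed.

(** For [p <= n] the logarithm is at least 1, so rounding up at most doubles it. *)
Lemma up_log_le (p n : nat) : (2 <= p <= n)%N ->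
  (up_log p n)%:R <= 2%:R * log_base R p n.
Proof.
move=> /andP[p2 pn]; have n2 := leq_trans p2 pn.
have lp : 0 < ln (p%:R : R) by rewrite ln_gt0 // ltr1n.
have h1 : ln (p%:R : R) <= ln n%:R by apply: le_ln_nat => //; lia.
have k0 : (0 < up_log p n)%N by rewrite up_log_gt0 p2.
have h2 : (up_log p n).-1%:R * ln p%:R <= ln (n%:R : R).
  rewrite -ln_natX; last by lia.
  by apply: le_ln_nat; [rewrite expn_gt0; lia|apply/ltnW/up_log_gtn].
rewrite /log_base mulrA ler_pdivlMr // -(prednK k0) -addn1 natrD.
by move: h1 h2; rewrite mulrDl mul1r; lra.
Qed.

Lemma large_bounds (s : nat -> nat) :
  (fun n => (s n)%:R : R^o) =Omega_\oo (fun n => ln (ln n%:R) : R^o) ->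
  (fun n => (s n)%:R : R^o) =o_\oo (fun n => ln n%:R : R^o) ->
  exists N, forall n, (N <= n)%N ->
    [/\ (0 < s n)%N, (s n < (trunc_log 2 n).+1)%N & (2 <= n)%N].
Proof.
rewrite eqOmegaE => /asboolP[K K0 [N1 _ H1]].
(* This epsilon bounds [s n] by half of the binary logarithm. *)
move=> /eqoP/(_ (2%:R * ln 2%:R)^-1); rewrite invr_gt0 mulr_gt0 ?ln2_gt0 ?ltr0n // => /(_ isT).
case=> N2 _ H2.
(* Beyond [e] the iterated logarithm is positive, so the lower growth bound excludes [s n = 0]. *)
exists (N1 + N2 + (Num.truncn (expR (1 : R))).+2)%N => n hn.
have {}H1 := H1 n ltac:(rewrite /=; lia); have {}H2 := H2 n ltac:(rewrite /=; lia).
have n2 : (2 <= n)%N by lia.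
have n0 : (0 < n)%N by lia.
have en : expR (1 : R) < n%:R.
  apply: lt_le_trans (truncnS_gt _) _; rewrite ler_nat.
  by apply: leq_trans hn; apply: leq_trans (leq_addl _ _); apply: leqnSn.
have ln1 : 1 < ln (n%:R : R).
  by rewrite -[X in X < _](expRK 1) ltr_ln ?posrE ?expR_gt0 ?ltr0n.
split=> //.
  rewrite lt0n; apply/eqP => s0; move: H1 => /=.
  rewrite s0 normr0 real_leNgt ?num_real // => /negP; apply.
  by rewrite mulr_gt0 // normr_gt0 gt_eqF // ln_gt0.
move: H2 => /=; rewrite normr_nat ger0_norm; last by apply: ltW; apply: lt_trans ln1.
have := trunc_log_gt n0; have l2 := ln2_gt0.
move=> h1; rewrite ler_pdivlMl ?mulr_gt0 ?ltr0n // => h2.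
have : (s n)%:R * 2%:R < (trunc_log 2 n).+1%:R :> R.
  rewrite -(ltr_pM2r l2); apply: le_lt_trans h1; apply: le_trans h2.
  by rewrite -mulrA mulrC.
rewrite -natrM ltr_nat; lia.
Qed.

End Logarithms.

(** * The three resource bounds *)

Section Bounds.
Variable R : realType.
Import Order.TTheory GRing.Theory Num.Theory numFieldNormedType.Exports.
Local Open Scope classical_set_scope.
Local Open Scope ring_scope.

Lemma part_a : exists (P : program) (c : nat) (C : R), (0 < c)%N /\
  forall (n : nat) (pt : 'I_n -> R * R), (0 < n)%N -> x_sorted pt ->
  exists t v : nat,
    [/\ reports_triangulation pt (word_size c n) P [:: n] t v,
        t%:R <= C * n%:R ^+ 2
      & v%:R <= C].
Proof.
exists (prog setup_a), 8%N, ((size setup_a).+1 + 76 * cmd_size body + (nreg + 13))%N%:R.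
split=> // n pt n0 srt; have [t ht hr] := run_a n0 srt.
exists t, (nreg + 13)%N; split=> //; last by rewrite ler_nat leq_addl.
have {}ht := bound_a n0 ht.
rewrite -natrX -natrM ler_nat; apply: leq_trans ht _.
by rewrite leq_mul2r leq_addr orbT.
Qed.

Lemma part_b : exists (P : program) (c : nat), (0 < c)%N /\
  forall s : nat -> nat,
  (fun n => (s n)%:R : R^o) =Omega_\oo (fun n => ln (ln n%:R) : R^o) ->
  (fun n => (s n)%:R : R^o) =o_\oo (fun n => ln n%:R : R^o) ->
  exists (C : R) (N : nat),
  forall (n : nat) (pt : 'I_n -> R * R), (0 < n)%N -> x_sorted pt ->
  exists t v : nat,
    reports_triangulation pt (word_size c n) P [:: n; s n] t v /\
    ((N <= n)%N ->
      t%:R <= C * (n%:R ^+ 2 * ln n%:R / 2 ^+ s n) /\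
      v%:R <= C * (s n)%:R).
Proof.
exists (prog setup_b), 8%N; split=> // s s_Omega s_o.
have [N HN] := large_bounds s_Omega s_o.
set K := ((size setup_b).+1 + 44 * cmd_size body)%N.
(* The factor 3 compares [trunc_log 2 n + 2] with the logarithm for [n >= 2]. The 50 is
   [26 + 13 + 11]: registers, fixed part of the stack and cells per level, using [1 <= s n]. *)
exists (K%:R * 3%:R / ln 2%:R + 50%:R), N => n pt n0 srt.
have [t ht hr] := run_b n0 srt (s n).
exists t, (nreg + stack_need 2 (trunc_log 2 n).+1 (s n %% 2 ^ word_size 8 n))%N; split=> // Nn.
have [s0 sL n2] := HN n Nn.
have sW : (s n %% 2 ^ word_size 8 n = s n)%N.
  apply: modn_small; apply: (leq_trans sL); apply: leq_trans (L_le n0) _.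
  by apply/ltnW/word_gt => //; nia.
have l2 := ln2_gt0 R.
have C1 : 0 <= K%:R * 3%:R / ln 2%:R :> R by rewrite !mulr_ge0 ?ler0n // invr_ge0 ltW.
split; last first.
  apply: (@le_trans _ _ (50%:R * (s n)%:R)); last by rewrite ler_wpM2r ?ler0n // lerDr.
  rewrite -natrM ler_nat sW /stack_need /nreg.
  have := geq_minr (trunc_log 2 n).+1 (s n); lia.
rewrite sW in ht; have {}ht := bound_b n0 sL ht.
have p2 : 0 < 2%:R ^+ s n :> R by rewrite exprn_gt0 // ltr0n.
rewrite mulrA ler_pdivlMr //.
have ht' : t%:R * 2%:R ^+ s n <= K%:R * (n%:R ^+ 2 * (trunc_log 2 n).+2%:R) :> R.
  by rewrite -!natrX -!natrM ler_nat.
apply: le_trans ht' _.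
have hl : (trunc_log 2 n).+2%:R <= 3%:R / ln 2%:R * ln n%:R :> R.
  rewrite mulrAC ler_pdivlMr //; have h := trunc_log_le R n0.
  apply: (@le_trans _ _ (3%:R * ((trunc_log 2 n)%:R * ln 2%:R))); last by rewrite ler_wpM2l.
  rewrite mulrA; apply: ler_wpM2r; first exact: ltW.
  rewrite -natrM ler_nat.
  have : (0 < trunc_log 2 n)%N by rewrite trunc_log_gt0.
  by lia.
apply: (@le_trans _ _ (K%:R * (n%:R ^+ 2 * (3%:R / ln 2%:R * ln n%:R)))).
  by rewrite ler_wpM2l ?ler0n // ler_wpM2l // exprn_ge0 ?ler0n.
have ln0 : 0 <= ln (n%:R : R) by rewrite ln_ge0 // ler1n.
have h50 : 0 <= 50%:R * (n%:R ^+ 2 * ln n%:R) :> R.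
  by rewrite !mulr_ge0 ?ler0n ?exprn_ge0 ?ler0n.
have -> : K%:R * (n%:R ^+ 2 * (3%:R / ln 2%:R * ln n%:R)) =
  (K%:R * 3%:R / ln 2%:R) * (n%:R ^+ 2 * ln n%:R) :> R by ring.
by rewrite (mulrDl (K%:R * 3%:R / ln 2%:R)) lerDl.
Qed.

Lemma part_c : exists (P : program) (c : nat) (C : R), (0 < c)%N /\
  forall (n p : nat) (pt : 'I_n -> R * R), (2 <= p <= n)%N -> x_sorted pt ->
  exists t v : nat,
    [/\ reports_triangulation pt (word_size c n) P [:: n; p] t v,
        t%:R <= C * (n%:R * log_base R p n)
      & v%:R <= C * (p%:R * log_base R p n)].
Proof.
set K := ((size setup_c).+1 + 76 * cmd_size body)%N.
exists (prog setup_c), 8%N, ((K + 26) * 2)%N%:R; split=> // n p pt pn srt.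
have hl := up_log_le R pn; have [p2 pn'] := andP pn.
have n0 : (0 < n)%N by lia.
have [t ht hr] := run_c n0 srt p2 pn'.
have k0 : (0 < up_log p n)%N by rewrite up_log_gt0 p2 (leq_trans p2).
have kn : (up_log p n <= n)%N.
  by apply: up_log_min => //; apply/ltnW/ltn_expl.
exists t, (nreg + stack_need p (up_log p n) n)%N; split=> //.
  have {}ht := bound_c n0 k0 kn ht.
  apply: (@le_trans _ _ (K%:R * (n%:R * (up_log p n)%:R))).
    by rewrite -!natrM ler_nat.
  rewrite natrM -mulrA ler_pM ?mulr_ge0 ?ler0n ?ler_nat ?leq_addr //.
  by rewrite mulrCA ler_wpM2l ?ler0n.
have hv := memory_c n0 p2 k0.
apply: (@le_trans _ _ (26%:R * (p%:R * (up_log p n)%:R))).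
  by rewrite -!natrM ler_nat.
rewrite natrM -mulrA ler_pM ?mulr_ge0 ?ler0n ?ler_nat ?leq_addl //.
by rewrite mulrCA ler_wpM2l ?ler0n.
Qed.

End Bounds.

Import Order.TTheory GRing.Theory Num.Theory.
Import numFieldNormedType.Exports.

Local Open Scope classical_set_scope.
Local Open Scope ring_scope.

Theorem theorem2p3 (R : realType) :
  (* (a) *)
  (exists (P : program) (c : nat) (C : R), (0 < c)%N /\
    forall (n : nat) (pt : 'I_n -> R * R), (0 < n)%N -> x_sorted pt ->
    exists t v : nat,
      [/\ reports_triangulation pt (word_size c n) P [:: n] t v,
          t%:R <= C * n%:R ^+ 2
        & v%:R <= C])
  /\
  (* (b) *)
  (exists (P : program) (c : nat), (0 < c)%N /\
    forall s : nat -> nat,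
    (fun n => (s n)%:R : R^o) =Omega_\oo (fun n => ln (ln n%:R) : R^o) ->
    (fun n => (s n)%:R : R^o) =o_\oo (fun n => ln n%:R : R^o) ->
    exists (C : R) (N : nat),
    forall (n : nat) (pt : 'I_n -> R * R), (0 < n)%N -> x_sorted pt ->
    exists t v : nat,
      reports_triangulation pt (word_size c n) P [:: n; s n] t v /\
      ((N <= n)%N ->
        t%:R <= C * (n%:R ^+ 2 * ln n%:R / 2 ^+ s n) /\
        v%:R <= C * (s n)%:R))
  /\
  (* (c) *)
  (exists (P : program) (c : nat) (C : R), (0 < c)%N /\
    forall (n p : nat) (pt : 'I_n -> R * R), (2 <= p <= n)%N -> x_sorted pt ->
    exists t v : nat,
      [/\ reports_triangulation pt (word_size c n) P [:: n; p] t v,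
          t%:R <= C * (n%:R * log_base R p n)
        & v%:R <= C * (p%:R * log_base R p n)]).
Proof. by split; [exact: part_a|split; [exact: part_b|exact: part_c]]. Qed.
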